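(* Let $(G,\pi)$ be a parity game, $\tau$ a strategy for Odd, $T$ the succinct $(n,d/2)$-universal tree, and $\mu:V\to\bar L(T)$ a node labeling such that $G_\tau$ has no loose arcs with respect to $\mu$. Then $\mu^{\mathcal{G}^\uparrow_\tau}$ can be computed in $O(mn^2\log n\log d)$ time.
   Context: A parity game: finite directed graph $G=(V,E)$, every node with an outgoing arc, $V=V_0\sqcup V_1$, priorities $\pi:V\to\{1,\dots,d\}$, $d$ even, $n=|V|$, $m=|E|$. A strategy for Odd is $\tau:V_1\to V$ with $v\tau(v)\in E$; $G_\tau=(V,E_\tau)$ with $E_\tau=\{vw\in E:v\in V_0\}\cup\{v\tau(v):v\in V_1\}$. An Even strategy $\sigma:V_0\to V$ gives $G_\sigma$ (all arcs out of $V_1$, only $v\sigma(v)$ out of $v\in V_0$). Ordered trees: prefix-closed sets of tuples over a linearly ordered set, viewed as rooted trees, ordered lexicographically; leaves of a height-$h$ tree are at depth $h$, written $\xi=(\xi_{2h-1},\dots,\xi_1)$; $\xi|_p$ deletes components with index $<p$; $\bar L(T)=L(T)\cup\{\top\}$, $\top$ maximal, $\top|_p=\top$. The succinct $(n,h)$-universal tree: binary strings ordered by $0s<\varepsilon<1s'$, $bs<bs'\iff s<s'$; leaves are all $h$-tuples of binary strings with at most $\lfloor\log_2 n\rfloor$ bits in total; the tree consists of all prefixes. For a labeling $\mu:V\to\bar L(T)$: arc $vw$ non-violated if ($\pi(v)$ even and $\mu(v)|_{\pi(v)}\ge\mu(w)|_{\pi(v)}$) or ($\pi(v)$ odd and ($\mu(v)|_{\pi(v)}>\mu(w)|_{\pi(v)}$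 or $\mu(v)=\mu(w)=\top$)); violated otherwise; tight if $\mu(v)$ is the smallest element of $\bar L(T)$ making $vw$ non-violated when substituted for $\mu(v)$; loose if neither. $\mu$ is feasible in $G_\tau$ if some Even strategy $\sigma$ makes all arcs of $G_\tau\cap G_\sigma$ non-violated. $\mu^{\mathcal{G}^\uparrow_\tau}$ is the pointwise least labeling $\nu\ge\mu$ feasible in $G_\tau$ (it exists). *)

(* Defs.v *)
From HB Require Import structures.
From mathcomp Require Import all_boot.

Set Implicit Arguments.
Unset Strict Implicit.
Unset Printing Implicit Defensive.

(** * Parity games and strategies *)

Record parity_game := ParityGame {
  node :> finType;
  edges : {set node * node};
  even_nodes : {set node};
  maxprio : nat;
  prio : node -> nat;
  has_succ : forall v : node, exists w : node, (v, w) \in edges;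
  maxprio_even : ~~ odd maxprio;
  prio_bounds : forall v : node, 0 < prio v <= maxprio }.

Section Strategies.
Variable G : parity_game.

Definition odd_nodes : {set G} := ~: even_nodes G.

(* A strategy is a total function on the nodes; only its values on the nodes
   of its owner are meaningful. *)
Definition odd_strategy (tau : G -> G) : Prop :=
  forall v, v \in odd_nodes -> (v, tau v) \in edges G.

Definition even_strategy (sigma : G -> G) : Prop :=
  forall v, v \in even_nodes G -> (v, sigma v) \in edges G.

Definition edges_odd (tau : G -> G) : {set G * G} :=
  [set e in edges G | (e.1 \in even_nodes G) || (e.2 == tau e.1)].

Definition edges_even (sigma : G -> G) : {set G * G} :=
  [set e in edges G | (e.1 \in odd_nodes) || (e.2 == sigma e.1)].

End Strategies.

(** * The succinct universal tree *)

(* The order on binary strings given by 0s < epsilon < 1s'. *)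
Fixpoint bits_lt (s t : bitseq) : bool :=
  match s, t with
  | [::], [::] => false
  | [::], b :: _ => b
  | b :: _, [::] => ~~ b
  | b :: s', c :: t' => if b == c then bits_lt s' t' else c
  end.

Fixpoint lex_lt (s t : seq bitseq) : bool :=
  match s, t with
  | _, [::] => false
  | [::], _ :: _ => true
  | a :: s', b :: t' => bits_lt a b || (a == b) && lex_lt s' t'
  end.

(* Leaves of the succinct (n, h)-universal tree, listed from the root:
   the tuple is (xi_{2h-1}, xi_{2h-3}, ..., xi_1). *)
Definition leaf (n h : nat) :=
  {xi : h.-tuple bitseq | sumn [seq size s | s <- xi] <= trunc_log 2 n}.

(* The indices 2h-1, 2h-3, ..., 1 of the components of a leaf. *)
Definition indices (h : nat) : seq nat := [seq (h - i).*2.-1 | i <- iota 0 h].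

(* [None] stands for the top element. *)
Definition label (n h : nat) := option (leaf n h).

Definition label_seq n h (x : label n h) : option (seq bitseq) :=
  omap (fun xi : leaf n h => tval (val xi)) x.

Definition trunc n h (p : nat) (x : label n h) : option (seq bitseq) :=
  omap (mask [seq p <= i | i <- indices h]) (label_seq x).

Definition top_lt (x y : option (seq bitseq)) : bool :=
  match x, y with
  | None, _ => false
  | Some _, None => true
  | Some s, Some t => lex_lt s t
  end.

Definition top_le (x y : option (seq bitseq)) : bool := (x == y) || top_lt x y.

Definition label_le n h (x y : label n h) : bool :=
  top_le (label_seq x) (label_seq y).

(** * Node labelings *)

Section Labelings.
Variable G : parity_game.

Notation glabel := (label #|G| (maxprio G)./2).

Definition labeling := G -> glabel.

Definition nonviolated (mu : labeling) (v w : G) : bool :=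
  let p := prio v in
  if odd p
  then top_lt (trunc p (mu w)) (trunc p (mu v))
       || (mu v == None) && (mu w == None)
  else top_le (trunc p (mu w)) (trunc p (mu v)).

Definition substitute (mu : labeling) (v : G) (xi : glabel) : labeling :=
  fun u => if u == v then xi else mu u.

Definition tight (mu : labeling) (v w : G) : Prop :=
  nonviolated mu v w /\
  forall xi, nonviolated (substitute mu v xi) v w -> label_le (mu v) xi.

Definition loose (mu : labeling) (v w : G) : Prop :=
  nonviolated mu v w /\ ~ tight mu v w.

Definition feasible (tau : G -> G) (mu : labeling) : Prop :=
  exists sigma, even_strategy sigma /\
    forall v w, (v, w) \in edges_odd tau :&: edges_even sigma ->
      nonviolated mu v w.

Definition labeling_le (mu nu : labeling) : Prop :=
  forall v, label_le (mu v) (nu v).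

Definition is_least_feasible (tau : G -> G) (mu nu : labeling) : Prop :=
  [/\ labeling_le mu nu, feasible tau nu &
      forall nu', labeling_le mu nu' -> feasible tau nu' -> labeling_le nu nu'].

End Labelings.

(** * A word RAM

    Structured programs over unboundedly many registers and an array of cells,
    with unit-cost operations on words.  All words, including addresses and
    intermediate results, have to be at most [W]; a program that exceeds this
    bound, or divides by zero, is stuck and has no execution. *)

Inductive binop := Add | Sub | Mul | Div | Mod | Lt | Eq.

Inductive expr :=
  | Const of nat
  | Reg of nat
  | Cell of expr
  | Bin of binop & expr & expr.

Inductive cmd :=
  | Skip
  | SetReg of nat & expr
  | SetCell of expr & expr
  | Seq of cmd & cmd
  | If of expr & cmd & cmd
  | While of expr & cmd.

Record state := State { regs : nat -> nat; cells : nat -> nat }.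

Definition word (W k : nat) : option nat := if k <= W then Some k else None.

Definition eval_binop (op : binop) (a b : nat) : option nat :=
  match op with
  | Add => Some (a + b)
  | Sub => Some (a - b)
  | Mul => Some (a * b)
  | Div => if b == 0 then None else Some (a %/ b)
  | Mod => if b == 0 then None else Some (a %% b)
  | Lt => Some (nat_of_bool (a < b))
  | Eq => Some (nat_of_bool (a == b))
  end.

Fixpoint eval (W : nat) (s : state) (e : expr) : option nat :=
  match e with
  | Const k => word W k
  | Reg x => word W (regs s x)
  | Cell e1 => obind (fun a => word W (cells s a)) (eval W s e1)
  | Bin op e1 e2 =>
      obind (fun a => obind (fun b => obind (word W) (eval_binop op a b))
        (eval W s e2)) (eval W s e1)
  end.

Fixpoint cost (e : expr) : nat :=
  match e with
  | Const _ | Reg _ => 1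
  | Cell e1 => (cost e1).+1
  | Bin _ e1 e2 => (cost e1 + cost e2).+1
  end.

Definition update (f : nat -> nat) (i k : nat) : nat -> nat :=
  fun j => if j == i then k else f j.

(* [exec W c s s' t]: run from [s], the program [c] halts in [s'] after
   [t] steps. *)
Inductive exec (W : nat) : cmd -> state -> state -> nat -> Prop :=
  | ExecSkip s : exec W Skip s s 1
  | ExecSetReg s x e k : eval W s e = Some k ->
      exec W (SetReg x e) s (State (update (regs s) x k) (cells s)) (cost e).+1
  | ExecSetCell s e1 e2 a k : eval W s e1 = Some a -> eval W s e2 = Some k ->
      exec W (SetCell e1 e2) s (State (regs s) (update (cells s) a k))
        (cost e1 + cost e2).+1
  | ExecSeq c1 c2 s s1 s2 t1 t2 : exec W c1 s s1 t1 -> exec W c2 s1 s2 t2 ->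
      exec W (Seq c1 c2) s s2 (t1 + t2).+1
  | ExecIf e c1 c2 s s' k t : eval W s e = Some k ->
      exec W (if k != 0 then c1 else c2) s s' t ->
      exec W (If e c1 c2) s s' (cost e + t).+1
  | ExecWhileStop e c s : eval W s e = Some 0 ->
      exec W (While e c) s s (cost e).+1
  | ExecWhileStep e c s s1 s2 k t1 t2 : eval W s e = Some k.+1 ->
      exec W c s s1 t1 -> exec W (While e c) s1 s2 t2 ->
      exec W (While e c) s s2 (cost e + t1 + t2).+1.

Lemma exec_functional W c s s1 s2 t1 t2 :
  exec W c s s1 t1 -> exec W c s s2 t2 -> s1 = s2 /\ t1 = t2.
Proof.
move=> H; elim: H s2 t2 => {c s s1 t1}.
all: intros; match goal with H : exec _ _ _ _ _ |- _ => inversion H; subst end.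
all: repeat match goal with
  | H1 : eval ?W ?s ?e = _, H2 : eval ?W ?s ?e = _ |- _ =>
      rewrite H1 in H2; case: H2 => ?; subst
  | IH : (forall s2 t2, exec ?W ?c ?s s2 t2 -> _), H : exec ?W ?c ?s _ _ |- _ =>
      case: (IH _ _ H) => ? ?; clear H; subst
  end; by [].
Qed.

(* The input is stored from cell 0 on, everything else is 0 initially; the
   output is expected from cell 0 on. *)
Definition computes_in (c : cmd) (W t : nat) (input output : seq nat) : Prop :=
  exists s : state,
    exec W c (State (fun=> 0) (nth 0 input)) s t /\
    forall i, i < size output -> cells s i = nth 0 output i.

(** * Encodings

    A leaf is encoded succinctly, as the list of its bits from the root on, each
    one preceded by the index of the component it belongs to.  The list is
    preceded by its length plus one; the top element is encoded as 0. *)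

Definition enc_leaf n h (xi : leaf n h) : seq (nat * bool) :=
  flatten [seq [seq (c.1, b) | b <- c.2] | c <- zip (indices h) (val xi)].

Definition enc_label n h (x : label n h) : seq nat :=
  if x is Some xi then
    (size (enc_leaf xi)).+1 ::
      flatten [seq [:: c.1; nat_of_bool c.2] | c <- enc_leaf xi]
  else [:: 0].

Section Encoding.
Variable G : parity_game.

Definition enc_node (v : G) : nat := enum_rank v.

Definition enc_labeling (mu : labeling G) : seq nat :=
  flatten [seq enc_label (mu v) | v <- enum G].

(* [arcs] lists the arcs of the game, in any order. *)
Definition enc_instance (arcs : seq (G * G)) (tau : G -> G) (mu : labeling G) :
    seq nat :=
  [:: #|G|; size arcs; maxprio G]
  ++ [seq nat_of_bool (v \in odd_nodes G) | v <- enum G]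
  ++ [seq prio v | v <- enum G]
  ++ [seq (if v \in odd_nodes G then enc_node (tau v) else 0) | v <- enum G]
  ++ flatten [seq [:: enc_node e.1; enc_node e.2] | e <- arcs]
  ++ enc_labeling mu.

End Encoding.

(* Main.v *)
(** A label is read as a word of [R.+1] numbers, [R = trunc_log 2 n]: a bit of the
    component [i] of a leaf becomes [d + i] if it is 1 and [d - i] if it is 0, the
    word is padded with [d], and top is the constant word [2d + 1].  Then the order
    of labels is the lexicographic order, and truncation at [p] replaces the tokens
    [t] with [|t - d| < p] by [d]; the least label making an arc non-violated
    ([lift]) is found by scanning one word.

    As no arc is loose, [mu v <= lift (mu w)] along every arc, so lowering labels
    along arcs from above [mu] never goes below [mu].  Let [nu >= mu] be feasible.
    Following its strategy from a node with [nu <> top] leads to a cycle whose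
    highest priority [p], say at [b], is even, and along which [nu] is constant up
    to truncation at [p]; say this truncation has [k] tokens.  Hence [nu b] is at
    least the least label above [mu b] that is minimal in its [p]-subtree and has
    at most [k] tokens of index at least [p], and [n] rounds of Bellman-Ford starting
    from such base labels go below [nu].  Moreover the cycle can be grafted into any
    [p]-subtree with at most [k] tokens above it, because there is more room below
    it; so base labels with at most [k] tokens at [b] remain justified by an outgoing
    arc of [b].  The algorithm keeps for every node a bound [c v] on the number of
    tokens plus one of its base label.  It raises the bounds of all active nodes
    together, after dropping from the active nodes those whose base label is not
    justified; there are at most [n + R + 2] such rounds, each taking time
    [O(n m R)], and at the end the labels computed are the least feasible ones. *)

Require Import Defs.
From mathcomp Require Import all_boot zify.

Set Implicit Arguments.
Unset Strict Implicit.
Unset Printing Implicit Defensive.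

(** * Words of tokens *)

(** Taking the least minimal label above [mu b] as base label would fail: its subtree may leave less
    room than the labels of the cycle need, and then nothing justifies it. A leaf has at most [R]
    tokens, so the room below a subtree is governed by the number of tokens spent above it. This
    number [k] depends on an unknown feasible labeling, hence one bound per node, found by search.
    Grafting makes the search safe: a base label at [b] with [c b <= k + 1] is supported whatever
    the other bounds are, so an unsupported one at the common bound [cur] proves [k + 1 < cur] for
    every even cycle based at [b], and [b] may be frozen for good. Each round thus freezes a node or
    raises [cur], which ends at [R + 2].

    Words are one token longer than the largest leaf, so the last token is always [d]: a position
    remains after all tokens are spent, and top differs from every leaf even for [R = 0]. *)

Fixpoint vlt (x y : seq nat) : bool :=
  match x, y with
  | a :: x', b :: y' => (a < b) || (a == b) && vlt x' y'
  | _, _ => false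
  end.

Definition vle (x y : seq nat) : bool := (x == y) || vlt x y.

Lemma vlt_irr x : vlt x x = false.
Proof. by elim: x => //= a x ->; rewrite ltnn andbF. Qed.

Lemma vlt_trans y x z : vlt x y -> vlt y z -> vlt x z.
Proof.
elim: x y z => [|a x IH] [|b y] [|c z] //=.
case/orP=> [ab|/andP[/eqP -> xy]] /orP[bc|/andP[/eqP <- yz]]; apply/orP.
- by left; apply: ltn_trans bc.
- by left.
- by left.
- by right; rewrite eqxx (IH _ _ xy yz).
Qed.

Lemma vle_refl x : vle x x.
Proof. by rewrite /vle eqxx. Qed.

Lemma vlt_vle x y : vlt x y -> vle x y.
Proof. by rewrite /vle => ->; rewrite orbT. Qed.

Lemma vle_trans y x z : vle x y -> vle y z -> vle x z.
Proof.
case/orP=> [/eqP -> //|xy] /orP[/eqP <-|yz]; apply: vlt_vle => //.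
exact: vlt_trans yz.
Qed.

Lemma vle_vlt_trans y x z : vle x y -> vlt y z -> vlt x z.
Proof. by case/orP=> [/eqP -> //|xy]; apply: vlt_trans. Qed.

Lemma vlt_vle_trans y x z : vlt x y -> vle y z -> vlt x z.
Proof. by move=> xy /orP[/eqP <- //|yz]; apply: vlt_trans yz. Qed.

(** Equal lengths are what makes the order total: when one word runs out first, [vlt] is false both
    ways. *)
Lemma vleNgt x y : size x = size y -> vle x y = ~~ vlt y x.
Proof.
rewrite /vle; elim: x y => [|a x IH] [|b y] //= [/IH {}IH].
rewrite eqseq_cons; case: (ltngtP a b) => //= ab; rewrite ?orbT //.
Qed.

Lemma vle_anti x y : vle x y -> vle y x -> x = y.
Proof.
move=> /orP[/eqP -> //|xy] /orP[/eqP -> //|yx].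
by have := vlt_trans xy yx; rewrite vlt_irr.
Qed.

Lemma vle_cons a b x y :
  vle (a :: x) (b :: y) = (a < b) || (a == b) && vle x y.
Proof.
by rewrite /vle eqseq_cons /=; case: ltngtP => //= ab; rewrite ?orbT.
Qed.

Lemma vlt_cat u x y : vlt (u ++ x) (u ++ y) = vlt x y.
Proof. by elim: u => //= a u ->; rewrite ltnn eqxx. Qed.

Lemma vlt_catr x y z : size x = size y -> vlt (x ++ z) (y ++ z) = vlt x y.
Proof.
by elim: x y => [|a x IH] [|b y] //= => [_|[/IH ->]]; rewrite ?vlt_irr.
Qed.

(** * The least leaf word above a truncated bound *)

Section Tokens.
Variable d : nat.

(** One of the two truncated differences vanishes, so this is the distance from [d]: the index of
    the component that the token belongs to, and 0 for padding. *)
Definition idx (t : nat) : nat := (t - d) + (d - t).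

Definition tok (i : nat) (b : bool) : nat := if b then d + i else d - i.

Definition tr (p : nat) (t : nat) : nat := if idx t < p then d else t.

Definition vtrunc (p : nat) (x : seq nat) : seq nat := map (tr p) x.

(* The words of leaves: the indices are odd or 0, at most [B] and weakly decreasing, and
   the last token is [d]. *)
Fixpoint vs (B : nat) (x : seq nat) : bool :=
  match x with
  | [::] => false
  | t :: x' =>
    if x' is [::] then t == d
    else ((t == d) || odd (idx t) && (idx t <= B)) && vs (idx t) x'
  end.

(** The shape of every least completion: spend the allowance [s] of upper tokens on [a], go on with
    [b], and close with the forced last token. *)
Fixpoint fl (a b s len : nat) : seq nat :=
  match len with
  | 0 => [::]
  | len'.+1 =>
    if len' is 0 then [:: d]
    else if s is s'.+1 then a :: fl a b s' len' else b :: fl a b 0 len'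
  end.

(** For odd [q] the largest odd index below [q] is [q - 2], so this is the least token erased by
    truncation at [q]; for [q = 1] it is the padding [d]. *)
Definition low (q : nat) : nat := d - (q - 2).

(* The least [y] satisfying [vs B] and [upper q y <= s] whose truncation at [q] is at
   least (if [weak]) or above that of [x]. *)
Fixpoint gl (weak : bool) (q B s : nat) (x : seq nat) {struct x} : option (seq nat) :=
  match x with
  | [::] => None
  | t :: x' =>
    let i := idx t in
    if i < q then
      if weak then Some (fl (low q) (low q) s (size x))
      else if (0 < s) && (q <= B) then Some (d + q :: fl (d - q) (low q) s.-1 (size x'))
      else None
    else if s is s'.+1 then
      if gl weak q i s' x' is Some r then Some (t :: r)
      else if t < d then Some (fl (d - (i - 2)) (low q) s (size x))
      else if i + 2 <= B then
        Some (t + 2 :: fl (d - (i + 2)) (low q) s' (size x'))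
      else None
    else if t < d then Some (fl (low q) (low q) 0 (size x)) else None
  end.

Definition upper (q : nat) (x : seq nat) : nat := count (fun t => q <= idx t) x.

Definition glcond (weak : bool) (q : nat) (x y : seq nat) : bool :=
  if weak then vle (vtrunc q x) (vtrunc q y) else vlt (vtrunc q x) (vtrunc q y).

Lemma size_fl a b s n : size (fl a b s n) = n.
Proof.
elim: n s => [|n IH] s //.
by case: n IH => [|n] IH //; case: s => [|s]; [exact: (congr1 S (IH 0)) | exact: (congr1 S (IH s))].
Qed.

#[local] Arguments fl : simpl never.
#[local] Arguments vs : simpl never.

Lemma fl1 a b s : fl a b s 1 = [:: d].
Proof. by []. Qed.

Lemma fl0 a b n : fl a b 0 n.+2 = b :: fl a b 0 n.+1.
Proof. by []. Qed.

Lemma flS a b s n : fl a b s.+1 n.+2 = a :: fl a b s n.+1.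
Proof. by []. Qed.

Lemma fl_0 a a' b n : fl a b 0 n = fl a' b 0 n.
Proof. by elim: n => // -[|n] IH; rewrite ?fl1 // !fl0 IH. Qed.

Lemma fl_same b s s' n : fl b b s n = fl b b s' n.
Proof.
elim: n s s' => // -[|n] IH s s'; first by rewrite !fl1.
by case: s s' => [|s] [|s'] //; rewrite ?fl0 ?flS; congr cons; exact: IH.
Qed.

Lemma vs_cons B t x : 0 < size x ->
  vs B (t :: x) = ((t == d) || odd (idx t) && (idx t <= B)) && vs (idx t) x.
Proof. by case: x. Qed.

Lemma vs1 B t : vs B [:: t] = (t == d).
Proof. by []. Qed.

Lemma vs_inv B t x : vs B (t :: x) ->
  x = [::] /\ t = d \/
  [/\ 0 < size x, vs (idx t) x & t = d \/ odd (idx t) /\ idx t <= B].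
Proof.
case: (posnP (size x)) => [/size0nil -> /eqP ->|x0]; first by left.
rewrite vs_cons // => /andP[tB vx]; right; split=> //.
by case/orP: tB => [/eqP|/andP[]]; [left|right].
Qed.

Lemma idx_d : idx d = 0.
Proof. by rewrite /idx; lia. Qed.

Lemma idx_leq B t : t = d \/ odd (idx t) /\ idx t <= B -> idx t <= B.
Proof. by case=> [->|[]//]; rewrite idx_d. Qed.

Lemma vs_leq B B' x : B <= B' -> vs B x -> vs B' x.
Proof.
case: x => [//|t x] BB'; case: (posnP (size x)) => [/size0nil -> //|x0].
rewrite !vs_cons // => /andP[H ->]; rewrite andbT.
by case/orP: H => [->//|/andP[-> /leq_trans ->]]; rewrite ?orbT.
Qed.

(* Below the position of its last free choice, the least vector repeats the most
   negative admissible token. *)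
Lemma fl_vs a i q s n B : odd q -> a = d - i -> i <= B -> i < d -> 0 < n ->
  (q <= i /\ odd i \/ i = q - 2 ) -> vs B (fl a (low q) s n).
Proof.
move=> oq -> iB id n0 iq; have oi: i = 0 \/ odd i by lia.
have lq: idx (low q) = q - 2 by rewrite /idx /low; lia.
have ia: idx (d - i) = i by rewrite /idx; lia.
have E: forall m B, 0 < m -> q - 2 <= B -> vs B (fl (d - i) (low q) 0 m).
  elim=> [//|[//|m] IH] B' _ qB'; first by rewrite fl1 vs1.
  rewrite fl0 vs_cons ?size_fl // IH ?lq //.
  case: (posnP (q - 2)) => [q2|q2].
    by rewrite {1}/low q2 subn0 eqxx.
  by rewrite qB' (_ : odd (q - 2)) ?orbT //; lia.
elim: s n B n0 iB => [|s IH] n B n0 iB; first by apply: E; lia.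
case: n n0 => [//|n] _; case: n => [|n]; first by rewrite fl1 vs1.
rewrite flS vs_cons ?size_fl // IH ?ia // andbT.
by case: oi => [->|->]; rewrite ?subn0 ?eqxx // iB orbT.
Qed.

(** Indices decrease weakly, so after index [i] no token is below [d - i], and repeating it is
    optimal. Once the allowance is spent only indices below [q] remain, and [low q] is the least
    such token. *)
Lemma fl_min i q s n y : odd q -> (q <= i /\ odd i \/ i = q - 2) -> i < d ->
  vs i y -> size y = n -> upper q y <= s -> vle (fl (d - i) (low q) s n) y.
Proof.
move=> oq iq id.
have dd : d < d = false by rewrite ltnn.
elim: n i s y iq id => [|n IH] i s y iq id; first by case: y.
case: y => [//|t y] vy [sy] us.
case: n IH sy => [|n] IH sy.
  by case: y sy vy us => //= _ /eqP -> _; rewrite fl1 vle_refl.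
move: vy; rewrite vs_cons ?sy // => /andP[ti vy].
have tl: d - i <= t by rewrite /idx in ti; lia.
case: s us => [|s] us.
  have ut : idx t < q by move: us => /=; case: (leqP q (idx t)); lia.
  have tl2: low q <= t.
    by rewrite /low; move: ti ut; rewrite /idx; lia.
  rewrite fl0 vle_cons; case: ltngtP tl2 => //= E _.
  rewrite (fl_0 _ (d - (q - 2))); apply: (IH (q - 2)); [by right|lia| |by []|by move: us => /=; lia].
  by apply: vs_leq vy; move: ti ut; rewrite /idx; lia.
rewrite flS vle_cons; case: ltngtP tl => //= E _.
have it : idx t = i by rewrite /idx; lia.
case: iq => [[qi oi]|iq].
  apply: IH => //; [by left|by rewrite -it|].
  by move: us => /=; rewrite it qi; lia.
(* The head is itself erased by truncation and costs [y] no allowance; since both fillers coincide,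
   the allowance can be put back to [s.+1] for the induction. *)
have Ei: d - i = low q by rewrite iq /low.
rewrite {1}Ei (fl_same _ s s.+1) -{1}Ei; apply: IH => //; [by right|by rewrite -it|].
by move: us => /=; lia.
Qed.

(** Here the indices of [y] may exceed [i]; only its head is bounded. A larger head decides at once,
    an equal one brings the index bound that [fl_min] asks for. *)
Lemma fl_min_head i q s n B y : odd q -> (q <= i /\ odd i \/ i = q - 2) ->
  i < d -> vs B y -> size y = n -> upper q y <= s -> 0 < s -> d - i <= head 0 y ->
  vle (fl (d - i) (low q) s n) y.
Proof.
move=> oq iq id vy sy us s0 hy.
case: (ltngtP (d - i) (head 0 y)) hy => // E _; last first.
  apply: fl_min => //; case: y E vy {sy us} => //= t y E vy.
  have it : idx t = i by rewrite /idx; lia.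
  case: (vs_inv vy) => [[-> ->]|[y0 vy' tB]]; first by rewrite vs1.
  rewrite vs_cons // vy' it leqnn andbT.
  by case: tB => [->|[+ _]]; rewrite ?eqxx // it => ->; rewrite orbT.
case: y E sy vy us => [|t y] //= E <-.
case: y => [|u y]; first by rewrite fl1 => /eqP -> _; exact: vle_refl.
by case: s s0 => [//|s] _ _ _; rewrite /= flS vle_cons E.
Qed.

Lemma vtrunc_low q B x : vs B x -> B < q -> vtrunc q x = nseq (size x) d.
Proof.
elim: x B => // t x IH B /vs_inv[[-> ->] _|[x0 vx /idx_leq tB] Bq].
  by rewrite /= /tr; case: ifP.
have tq := leq_ltn_trans tB Bq.
by rewrite /= (IH (idx t)) // /tr tq.
Qed.

Lemma upper_low q B x : vs B x -> B < q -> upper q x = 0.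
Proof.
rewrite /upper; elim: x B => // t x IH B /vs_inv[[-> ->] Bq|[x0 vx /idx_leq tB] Bq].
  by rewrite /= idx_d leqNgt; case: (posnP q) Bq => // ->.
have tq := leq_ltn_trans tB Bq.
by rewrite /= (IH _ vx tq) leqNgt tq.
Qed.

Lemma upper_fl a q s n : 0 < q -> low q <= d -> upper q (fl a (low q) s n) <= s.
Proof.
move=> q0 _; have lq : q <= idx (low q) = false by rewrite /idx /low; lia.
have dq : q <= idx d = false by rewrite idx_d; lia.
elim: n s => // -[|n] IH s; first by rewrite fl1 /upper /= dq.
case: s => [|s]; rewrite ?fl0 ?flS /upper /=; last by have := IH s; rewrite /upper; lia.
by have := IH 0; rewrite /upper lq.
Qed.

(** Among larger words, a longer common prefix with [x] means a smaller word, so [gl] alters a token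
    only if the call on the rest fails. Surviving indices are odd, hence the steps of 2. The
    condition [s < size x] leaves a place for the closing [d] after all upper tokens. *)
Lemma gl_sound weak q B s x r : odd q -> q <= B + 2 -> B < d -> vs B x ->
  s < size x -> gl weak q B s x = Some r ->
  [/\ vs B r, size r = size x, upper q r <= s & glcond weak q x r].
Proof.
move=> oq; have q0 : 0 < q by case: q oq.
elim: x B s r => [//|t x IH] B s r qB Bd vx sx.
have td : idx t < d.
  case: (vs_inv vx) => [[_ ->]|[_ _ /idx_leq]]; rewrite ?idx_d; lia.
have lvs n B' s' : 0 < n -> q <= B' + 2 -> B' < d ->
    vs B' (fl (low q) (low q) s' n).
  by move=> n0 qB' Bd'; apply: (@fl_vs _ (q - 2)) => //; try lia; right.
have ltr n s' : vtrunc q (fl (low q) (low q) s' n) = nseq n d.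
  case: (posnP n) => [-> //|n0]; rewrite -{2}(size_fl (low q) (low q) s' n).
  apply: (@vtrunc_low q (q - 2)); last lia.
  by apply: (@fl_vs _ (q - 2)) => //; try lia; right.
have lup n s' : upper q (fl (low q) (low q) s' n) = 0.
  case: (posnP n) => [-> //|n0]; apply: (@upper_low q (q - 2)); last lia.
  by apply: (@fl_vs _ (q - 2)) => //; try lia; right.
rewrite [gl _ _ _ _ _]/=; case: (ltnP (idx t) q) => tq.
  have xd : vtrunc q (t :: x) = nseq (size x).+1 d.
    case: (vs_inv vx) => [[-> ->]|[_ vx' _]]; first by rewrite /= /tr idx_d q0.
    by rewrite /= (vtrunc_low vx' tq) /tr tq.
  case: weak IH => _; first move=> /Some_inj <-.
    rewrite size_fl lvs // lup; split=> //.
    by rewrite /glcond xd ltr vle_refl.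
  case: ifP => // /andP[s0 qB'] [<-]; have x0 : 0 < size x by move: sx => /=; lia.
  have qq : idx (d + q) = q by rewrite /idx; lia.
  split.
  - rewrite vs_cons ?size_fl // qq oq qB' orbT.
    by apply: (@fl_vs _ q) => //; try lia; left.
  - by rewrite /= size_fl.
  - rewrite /upper /= qq leqnn.
    by have := @upper_fl (d - q) q s.-1 (size x) q0 (leq_subr _ _); rewrite /upper; lia.
  - by rewrite /glcond xd /= /tr qq ltnn; rewrite (_ : d < d + q); lia.
have trt : tr q t = t by rewrite /tr ltnNge tq.
(* Without allowance the result has to continue with erased tokens here, and these exceed [t] only
   if [t < d]. *)
case: s sx => [|s] sx.
  case: (ltnP t d) => // tld [<-]; rewrite lvs // size_fl lup; split=> //.
  rewrite /glcond; have h: vlt (vtrunc q (t :: x)) (nseq (size x).+1 d).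
    by rewrite /= trt tld.
  by rewrite ltr; case: weak IH => _ //; apply: vlt_vle.
have {}sx : s < size x by [].
have x0 : 0 < size x by lia.
move: vx; rewrite vs_cons // => /andP[tB vx].
have ot : odd (idx t) && (idx t <= B).
  by case/orP: tB => // /eqP E; move: tq; rewrite E idx_d; lia.
case E: (gl weak q (idx t) s x) => [r'|].
  case=> <-; have [|//|vr sr ur cr] := IH _ _ _ _ td vx _ E; first lia.
  split=> /=; rewrite ?sr //.
  - by rewrite vs_cons ?sr // ot orbT.
  - by rewrite /upper /= tq; rewrite /upper in ur; lia.
  - by move: cr; rewrite /glcond /= vle_cons /= !ltnn !eqxx /=.
case: (ltnP t d) => tld.
  case=> <-; split.
  - apply: (@fl_vs _ (idx t - 2)) => //; try lia.
  - by rewrite size_fl.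
  - by apply: upper_fl => //; exact: leq_subr.
  - have h : vlt (vtrunc q (t :: x))
        (vtrunc q (fl (d - (idx t - 2)) (low q) s.+1 (size x).+1)).
      case: (size x) x0 => // m _; rewrite flS /= trt /tr.
      by case: ifP => _; rewrite ?tld //; move: tld tq q0; rewrite /idx; lia.
    by rewrite /glcond h; case: weak {IH E} => //; apply: vlt_vle.
case: ifP => // tB2 [<-].
have it2 : idx (t + 2) = idx t + 2 by move: tq; rewrite /idx; lia.
split.
- rewrite vs_cons ?size_fl // it2 tB2 andbT; apply/andP; split; first lia.
  by apply: (@fl_vs _ (idx t + 2)) => //; try lia; left; lia.
- by rewrite /= size_fl.
- rewrite /upper /= it2 (_ : q <= idx t + 2); last lia.
  have := @upper_fl (d - (idx t + 2)) q s (size x) q0 (leq_subr _ _).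
  by rewrite /upper; lia.
- have h : vlt (vtrunc q (t :: x)) (vtrunc q (t + 2 :: fl (d - (idx t + 2)) (low q) s (size x))).
    by rewrite /= trt /tr it2 (_ : idx t + 2 < q = false); lia.
  by rewrite /glcond h; case: weak {IH E} => //; apply: vlt_vle.
Qed.

(** Up to the first position where the truncation of [y] leaves that of [x], the recursion applies;
    at that position the token of [y] is at least the successor chosen by [gl], and the minimality
    of [fl] handles the rest. *)
Lemma gl_complete weak q B s x y : odd q -> q <= B + 2 -> B < d -> vs B x ->
  s < size x -> vs B y -> size y = size x -> upper q y <= s ->
  glcond weak q x y -> exists2 r, gl weak q B s x = Some r & vle r y.
Proof.
move=> oq; have q0 : 0 < q by case: q oq.
elim: x B s y => [//|t x IH] B s [//|t' y] qB Bd vx sx vy syx uy cy.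
have td : idx t < d.
  case: (vs_inv vx) => [[_ ->]|[_ _ /idx_leq]]; rewrite ?idx_d; lia.
have td' : idx t' < d.
  case: (vs_inv vy) => [[_ ->]|[_ _ /idx_leq]]; rewrite ?idx_d; lia.
have lmin n z s' : vs (q - 2) z -> size z = n -> vle (fl (low q) (low q) s' n) z.
  move=> vz sz; rewrite (fl_same _ s' (upper q z)).
  by apply: (@fl_min (q - 2)) => //; try lia; right.
have ylow : idx t' < q -> vs (q - 2) (t' :: y).
  move=> tq; case: (vs_inv vy) => [[-> ->]|[y0 vy' tB]]; first by rewrite vs1.
  rewrite vs_cons // vy' andbT; case: tB => [->|[ot _]]; rewrite ?eqxx // ot.
  by rewrite (_ : idx t' <= q - 2) ?orbT //; lia.
rewrite [gl _ _ _ _ _]/=; case: (ltnP (idx t) q) => tq.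
  have xd : vtrunc q (t :: x) = nseq (size x).+1 d.
    case: (vs_inv vx) => [[-> ->]|[_ vx' _]]; first by rewrite /= /tr idx_d q0.
    by rewrite /= (vtrunc_low vx' tq) /tr tq.
  have yd : idx t' < q -> vtrunc q (t' :: y) = nseq (size x).+1 d.
    by move=> tq'; rewrite (vtrunc_low (ylow tq')) ?syx //; lia.
  case: (ltnP (idx t') q) => tq'.
    case: weak IH cy => [_ _|_]; last first.
      by rewrite /glcond xd yd // vlt_irr.
    by eexists; [by []|]; apply: lmin => //; exact: ylow.
  have tr' : tr q t' = t' by rewrite /tr ltnNge tq'.
  have t'd : d < t'.
    suff: d <= t' by move: tq' q0; rewrite /idx; lia.
    move: cy; rewrite /glcond xd /= vle_cons tr'; case: (weak); lia.
  case: (vs_inv vy) => [[_ E]|[y0 vy' [E|[ot' tB']]]]; try lia.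
  have u1 : upper q (t' :: y) = (upper q y).+1 by rewrite /upper /= tq'.
  case: weak IH cy => _ cy.
    eexists; first by [].
    rewrite /vle; apply/orP; right.
    have : 0 < size x by move: y0; case: syx => ->.
    rewrite /=; case: (size x) => // n _; case: (s) => [|s'].
      by rewrite fl0 /= (_ : low q < t') // /low; lia.
    by rewrite flS /= (_ : low q < t') // /low; lia.
  rewrite (_ : (0 < s) && (q <= B)); last lia.
  eexists; first by [].
  rewrite vle_cons; have: d + q <= t' by move: tq' t'd; rewrite /idx; lia.
  case: ltngtP => // E _ /=.
  have it' : idx t' = q by rewrite -E /idx; lia.
  apply: (@fl_min q); first [lia | by left | by rewrite -it' | by case: syx].
have trt : tr q t = t by rewrite /tr ltnNge tq.
have tnd : t <> d by move=> E; move: tq; rewrite E idx_d; lia.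
case: (vs_inv vx) => [[_ //]|[x0 vx' [//|[ot tB]]]].
have y0 : 0 < size y by case: syx => ->.
have [[Et cy']|tt'] : (t' = t /\ glcond weak q x y) \/ t < tr q t'.
  move: cy; rewrite /glcond /= vle_cons trt; case: ltngtP => /=; try by right.
    by case: (weak).
  move=> E; rewrite /tr in E; case: (ltnP (idx t') q) E => // _ <- c; first by left; case: (weak) c.
- subst t'; case: (vs_inv vy) => [[E _]|[_ vy' _]]; first by rewrite E in y0.
  have u1 : upper q (t :: y) = (upper q y).+1 by rewrite /upper /= tq.
  case: s sx uy => [|s] sx uy; first by move: uy; rewrite u1.
  have [|||r -> ry] := IH (idx t) s y _ td vx' sx vy' _ _ cy'.
  + lia.
  + by case: syx.
  + by move: uy; rewrite u1.
  by exists (t :: r) => //; rewrite vle_cons ltnn eqxx.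
have {}tt' : t < t'.
  move: tt' tq; rewrite /tr; case: ifP => // tq' tld tq.
  by move: tq' tld tq; rewrite /idx; lia.
have yh : idx t' <= B by case: (vs_inv vy) => [[_ ->]|[_ _ /idx_leq]]; rewrite ?idx_d.
have pt' : t' = d \/ odd (idx t').
  by case: (vs_inv vy) => [[_ ->]|[_ _ [->|[]]]]; [left|left|right].
case: s sx uy => [|s] sx uy.
  have tq' : idx t' < q by move: uy; rewrite /upper /=; case: leqP.
  have -> : t < d.
    by move: tt' tq tq'; rewrite /idx; lia.
  eexists; first by [].
  by apply: lmin => //; exact: ylow.
(* A result found deeper keeps [t], while [y] already has a larger token here. *)
case: (gl _ _ _ s x) => [r|].
  by exists (t :: r) => //; rewrite vle_cons tt'.
case: (ltnP t d) => tld.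
  eexists; first by [].
  apply: (@fl_min_head _ _ _ _ B) => //.
  - by case: (leqP q (idx t - 2)) => h; [left; lia|right; lia].
  - lia.
  - by move: tt' pt' tld ot tq; rewrite /idx /=; lia.
(* Above [t = d + i] with [i] odd, the next token of odd index is [t + 2]. *)
have h : t + 2 <= t' by move: tt' pt' tld ot tq; rewrite /idx /=; lia.
rewrite (_ : idx t + 2 <= B); last by move: yh h tld tt'; rewrite /idx; lia.
eexists; first by [].
rewrite vle_cons; case: ltngtP h => // E _ /=.
have it' : idx t' = idx t + 2 by rewrite -E; move: tld; rewrite /idx; lia.
case: (vs_inv vy) => [[E2 _]|[_ vy' _]]; first by rewrite E2 in y0.
have u1 : upper q (t' :: y) = (upper q y).+1 by rewrite /upper /= it' (_ : q <= _); lia.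
apply: fl_min; rewrite -?it' //; [left; rewrite it'|case: syx|]; lia.
Qed.

End Tokens.

#[local] Arguments fl : simpl never.
#[local] Arguments vs : simpl never.
#[local] Arguments vtrunc : simpl never.
#[local] Arguments upper : simpl never.

(* The indices being odd, truncations at an even [p] and at [p.+1] agree. *)
Definition oddup (p : nat) : nat := if odd p then p else p.+1.

Lemma odd_oddup p : odd (oddup p).
Proof. by rewrite /oddup; case: ifP => //= ->. Qed.

Lemma oddup_gt0 p : 0 < oddup p.
Proof. by case: oddup (odd_oddup p). Qed.

Lemma oddup_mono p p' : p <= p' -> oddup p <= oddup p'.
Proof. by rewrite /oddup; case: ifP; case: ifP; lia. Qed.

Lemma oddup_le d p : p <= d -> oddup p <= d.+1.
Proof. by rewrite /oddup; case: ifP; lia. Qed.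

(** * Lifting a label along an arc *)

Section Lift.
Variables d R : nat.
Hypothesis d_gt0 : 0 < d.

Notation vs := (vs d).
Notation idx := (idx d).
Notation tr := (tr d).
Notation vtrunc := (vtrunc d).
Notation upper := (upper d).

(** The token exceeds all tokens of leaves, and its index [d + 1] makes it survive truncation at
    every [q <= d + 1]. *)
Definition vtop : seq nat := nseq R.+1 (d.*2.+1).

Definition leafv (x : seq nat) : bool := vs d.-1 x && (size x == R.+1).

Definition valid (x : seq nat) : bool := (x == vtop) || leafv x.

(** If the search fails, no leaf is large enough and only top is left. *)
Definition LF (weak : bool) (q s : nat) (x : seq nat) : seq nat :=
  odflt vtop (gl d weak q d.-1 s x).

(** The allowance [R] excludes no leaf, by [upper_leaf]; even priorities ask for a weak inequality,
    odd ones for a strict one. *)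
Definition lift (p : nat) (x : seq nat) : seq nat := LF (~~ odd p) (oddup p) R x.

Definition NV (p : nat) (y x : seq nat) : bool :=
  if odd p then vlt (vtrunc (oddup p) x) (vtrunc (oddup p) y)
                || (y == vtop) && (x == vtop)
  else vle (vtrunc (oddup p) x) (vtrunc (oddup p) y).

Definition is_min (q : nat) (x : seq nat) : Prop :=
  forall z, leafv z -> vtrunc q z = vtrunc q x -> vle x z.

Lemma size_valid x : valid x -> size x = R.+1.
Proof. by case/orP=> [/eqP ->|/andP[_ /eqP]]; rewrite ?size_nseq. Qed.

Lemma leaf_valid x : leafv x -> valid x.
Proof. by rewrite /valid orbC => ->. Qed.

Lemma top_valid : valid vtop.
Proof. by rewrite /valid eqxx. Qed.

Lemma vtrunc_cons q t x : vtrunc q (t :: x) = tr q t :: vtrunc q x.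
Proof. by []. Qed.

Lemma upper_cons q t x : upper q (t :: x) = (q <= idx t) + upper q x.
Proof. by []. Qed.

Lemma size_vtrunc q x : size (vtrunc q x) = size x.
Proof. exact: size_map. Qed.

Lemma idx_top : idx d.*2.+1 = d.+1.
Proof. by rewrite /idx; lia. Qed.

Lemma vtrunc_top q : q <= d.+1 -> vtrunc q vtop = vtop.
Proof.
by move=> qd; rewrite /vtrunc map_nseq /tr idx_top ltnNge qd.
Qed.

Lemma gl_top weak q B s k : q <= d.+1 -> B <= d.+1 ->
  gl d weak q B s (nseq k d.*2.+1) = None.
Proof.
elim: k B s => //= k IH B s qd Bd; rewrite idx_top ltnNge qd /=.
have -> : (d.*2.+1 < d) = false by lia.
have -> : (d.+1 + 2 <= B) = false by lia.
by case: s => // s; rewrite IH.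
Qed.

Lemma LF_top weak q s : q <= d.+1 -> LF weak q s vtop = vtop.
Proof. by move=> qd; rewrite /LF gl_top //; lia. Qed.

Lemma LF_none s x : valid x -> LF false (d + 3) s x = vtop.
Proof.
move=> vx; rewrite /LF.
suff -> : gl d false (d + 3) d.-1 s x = None by [].
have : idx (head 0 x) < d + 3.
  case/orP: vx => [/eqP ->|/andP[+ _]]; first by rewrite /= idx_top; lia.
  case: x => // t x /vs_inv[[_ ->]|[_ _ /idx_leq]] /=; rewrite ?idx_d; lia.
case: {vx} x => //= t x ->.
by rewrite (_ : d + 3 <= d.-1 = false) ?andbF //; lia.
Qed.

Lemma leaf_lt_top x : leafv x -> vlt x vtop.
Proof.
case: x => [|t x] /andP[] // /vs_inv[[_ ->]|[_ _ /idx_leq tB]] _ /=; first by lia.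
by rewrite (_ : t < d.*2.+1) //; move: tB; rewrite /idx; lia.
Qed.

Lemma leaf_neq_top x : leafv x -> x != vtop.
Proof. by move=> lx; apply/eqP => E; have := leaf_lt_top lx; rewrite {1}E vlt_irr. Qed.

Lemma valid_leaf x : valid x -> x != vtop -> leafv x.
Proof. by rewrite /valid => /orP[->|]. Qed.

Lemma valid_le_top x : valid x -> vle x vtop.
Proof. by case/orP=> [/eqP ->|/leaf_lt_top /vlt_vle //]; rewrite vle_refl. Qed.

Lemma valid_leNgt x y : valid x -> valid y -> vle x y = ~~ vlt y x.
Proof. by move=> /size_valid sx /size_valid sy; rewrite vleNgt ?sx. Qed.

Lemma vs_nseq B n : vs B (nseq n.+1 d).
Proof.
by elim: n B => [|n IH] B; rewrite ?vs1 // -[nseq _ _]/(d :: nseq n.+1 d)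
  vs_cons ?size_nseq // eqxx IH.
Qed.

Lemma vs_vtrunc q B x : vs B x -> vs B (vtrunc q x).
Proof.
elim: x B => // t x IH B vtx; case: (ltnP (idx t) q) => tq.
  have E : vtrunc q (t :: x) = nseq (size x).+1 d.
    case: (vs_inv vtx) => [[-> ->]|[_ vx _]]; rewrite vtrunc_cons /tr ?idx_d.
      by case: ifP.
    by rewrite (vtrunc_low vx tq) tq.
  by rewrite E vs_nseq.
case: (vs_inv vtx) => [[-> ->]|[x0 vx tB]]; rewrite vtrunc_cons /tr.
  by case: ifP; rewrite vs1.
rewrite vs_cons ?size_vtrunc // ltnNge tq /= IH // andbT.
by case: tB => [->|[-> ->]]; rewrite ?eqxx ?orbT.
Qed.

Lemma leaf_vtrunc q x : leafv x -> leafv (vtrunc q x).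
Proof. by case/andP=> vx sx; rewrite /leafv vs_vtrunc // size_map. Qed.

(** If the first differing tokens are both erased, so is all that follows, indices being decreasing,
    and the truncations agree. A surviving token lies farther from [d] than any erased one, so
    comparing it with [d] instead changes nothing. *)
Lemma vs_vtrunc_mono q B x y : vs B x -> vs B y -> size x = size y ->
  vle x y -> vle (vtrunc q x) (vtrunc q y).
Proof.
elim: x B y => // t x IH B [|t' y] vx vy // [sxy]; rewrite !vtrunc_cons !vle_cons.
case: (ltngtP t t') => //= [tt' _|E]; last first.
  subst t'; case: (vs_inv vx) sxy => [[-> _] /esym/size0nil ->|[x0 vx' _] sxy].
    by rewrite eqxx vle_refl orbT.
  case: (vs_inv vy) => [[E _]|[_ vy' _]]; first by rewrite E in sxy; rewrite sxy in x0.
  by move/(IH _ _ vx' vy' sxy) => ->; rewrite eqxx orbT.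
rewrite /tr; case: (ltnP (idx t) q) => tq; case: (ltnP (idx t') q) => tq'; rewrite ?tt' //.
- rewrite eqxx orbC /=; apply/orP; left.
  case: (vs_inv vx) sxy => [[-> _] /esym/size0nil -> //|[x0 vx' _] sxy].
  case: (vs_inv vy) => [[E _]|[_ vy' _]]; first by rewrite E in sxy; rewrite sxy in x0.
  by rewrite (vtrunc_low vx' tq) (vtrunc_low vy' tq') sxy vle_refl.
- by rewrite (_ : d < t') //; move: tq tq' tt'; rewrite /idx; lia.
- by rewrite (_ : t < d) //; move: tq tq' tt'; rewrite /idx; lia.
Qed.

Lemma vtrunc_mono q x y : q <= d.+1 -> valid x -> valid y ->
  vle x y -> vle (vtrunc q x) (vtrunc q y).
Proof.
move=> qd /orP[/eqP ->|lx] /orP[/eqP ->|ly]; rewrite ?vle_refl // ?vtrunc_top //.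
- by move=> H; have := vle_vlt_trans H (leaf_lt_top ly); rewrite vlt_irr.
- by move=> _; apply/vlt_vle/leaf_lt_top/leaf_vtrunc.
- case/andP: lx ly => vx /eqP sx /andP[vy /eqP sy].
  by apply: vs_vtrunc_mono vx vy _; rewrite sx.
Qed.

Lemma vtruncK q q' x : q' <= q -> vtrunc q (vtrunc q' x) = vtrunc q x.
Proof.
move=> qq; rewrite /vtrunc -map_comp; apply: eq_map => t /=.
rewrite {2}/tr; case: ifP => // tq.
by rewrite /tr (leq_trans tq qq) idx_d; case: ifP.
Qed.

Lemma LF_valid weak q s x : odd q -> q <= d.+1 -> s <= R -> valid x ->
  valid (LF weak q s x).
Proof.
move=> oq qd sR /orP[/eqP ->|/andP[vx /eqP sx]]; first by rewrite LF_top // top_valid.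
rewrite /LF; case E: gl => [r|] /=; last exact: top_valid.
have [|||vr sr _ _] := gl_sound oq _ _ vx _ E; try lia.
by rewrite leaf_valid // /leafv vr sr sx eqxx.
Qed.

Lemma LF_spec weak q s x : odd q -> q <= d.+1 -> s <= R -> leafv x ->
  LF weak q s x != vtop ->
  [/\ leafv (LF weak q s x), upper q (LF weak q s x) <= s &
      glcond d weak q x (LF weak q s x)].
Proof.
move=> oq qd sR /andP[vx /eqP sx].
rewrite /LF; case E: gl => [r|] /=; rewrite ?eqxx // => _.
have [|||vr sr ur cr] := gl_sound oq _ _ vx _ E; try lia.
by rewrite /leafv vr sr sx ur eqxx.
Qed.

Lemma LF_min weak q s x y : odd q -> q <= d.+1 -> s <= R -> leafv x -> leafv y ->
  upper q y <= s -> glcond d weak q x y -> vle (LF weak q s x) y.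
Proof.
move=> oq qd sR /andP[vx /eqP sx] /andP[vy /eqP sy] uy cxy.
have [||||r E ry] := gl_complete oq _ _ vx _ vy _ uy cxy; try lia.
by rewrite /LF E.
Qed.

Lemma upper_leaf q x : 0 < q -> leafv x -> upper q x <= R.
Proof.
move=> q0 /andP[+ /eqP]; elim: x R d.-1 => // t x IH n B.
case/vs_inv=> [[-> -> _]|[x0 vx _]]; rewrite upper_cons.
  by rewrite idx_d leqn0 gtn_eqF.
case=> sx; have /IH := vx.
case: n sx => [|n] sx; first by rewrite sx in x0.
by move/(_ n sx); case: leqP; lia.
Qed.

Lemma lift_valid p x : p <= d -> valid x -> valid (lift p x).
Proof. by move=> pd vx; apply: LF_valid => //; [exact: odd_oddup|exact: oddup_le]. Qed.

(** The admissible values of [y] are closed upwards because truncation is monotone, and [LF_spec]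
    with [LF_min] provides their least element. From here on, arcs can be treated through an order
    instead of a case distinction on parities. *)
Lemma lift_NV p x y : p <= d -> valid x -> valid y -> NV p y x = vle (lift p x) y.
Proof.
move=> pd vx vy; have qd := oddup_le pd; have oq := odd_oddup p.
have le_top : vle (lift p x) vtop by apply: valid_le_top; exact: lift_valid.
case/orP: (vx) => [/eqP Ex|lx].
  rewrite /lift Ex LF_top // /NV vtrunc_top // eqxx andbT.
  case/orP: (vy) => [/eqP ->|ly].
    by rewrite eqxx vle_refl orbT vtrunc_top // vle_refl; case: ifP.
  have h: vlt (vtrunc (oddup p) y) vtop by apply/leaf_lt_top/leaf_vtrunc.
  rewrite (negPf (leaf_neq_top ly)) orbF (valid_leNgt top_valid vy) leaf_lt_top //.
  case: ifP => _; last by rewrite vleNgt ?h // size_map !size_valid ?top_valid.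
  by apply/negP => h2; have := vlt_trans h h2; rewrite vlt_irr.
have NVE : leafv y -> NV p y x = glcond d (~~ odd p) (oddup p) x y.
  move=> ly; rewrite /NV /glcond (negPf (leaf_neq_top ly)) orbF.
  by case: (odd p).
case/orP: (vy) => [/eqP ->|ly].
  rewrite le_top /NV vtrunc_top // vlt_vle ?leaf_lt_top ?leaf_vtrunc //.
  by case: ifP.
rewrite NVE //; apply/idP/idP => [c|c].
  by apply: LF_min => //; apply: upper_leaf => //; exact: oddup_gt0.
have nt : lift p x != vtop.
  apply/eqP => E; have := vle_vlt_trans c (leaf_lt_top ly).
  by rewrite E vlt_irr.
have [lr ur cr] := LF_spec oq qd (leqnn R) lx nt.
have m : vle (vtrunc (oddup p) (lift p x)) (vtrunc (oddup p) y).
  by apply: vtrunc_mono => //; exact: leaf_valid.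
move: cr; rewrite -/(lift p x) /glcond; case: (~~ odd p) => cr; first exact: vle_trans cr m.
exact: vlt_vle_trans cr m.
Qed.

Lemma NV_mono p x x' y : p <= d -> valid x -> valid x' -> valid y ->
  vle x x' -> NV p y x' -> NV p y x.
Proof.
move=> pd vx vx' vy xx'; have := vtrunc_mono (oddup_le pd) vx vx' xx'.
rewrite /NV; case: ifP => op t.
  case/orP=> [h|/andP[/eqP -> /eqP ex']]; first by rewrite (vle_vlt_trans t h).
  case/orP: vx => [/eqP ->|lx]; first by rewrite !eqxx orbT.
  by rewrite vtrunc_top ?leaf_lt_top ?leaf_vtrunc //; exact: oddup_le.
exact: vle_trans.
Qed.

Lemma lift_mono p x x' : p <= d -> valid x -> valid x' -> vle x x' ->
  vle (lift p x) (lift p x').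
Proof.
move=> pd vx vx' xx'; rewrite -lift_NV //; last exact: lift_valid.
apply: NV_mono xx' _ => //; first exact: lift_valid.
by rewrite lift_NV ?vle_refl //; exact: lift_valid.
Qed.

(** Coarser truncation keeps weak inequalities. Around a cycle with highest priority [p'], the
    truncated labels therefore decrease weakly at every arc. *)
Lemma NV_trunc p p' x y : p <= p' -> p' <= d -> valid x -> valid y -> NV p y x ->
  vle (vtrunc (oddup p') x) (vtrunc (oddup p') y).
Proof.
move=> pp pd vx vy; have qd := oddup_le pd; have qq := oddup_mono pp.
have h : vle (vtrunc (oddup p) x) (vtrunc (oddup p) y) ->
    vle (vtrunc (oddup p') x) (vtrunc (oddup p') y).
  have E z : valid z -> valid (vtrunc (oddup p) z).
    case/orP=> [/eqP ->|lz]; last by rewrite leaf_valid // leaf_vtrunc.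
    by rewrite vtrunc_top ?top_valid //; lia.
  move/(vtrunc_mono qd (E _ vx) (E _ vy)).
  by rewrite !(@vtruncK _ (oddup p)).
rewrite /NV; case: ifP => _; last exact: h.
by case/orP=> [/vlt_vle //|/andP[/eqP -> /eqP ->]]; rewrite vle_refl.
Qed.

End Lift.

(** * Base labels, and moving labels between subtrees *)

Section Base.
Variables d R : nat.
Hypothesis d_gt0 : 0 < d.

Notation vs := (vs d).
Notation idx := (idx d).
Notation tr := (tr d).
Notation vtrunc := (vtrunc d).
Notation upper := (upper d).
Notation vtop := (vtop d R).
Notation leafv := (leafv d R).
Notation valid := (valid d R).
Notation LF := (LF d R).
Notation lift := (lift d R).
Notation NV := (NV d R).
Notation is_min := (is_min d R).

(** A base label belongs to the node of highest priority on an even cycle, so odd priorities have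
    none. As [c] is a number of tokens plus one, [c = 0] admits no label at all. *)
Definition noX (c p : nat) : bool := odd p || (c == 0).

(* No index reaches [d + 3], so [LF] is top there. *)
Definition Xf (c p : nat) (x : seq nat) : seq nat :=
  LF (~~ noX c p && ~~ vlt (LF true p.+1 R x) x)
     (if noX c p then d + 3 else p.+1) c.-1 x.

(** The truncation alone determines the number of upper tokens, so this number is constant on a
    subtree and along an even cycle. *)
Lemma upperE q x : 0 < q -> upper q x = count (predC1 d) (vtrunc q x).
Proof.
move=> q0; rewrite /vtrunc count_map; apply: eq_count => t /=; rewrite /tr.
case: leqP => h; last by rewrite eqxx.
by apply/esym/eqP => E; move: h; rewrite E idx_d; lia.
Qed.

Lemma Xf_none c p x : noX c p -> valid x -> Xf c p x = vtop.
Proof. by move=> n vx; rewrite /Xf n /= LF_none. Qed.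

Lemma Xf_valid c p x : p <= d -> c <= R.+1 -> valid x -> valid (Xf c p x).
Proof.
move=> pd cR vx; case n: (noX c p); first by rewrite Xf_none // top_valid.
rewrite /Xf n; apply: LF_valid => //; try lia.
by move: n; rewrite /noX /=; case: odd.
Qed.

(** The word [x] satisfies its own weak condition, so the least solution lies below it; monotonicity
    then forces equal truncations. The result is the least leaf in the subtree of [x]. *)
Lemma LF_weak_le q x : odd q -> q <= d.+1 -> leafv x ->
  [/\ leafv (LF true q R x), vle (LF true q R x) x &
      vtrunc q (LF true q R x) = vtrunc q x].
Proof.
move=> oq qd lx; have q0 : 0 < q by case: q oq {qd}.
have m : vle (LF true q R x) x.
  by apply: LF_min => //; [exact: upper_leaf|exact: vle_refl].
have nt : LF true q R x != vtop.
  by apply/eqP => E; have := vle_vlt_trans m (leaf_lt_top d_gt0 lx); rewrite E vlt_irr.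
have [//|ll _ c] := LF_spec d_gt0 oq qd _ lx nt; split=> //.
apply: vle_anti => //; apply: (vtrunc_mono (R := R)) => //; exact: leaf_valid.
Qed.

(** If [x] is the least leaf of its subtree, it is itself a candidate and [Xf] searches weakly.
    Otherwise the minimum of that subtree is below [x], so a strictly later subtree is needed. *)
Lemma Xf_spec c p x : ~~ noX c p -> p <= d -> c <= R.+1 -> leafv x ->
  Xf c p x != vtop ->
  [/\ leafv (Xf c p x), upper p.+1 (Xf c p x) < c, vle x (Xf c p x) &
      is_min p.+1 (Xf c p x)].
Proof.
move=> n pd cR lx; have vx := leaf_valid lx.
have op : odd p.+1 by move: n; rewrite /noX /=; case: odd.
have c0 : 0 < c by move: n; rewrite /noX; case: (c); rewrite ?orbT.
rewrite /Xf (negPf n) /=; set wk := ~~ vlt _ _ => nt.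
have c1R : c.-1 <= R by lia.
have [ll ul cl] := LF_spec d_gt0 op pd c1R lx nt.
have [lw lwx tw] := LF_weak_le op pd lx.
split=> //; first lia.
  move: cl; rewrite /glcond; set r := LF _ _ _ _ in ll *.
  case E: wk => t.
    have -> : x = LF true p.+1 R x.
      move: lwx E; rewrite /wk /vle; case/orP=> [/eqP -> //|->] //.
    apply: LF_min => //; exact: upper_leaf.
  rewrite (valid_leNgt vx (leaf_valid ll)); apply/negP => /vlt_vle h.
  have := vtrunc_mono d_gt0 (pd : p.+1 <= d.+1) (leaf_valid ll) vx h.
  by move/(vlt_vle_trans t); rewrite vlt_irr.
move=> z lz tz; apply: LF_min => //; last by rewrite /glcond tz.
by rewrite upperE // tz -upperE.
Qed.

Lemma Xf_ge c p x : p <= d -> c <= R.+1 -> valid x -> vle x (Xf c p x).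
Proof.
move=> pd cR vx; have vX := Xf_valid pd cR vx.
case: (eqVneq (Xf c p x) vtop) => [->|nt]; first exact: valid_le_top.
case n: (noX c p); first by rewrite Xf_none ?eqxx in nt.
case/orP: (vx) => [/eqP E|lx].
  by move: nt; rewrite /Xf n E LF_top ?eqxx.
by case: (Xf_spec (negbT n) pd cR lx nt).
Qed.

Lemma Xf_min c p x y : ~~ noX c p -> p <= d -> c <= R.+1 -> leafv x -> leafv y ->
  vle x y -> upper p.+1 y < c -> is_min p.+1 y -> vle (Xf c p x) y.
Proof.
move=> n pd cR lx ly xy uy my.
have op : odd p.+1 by move: n; rewrite /noX /=; case: odd.
have [lw lwx tw] := LF_weak_le op pd lx.
rewrite /Xf (negPf n) /=; apply: LF_min => //; try lia.
have t : vle (vtrunc p.+1 x) (vtrunc p.+1 y).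
  refine (vtrunc_mono d_gt0 (pd : p.+1 <= d.+1) (leaf_valid lx) (leaf_valid ly) xy).
rewrite /glcond; case: ifP => // /negbFE wx.
case/orP: t => // /eqP E.
(* With equal truncations, [y] would be at most the least leaf of the common subtree, which is below
   [x] in the strict case; this contradicts [vle x y]. *)
have yx : vle y x by apply: my.
have := my _ lw; rewrite tw E => /(_ erefl) yw.
have := vle_vlt_trans yw wx; rewrite (vle_anti xy yx) vlt_irr //.
Qed.

Lemma Xf_anti c c' p x : p <= d -> c <= c' -> c' <= R.+1 -> valid x ->
  vle (Xf c' p x) (Xf c p x).
Proof.
move=> pd cc cR vx; have cR' := leq_trans cc cR.
case: (eqVneq (Xf c p x) vtop) => [->|nt]; first by apply: valid_le_top => //; exact: Xf_valid.
case n: (noX c p); first by rewrite Xf_none ?eqxx in nt.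
have n' : ~~ noX c' p.
  by move: n cc; rewrite /noX; case: odd => //=; case: (c) => //; case: (c').
case/orP: (vx) => [/eqP E|lx]; first by move: nt; rewrite /Xf n E LF_top ?eqxx.
have [lX uX xX mX] := Xf_spec (negbT n) pd cR' lx nt.
by apply: Xf_min => //; exact: leq_trans cc.
Qed.

(** Decreasing indices force the upper tokens into a prefix; the tail has odd indices below the odd
    [q], so at most [q - 2]. *)
Lemma vs_split q B x : odd q -> vs B x -> let k := upper q x in
  [/\ k < size x, vtrunc q x = take k x ++ nseq (size x - k) d,
      all (fun t => q <= idx t) (take k x) & vs (q - 2) (drop k x)].
Proof.
move=> oq; have q0 : 0 < q by case: q oq.
elim: x B => // t x IH B vtx /=; rewrite upper_cons.
case: (ltnP (idx t) q) => tq.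
  have u0 : upper q x = 0.
    case: (vs_inv vtx) => [[-> //]|[_ vx _]]; exact: upper_low vx tq.
  have vq : vs (q - 2) (t :: x).
    case: (vs_inv vtx) => [[-> ->]|[x0 vx tB]]; first by rewrite vs1.
    rewrite vs_cons // vx andbT; case: tB => [->|[ot _]]; rewrite ?eqxx // ot.
    by rewrite (_ : idx t <= q - 2) ?orbT //; lia.
  rewrite u0; split=> //.
  by rewrite (vtrunc_low vq) //; lia.
case: (vs_inv vtx) => [[_ E]|[x0 vx tB]]; first by move: tq; rewrite E idx_d; lia.
have [ux E au vd] := IH _ vx.
rewrite -[nat_of_bool true + _]add1n add1n /= tq au; split=> //.
by rewrite vtrunc_cons E /tr ltnNge tq.
Qed.

Lemma vs_cat_low q B X k z : odd q -> vs B X -> k <= upper q X -> vs (q - 2) z ->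
  q - 2 <= B -> vs B (take k X ++ z).
Proof.
move=> oq; elim: X k B => [|t X IH] k B; first by [].
case: k => [|k] vtX kX vz qB; first by rewrite take0; exact: vs_leq vz.
have tq : q <= idx t.
  move: kX; rewrite upper_cons; case: (leqP q (idx t)) => // tq.
  case: (vs_inv vtX) => [[-> _] //|[_ vX _]].
  by rewrite (upper_low vX tq).
have q0 : 0 < q by case: q oq {vz qB tq kX IH}.
case: (vs_inv vtX) => [[_ E]|[x0 vx tB]]; first by move: tq; rewrite E idx_d; lia.
have z0 : 0 < size z by case: (z) vz.
rewrite /= vs_cons; last by rewrite size_cat; lia.
have kX' : k <= upper q X by move: kX; rewrite upper_cons tq.
rewrite (IH k _ vx kX' vz); last lia.
by case: tB => [->|[-> ->]]; rewrite ?eqxx ?orbT.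
Qed.

Lemma vs_pad B z n : vs B z -> vs B (z ++ nseq n d).
Proof.
elim: z B => // t z IH B; case/vs_inv=> [[-> ->]|[z0 vz tB]].
  exact: (vs_nseq d B n).
rewrite /= vs_cons; last by rewrite size_cat; lia.
by rewrite IH // andbT; case: tB => [->|[-> ->]]; rewrite ?eqxx ?orbT.
Qed.

(* Moves [x] from the subtree below its first [k] tokens to the subtree below [u];
   there is room for this as soon as [size u <= k]. *)
Definition graft (u : seq nat) (k : nat) (x : seq nat) : seq nat :=
  u ++ drop k x ++ nseq (k - size u) d.

Section Graft.
Variables (q k : nat) (X : seq nat).
Hypotheses (q_odd : odd q) (q_le : q <= d.+1) (leafX : leafv X).
Hypothesis (leXk : upper q X <= k).
Let u := take (upper q X) X.

Let size_u : size u = upper q X.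
Proof.
case/andP: leafX => vX _; have [h _ _ _] := vs_split q_odd vX.
by rewrite size_take h.
Qed.

Let q0 : 0 < q.
Proof. by case: q q_odd. Qed.

(** As [u] is no longer than the prefix it replaces, the length is restored by padding at the end,
    and the tail of [x] has indices low enough to follow [u]. *)
Lemma graft_leaf x : leafv x -> upper q x = k -> leafv (graft u k x).
Proof.
case/andP=> vx /eqP sx ux; have [h _ _ vd] := vs_split q_odd vx; rewrite ux in h vd.
rewrite /leafv /graft !size_cat size_drop size_nseq size_u; apply/andP; split.
  case/andP: leafX => vX _; apply: (vs_cat_low q_odd) => //; last lia.
  exact: vs_pad.
by apply/eqP; lia.
Qed.

Lemma graft_vtrunc x : leafv x -> upper q x = k -> vtrunc q (graft u k x) = vtrunc q X.
Proof.
case/andP=> vx /eqP sx ux; have [h _ _ vd] := vs_split q_odd vx; rewrite ux in h vd.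
case/andP: leafX => vX /eqP sX; have [h' E' au _] := vs_split q_odd vX.
have q2 : q - 2 < q by lia.
rewrite E' /graft [LHS]map_cat; congr (_ ++ _).
  rewrite -[RHS]map_id; apply/eq_in_map => t /(allP au).
  by rewrite /tr ltnNge => ->.
rewrite -/(vtrunc q _) (vtrunc_low (vs_pad _ vd) q2) size_cat size_drop size_nseq.
by congr nseq; rewrite size_u; lia.
Qed.

(** Equal truncations mean equal upper prefixes. Exchanging a common prefix and appending common
    padding leaves lexicographic comparison unchanged. *)
Lemma graft_cmp q' x y : q' <= q -> leafv x -> leafv y -> upper q x = k ->
  vtrunc q x = vtrunc q y ->
  vlt (vtrunc q' (graft u k x)) (vtrunc q' (graft u k y)) =
    vlt (vtrunc q' x) (vtrunc q' y) /\
  vle (vtrunc q' (graft u k x)) (vtrunc q' (graft u k y)) =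
    vle (vtrunc q' x) (vtrunc q' y).
Proof.
move=> qq lx ly ux txy.
have uy : upper q y = k by rewrite upperE // -txy -upperE.
case/andP: (lx) (ly) => vx /eqP sx /andP[vy /eqP sy].
have [hx Ex ax _] := vs_split q_odd vx; have [hy Ey ay _] := vs_split q_odd vy.
rewrite ux in hx Ex ax; rewrite uy in hy Ey ay.
have txyk : take k x = take k y.
  by move: txy; rewrite Ex Ey sx sy => /(congr1 (take k));
    rewrite !take_size_cat ?size_takel //; lia.
have vltE : vlt (vtrunc q' (graft u k x)) (vtrunc q' (graft u k y)) =
    vlt (vtrunc q' x) (vtrunc q' y).
  rewrite -{2}(cat_take_drop k x) -{2}(cat_take_drop k y) -txyk.
  rewrite /graft /vtrunc !map_cat !vlt_cat vlt_catr //.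
  by rewrite !size_map !size_drop sx sy.
split=> //; rewrite /vle vltE; congr (_ || _).
rewrite -{2}(cat_take_drop k x) -{2}(cat_take_drop k y) -txyk.
rewrite /graft /vtrunc !map_cat !eqseq_cat ?eqxx ?andbT //.
by rewrite !size_map !size_drop sx sy.
Qed.

End Graft.

End Base.

(** * Least feasible labelings *)

Section LeastFeasible.
Variables (d R n : nat) (arcs : seq (nat * nat)) (pr : nat -> nat).
Variable mu : nat -> seq nat.

Notation vtrunc := (vtrunc d).
Notation upper := (upper d).
Notation vtop := (vtop d R).
Notation leafv := (leafv d R).
Notation valid := (valid d R).
Notation lift := (lift d R).
Notation NV := (NV d R).
Notation Xf := (Xf d R).

Hypothesis d_gt0 : 0 < d.
Hypothesis arcs_lt : forall v w : nat, (v, w) \in arcs -> (v < n) && (w < n).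
Hypothesis arcs_succ : forall v, v < n -> exists w : nat, (v, w) \in arcs.
Hypothesis pr_le : forall v, v < n -> pr v <= d.
Hypothesis mu_valid : forall v, v < n -> valid (mu v).
Hypothesis mu_lift : forall v w : nat, (v, w) \in arcs -> vle (mu v) (lift (pr v) (mu w)).

(** * Bellman-Ford with lifts as arc functions *)

Definition labels := nat -> seq nat.

Definition validl (D : labels) := forall v, v < n -> valid (D v).

Definition lel (D D' : labels) := forall v, v < n -> vle (D v) (D' v).

(** Top is a separate case because every arc out of a node labeled top is non-violated. *)
Definition feasv (D : labels) :=
  forall v, v < n -> D v = vtop \/ exists2 w : nat, (v, w) \in arcs & NV (pr v) (D v) (D w).

Definition relax (D : labels) (e : nat * nat) : labels :=
  if vlt (lift (pr e.1) (D e.2)) (D e.1)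
  then fun u => if u == e.1 then lift (pr e.1) (D e.2) else D u
  else D.

Definition relax_all (D : labels) : labels := foldl relax D arcs.

Definition bellman (k : nat) (D : labels) : labels := iter k relax_all D.

Lemma bellmanS k D : bellman k.+1 D = foldl relax (bellman k D) arcs.
Proof. by []. Qed.

Definition base (c : nat -> nat) : labels := fun v => Xf (c v) (pr v) (mu v).

Definition run (c : nat -> nat) : labels := bellman n (base c).

(** Only base labels have to be tested: a label lowered below its base is justified by
    [bellman_justified]. *)
Definition supported (c : nat -> nat) (v : nat) : bool :=
  has (fun e => (e.1 == v) && ~~ vlt (base c v) (lift (pr e.1) (run c e.2))) arcs.

Lemma lel_trans D2 D1 D3 : lel D1 D2 -> lel D2 D3 -> lel D1 D3.
Proof. by move=> h h' v vn; exact: vle_trans (h v vn) (h' v vn). Qed.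

Lemma lel_refl D : lel D D.
Proof. by move=> v _; exact: vle_refl. Qed.

Lemma relaxE D e v : validl D -> e \in arcs -> v < n ->
  [/\ valid (relax D e v), vle (relax D e v) (D v),
      v = e.1 -> vle (relax D e v) (lift (pr v) (D e.2)) &
      relax D e v = D v \/ v = e.1 /\ relax D e v = lift (pr v) (D e.2)].
Proof.
case: e => a b vD ab vn; have /andP[an bn] := arcs_lt ab.
have vL : valid (lift (pr a) (D b)) by apply: lift_valid; [|exact: pr_le|exact: vD].
rewrite /relax /=; case: ifP => h.
  case: eqVneq => [->|ne]; first by split; [|exact: vlt_vle|rewrite vle_refl|right].
  by split; [exact: vD|exact: vle_refl|move=> E; rewrite E eqxx in ne|left].
split; [exact: vD|exact: vle_refl| |by left].
by move=> ->; rewrite (valid_leNgt (vD a an) vL) h.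
Qed.

Lemma relax_mono D D' e : validl D -> validl D' -> e \in arcs -> lel D D' ->
  lel (relax D e) (relax D' e).
Proof.
move=> vD vD' ea DD' v vn; case: (relaxE vD ea vn) => _ h1 h2 _.
case: (relaxE vD' ea vn) => _ _ _ [->|[E ->]]; first exact: vle_trans (DD' v vn).
apply: vle_trans (h2 E) _; case: e ea E {h1 h2} => a b ab _.
have /andP[an bn] := arcs_lt ab.
by apply: lift_mono => //; [exact: pr_le|exact: vD|exact: vD'|exact: DD'].
Qed.

(** Updates are in place, so an arc may read a label that was already lowered. As [lift] is
    monotone, a pass still does at least as well as a simultaneous update. *)
Lemma relax_foldl s D : {subset s <= arcs} -> validl D ->
  [/\ validl (foldl relax D s), lel (foldl relax D s) D &
      forall v w : nat, (v, w) \in s -> vle (foldl relax D s v) (lift (pr v) (D w))].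
Proof.
elim: s D => [|e s IH] D ss vD /=; first by split=> // v _; exact: vle_refl.
have ea : e \in arcs by apply: ss; rewrite mem_head.
have vD' : validl (relax D e) by move=> v vn; case: (relaxE vD ea vn).
have DD' : lel (relax D e) D by move=> v vn; case: (relaxE vD ea vn).
have [|vF lF aF] := IH (relax D e) _ vD'.
  by move=> x xs; apply: ss; rewrite inE xs orbT.
split=> //; first exact: lel_trans lF DD'.
move=> v w; rewrite inE => /orP[/eqP E|vw].
  have /andP[vn wn] : (v < n) && (w < n) by apply: arcs_lt; rewrite E.
  case: (relaxE vD ea vn) => _ _ h _; apply: vle_trans (lF v vn) _.
  by move: h; rewrite -E /=; apply.
have /andP[vn wn] : (v < n) && (w < n) by apply: arcs_lt; apply: ss; rewrite inE vw orbT.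
apply: vle_trans (aF v w vw) _.
by apply: lift_mono => //; [exact: pr_le|exact: vD'|exact: vD|exact: DD'].
Qed.

Lemma foldl_mono s D D' : {subset s <= arcs} -> validl D -> validl D' ->
  lel D D' -> lel (foldl relax D s) (foldl relax D' s).
Proof.
elim: s D D' => [|e s IH] D D' ss vD vD' DD' //=.
have ea : e \in arcs by apply: ss; rewrite mem_head.
apply: IH => [x xs|v vn|v vn|]; first by apply: ss; rewrite inE xs orbT.
- by case: (relaxE vD ea vn).
- by case: (relaxE vD' ea vn).
- exact: relax_mono.
Qed.

Lemma bellman_valid k D : validl D -> validl (bellman k D).
Proof.
by move=> vD; elim: k => //= k IH; case: (relax_foldl (s := arcs) _ IH).
Qed.

Lemma bellman_dec k D : validl D -> lel (bellman k D) D.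
Proof.
move=> vD; elim: k => [|k IH]; first exact: lel_refl.
have [//|_ h _] := relax_foldl (s := arcs) _ (bellman_valid k vD).
exact: lel_trans h IH.
Qed.

Lemma bellman_mono k D D' : validl D -> validl D' -> lel D D' ->
  lel (bellman k D) (bellman k D').
Proof.
move=> vD vD' DD'; elim: k => //= k IH.
by apply: foldl_mono => //; exact: bellman_valid.
Qed.

Lemma bellman_ind (P : labels -> Prop) k D : validl D -> P D ->
  (forall F e, validl F -> e \in arcs -> P F -> P (relax F e)) -> P (bellman k D).
Proof.
move=> vD PD IP; elim: k => // k IH; rewrite bellmanS.
suff h s F : {subset s <= arcs} -> validl F -> P F -> P (foldl relax F s).
  by apply: h => //; exact: bellman_valid.
elim: s F => //= e s IHs F ss vF PF.
have ea : e \in arcs by apply: ss; rewrite mem_head.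
apply: IHs; [|by move=> v vn; case: (relaxE vF ea vn)|exact: IP].
by move=> x xs; apply: ss; rewrite inE xs orbT.
Qed.

(** With [nu := mu] this is the use made of the absence of loose arcs: lowering never leads below
    [mu]. *)
Lemma bellman_ge k D nu : validl D -> validl nu ->
  (forall v w : nat, (v, w) \in arcs -> vle (nu v) (lift (pr v) (nu w))) ->
  lel nu D -> lel nu (bellman k D).
Proof.
move=> vD vnu nl nD; apply: bellman_ind => // F e vF ea nF v vn.
case: (relaxE vF ea vn) => _ _ _ [->|[E ->]]; first exact: nF.
case: e ea E => a b ab /= E; subst a; have /andP[_ bn] := arcs_lt ab.
apply: vle_trans (nl _ _ ab) _.
by apply: lift_mono => //; [exact: pr_le|exact: vnu|exact: vF|exact: nF].
Qed.

Definition justified (X D : labels) := forall v, v < n ->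
  D v = X v \/ exists2 w : nat, (v, w) \in arcs & vle (lift (pr v) (D w)) (D v).

(** After [v] was lowered along an arc, the head of that arc can only become smaller, so the arc
    remains a justification until [v] is lowered again, along another one. *)
Lemma bellman_justified k D : validl D -> justified D (bellman k D).
Proof.
move=> vD; apply: bellman_ind => // [|F e vF ea jF v vn]; first by left.
have dec w : (v, w) \in arcs -> vle (lift (pr v) (F w)) (relax F e v) ->
    vle (lift (pr v) (relax F e w)) (relax F e v).
  move=> vw; apply: vle_trans; have /andP[_ wn] := arcs_lt vw.
  case: (relaxE vF ea wn) => h1 h2 _ _.
  by apply: lift_mono => //; [exact: pr_le|exact: vF].
case: (relaxE vF ea vn) => _ _ _ [E|[E E2]].
  case: (jF v vn) => [<-|[w vw h]]; first by left.
  by right; exists w => //; apply: dec => //; rewrite E.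
right; exists e.2; first by rewrite E -surjective_pairing.
by apply: dec; rewrite ?E2 ?vle_refl // E -surjective_pairing.
Qed.

(** One pass per arc, counted from the end of the path: each pass carries the inequality one node
    backwards, by monotonicity of [lift]. *)
Lemma bellman_path k k' (x : nat -> nat) (nu : nat -> seq nat) D : validl D ->
  k <= k' ->
  (forall i, i <= k -> valid (nu i)) ->
  (forall i, i < k -> (x i, x i.+1) \in arcs /\ NV (pr (x i)) (nu i) (nu i.+1)) ->
  x k < n -> vle (D (x k)) (nu k) -> vle (bellman k' D (x 0)) (nu 0).
Proof.
move=> vD; elim: k k' x nu => [|k IH] k' x nu kk vnu st xn dk.
  exact: vle_trans (bellman_dec _ vD xn) dk.
case: k' kk => // k' kk.
have [a0 nv0] := st 0 isT; have /andP[x0n x1n] := arcs_lt a0.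
have h : vle (bellman k' D (x 1)) (nu 1).
  apply: (IH k' (fun i => x i.+1) (fun i => nu i.+1)) => //.
  - by move=> i ik; apply: vnu.
  - by move=> i ik; apply: st.
have [//|_ _ /(_ _ _ a0) h2] := relax_foldl (s := arcs) _ (bellman_valid k' vD).
apply: vle_trans h2 _; apply: (@vle_trans (lift (pr (x 0)) (nu 1))).
  by apply: lift_mono => //; [exact: pr_le|exact: bellman_valid|exact: vnu].
by rewrite -lift_NV ?pr_le //; exact: vnu.
Qed.

(** * Support of base labels and even cycles *)

Definition bounded (c : nat -> nat) := forall v, v < n -> c v <= R.+1.

Lemma base_valid c : bounded c -> validl (base c).
Proof. by move=> bc v vn; apply: Xf_valid => //; [exact: pr_le|exact: bc|exact: mu_valid]. Qed.

Lemma run_valid c : bounded c -> validl (run c).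
Proof. by move=> /base_valid/bellman_valid; apply. Qed.

Lemma base_ge c : bounded c -> lel mu (base c).
Proof. by move=> bc v vn; apply: Xf_ge => //; [exact: pr_le|exact: bc|exact: mu_valid]. Qed.

Lemma base_anti c c' : bounded c' -> (forall v, v < n -> c v <= c' v) ->
  lel (base c') (base c).
Proof.
move=> bc cc v vn; apply: Xf_anti => //;
  [exact: pr_le|exact: cc|exact: bc|exact: mu_valid].
Qed.

Lemma run_ge c : bounded c -> lel mu (run c).
Proof. by move=> bc; apply: bellman_ge => //; [exact: base_valid|exact: base_ge]. Qed.

Lemma bounded_le c c' : bounded c' -> (forall v, v < n -> c v <= c' v) -> bounded c.
Proof. by move=> bc cc v vn; exact: leq_trans (cc v vn) (bc v vn). Qed.

Lemma run_anti c c' : bounded c' -> (forall v, v < n -> c v <= c' v) ->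
  lel (run c') (run c).
Proof.
move=> bc cc; have bc' := bounded_le bc cc.
by apply: bellman_mono; [exact: base_valid|exact: base_valid|exact: base_anti].
Qed.

Lemma supportedP c v : bounded c -> v < n ->
  reflect (exists2 w : nat, (v, w) \in arcs & vle (lift (pr v) (run c w)) (base c v))
          (supported c v).
Proof.
move=> bc vn; have E w : (v, w) \in arcs ->
    vle (lift (pr v) (run c w)) (base c v) = ~~ vlt (base c v) (lift (pr v) (run c w)).
  move=> /arcs_lt/andP[_ wn]; apply: valid_leNgt (base_valid bc vn).
  by apply: lift_valid => //; [exact: pr_le|exact: run_valid].
apply: (iffP hasP) => [[[a b] ab /andP[/eqP /= av h]]|[w vw h]].
  by subst a; exists b; rewrite ?E.
by exists (v, w); rewrite //= eqxx -E.
Qed.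

Definition stable (c : nat -> nat) := forall v, v < n -> supported c v.

(** Higher bounds elsewhere only lower the computed labels, while the base label of [v] stays the
    same. *)
Lemma supported_anti c c' v : bounded c' -> (forall v, v < n -> c v <= c' v) ->
  v < n -> c v = c' v -> supported c v -> supported c' v.
Proof.
move=> bc cc vn E; have bc' := bounded_le bc cc.
case/(supportedP bc' vn)=> w vw h; apply/(supportedP bc vn); exists w => //.
have /andP[_ wn] := arcs_lt vw; rewrite /base -E; apply: vle_trans h.
by apply: lift_mono => //; [exact: pr_le|exact: run_valid|exact: run_valid|exact: run_anti].
Qed.

Lemma stable_feasible c : bounded c -> stable c -> feasv (run c).
Proof.
move=> bc sc v vn; right; have vr := run_valid bc.
suff [w vw h] : exists2 w : nat, (v, w) \in arcs & vle (lift (pr v) (run c w)) (run c v).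
  have /andP[_ wn] := arcs_lt vw.
  by exists w => //; rewrite lift_NV ?pr_le //; exact: vr.
have [E|//] := bellman_justified n (base_valid bc) vn.
by have /(supportedP bc vn)[w vw h] := sc v vn; exists w; rewrite // /run E.
Qed.

(* A cycle through [b] dominated by the even priority of [b], as followed by a
   feasible labeling. *)
Definition even_cycle (nu : labels) (b k : nat) := exists l (x : nat -> nat),
  [/\ [/\ validl nu, lel mu nu, 0 < l & l <= n],
      x 0 = b, x l = b,
      forall i, [/\ (x i, x i.+1) \in arcs, NV (pr (x i)) (nu (x i)) (nu (x i.+1)),
                   leafv (nu (x i)) & pr (x i) <= pr b] &
      [/\ ~~ odd (pr b), upper (pr b).+1 (nu b) = k &
        forall i, i <= l -> vtrunc (pr b).+1 (nu (x i)) = vtrunc (pr b).+1 (nu b)]].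

(** Grafted below the base label of [b], the labels of the cycle form a non-violated walk from [x 1]
    back to [b]. Its final label is at least the base label, which is minimal in its subtree, so
    Bellman-Ford gets below the walk at [x 1], and the arc to [x 1] gives the support. *)
Lemma even_cycle_supported nu b k c : even_cycle nu b k -> bounded c -> c b <= k.+1 ->
  supported c b.
Proof.
case=> l [x [[vnu _ l0 ln] x0 xl st [ep uk tr]]] bc ck.
have [a0 nv0 lf0 _] := st 0; rewrite x0 in a0 nv0 lf0.
have /andP[bn x1n] := arcs_lt a0; have pd := pr_le bn.
have op : odd (pr b).+1 by rewrite /= ep.
apply/(supportedP bc bn); exists (x 1) => //.
case: (eqVneq (base c b) vtop) => [->|nt].
  apply: valid_le_top => //; apply: lift_valid => //; exact: run_valid.
have lm : leafv (mu b).
  apply: valid_leaf (mu_valid bn) _; apply/eqP => E.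
  case n0: (noX (c b) (pr b)).
    by move: nt; rewrite /base Xf_none ?eqxx //; exact: mu_valid.
  by move: nt; rewrite /base /Xf n0 E LF_top ?eqxx.
have nX : ~~ noX (c b) (pr b).
  by apply/negP => h; move: nt; rewrite /base Xf_none ?eqxx //; exact: leaf_valid.
have [lX uX _ mX] := Xf_spec d_gt0 nX pd (bc b bn) lm nt.
rewrite -/(base c b) in lX uX mX.
have uXk : upper (pr b).+1 (base c b) <= k by rewrite -ltnS; exact: leq_trans uX ck.
set u := take (upper (pr b).+1 (base c b)) (base c b).
have ut i : i <= l -> upper (pr b).+1 (nu (x i)) = k.
  by move=> il; rewrite upperE // tr // -upperE.
have lg i : i <= l -> leafv (graft d u k (nu (x i))).
  move=> il; have [_ _ lf _] := st i.
  refine (graft_leaf d_gt0 op pd lX uXk lf (ut i il)).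
have tg i : i <= l -> vtrunc (pr b).+1 (graft d u k (nu (x i))) =
    vtrunc (pr b).+1 (base c b).
  move=> il; have [_ _ lf _] := st i.
  refine (graft_vtrunc d_gt0 op pd lX uXk lf (ut i il)).
have h : vle (run c (x 1)) (graft d u k (nu (x 1))).
  (* The walk skips the first arc of the cycle, hence has [l - 1] arcs, and [l <= n] makes [n]
     passes enough. *)
  apply: (@bellman_path l.-1 n (fun i => x i.+1)
    (fun i => graft d u k (nu (x i.+1)))).
  - exact: base_valid.
  - exact: leq_trans (leq_pred l) ln.
  - by move=> i il; apply/leaf_valid/lg; rewrite -(prednK l0).
  - move=> i il; have [a1 nv1 lf1 pr1] := st i.+1; split=> //.
    have [_ _ lf2 _] := st i.+2.
    have il2 : i.+2 <= l by rewrite -(prednK l0).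
    have qq : oddup (pr (x i.+1)) <= (pr b).+1.
      by have := oddup_mono pr1; rewrite /oddup (negPf ep).
    have E : vtrunc (pr b).+1 (nu (x i.+2)) = vtrunc (pr b).+1 (nu (x i.+1)).
      by rewrite !tr // ltnW.
    have u2 : upper (pr b).+1 (nu (x i.+2)) = k by exact: ut.
    have [El Ee] := graft_cmp d_gt0 op pd lX uXk qq lf2 lf1 u2 E.
    rewrite /NV /u El Ee; move: nv1; rewrite /NV.
    (* The alternative of two tops cannot occur on a cycle of leaves. *)
    case: ifP => // _ /orP[->//|/andP[/eqP F _]].
    by have := leaf_neq_top d_gt0 lf1; rewrite F eqxx.
  - by rewrite prednK ?xl.
  - rewrite prednK // xl; apply: mX; first by have := lg l (leqnn l); rewrite xl.
    by have := tg l (leqnn l); rewrite xl.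
apply: (@vle_trans (lift (pr b) (graft d u k (nu (x 1))))).
  apply: lift_mono => //; first exact: run_valid.
  exact/leaf_valid/lg.
(* The priority of [b] is even, so the first arc only compares truncations, and all grafted labels
   share the one of the base label. *)
rewrite -lift_NV //; try exact/leaf_valid; last exact/leaf_valid/lg.
by rewrite /NV (negPf ep) /oddup (negPf ep) tg // vle_refl.
Qed.

(** The least leaf in the subtree of [nu b] competes in the search for the base label. It is still
    above [mu b]: the even arc to [x 1] only constrains the truncation, and [mu b] is at most the
    lift of [mu (x 1)], hence of [nu (x 1)]. *)
Lemma even_cycle_base nu b k c : even_cycle nu b k -> k < c -> c <= R.+1 ->
  vle (Xf c (pr b) (mu b)) (nu b).
Proof.
case=> l [x [[vnu mnu l0 ln] x0 xl st [ep uk tr]]] kc cR.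
have [a0 nv0 lf0 _] := st 0; rewrite x0 in a0 nv0 lf0.
have /andP[bn x1n] := arcs_lt a0; have pd := pr_le bn.
have op : odd (pr b).+1 by rewrite /= ep.
have lm : leafv (mu b).
  apply: valid_leaf (mu_valid bn) _; apply/eqP => E.
  have := vle_vlt_trans (mnu b bn) (leaf_lt_top d_gt0 lf0).
  by rewrite E vlt_irr.
have [ly yn ty] := LF_weak_le d_gt0 op pd lf0.
apply: vle_trans yn; apply: Xf_min => //.
- by rewrite /noX (negPf ep) /=; case: (c) kc.
- apply: vle_trans (mu_lift a0) _.
  apply: (@vle_trans (lift (pr b) (nu (x 1)))).
    by apply: lift_mono => //; [exact: mu_valid|exact: vnu|exact: mnu].
  rewrite -lift_NV //; [|exact: vnu|exact: leaf_valid].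
  by rewrite /NV (negPf ep) /oddup (negPf ep) ty tr ?vle_refl.
- by rewrite upperE // ty -upperE // uk.
- move=> z lz tz; apply: LF_min => //; first exact: upper_leaf.
  by rewrite /glcond tz ty vle_refl.
Qed.

(** Truncations at the highest priority decrease weakly around the cycle, so they are constant, and
    an odd highest priority would make one step strict. The dominating node is reached in fewer than
    [n] steps, matching the number of passes. *)
Lemma even_cycle_exists nu v : validl nu -> lel mu nu -> feasv nu -> v < n ->
  nu v != vtop -> exists k (x : nat -> nat) j,
  [/\ j < n, x 0 = v,
      forall i, (x i, x i.+1) \in arcs /\ NV (pr (x i)) (nu (x i)) (nu (x i.+1)) &
      even_cycle nu (x j) k].
Proof.
move=> vnu mnu fnu vn nt.
(* The successor is the first non-violated arc in the list; [fP] shows that the default is not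
   reached at nodes below top. *)
pose f v := (nth (v, v) arcs
  (find (fun e => (e.1 == v) && NV (pr v) (nu v) (nu e.2)) arcs)).2.
have fP a : a < n -> nu a != vtop ->
    [/\ (a, f a) \in arcs, NV (pr a) (nu a) (nu (f a)) & f a < n].
  move=> an; have [->|[w aw nw]] := fnu a an; first by rewrite eqxx.
  have h : has (fun e => (e.1 == a) && NV (pr a) (nu a) (nu e.2)) arcs.
    by apply/hasP; exists (a, w); rewrite //= eqxx.
  have := nth_find (a, a) h; rewrite -/(f a) => /andP[/eqP E nv].
  have fa : (a, f a) \in arcs.
    by rewrite -{1}E -surjective_pairing mem_nth // -has_find.
  by split=> //; have /andP[] := arcs_lt fa.
have lf a : a < n -> nu a != vtop -> nu (f a) != vtop.
  move=> an na; have [fa nv fn] := fP a an na.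
  apply/eqP => E; move: nv; rewrite lift_NV ?pr_le //; try exact: vnu.
  rewrite E /lift LF_top //; last by apply: oddup_le; exact: pr_le.
  move=> h; have := vle_vlt_trans h (leaf_lt_top d_gt0 (valid_leaf (vnu a an) na)).
  by rewrite vlt_irr.
pose x i := iter i f v.
have xP i : x i < n /\ nu (x i) != vtop.
  elim: i => [|i [xn xt]] //; rewrite /x iterS -/(x i).
  by have [_ _ fn] := fP _ xn xt; split=> //; exact: lf.
have st i : [/\ (x i, x i.+1) \in arcs, NV (pr (x i)) (nu (x i)) (nu (x i.+1)) &
               leafv (nu (x i))].
  have [xn xt] := xP i; have [fa nv fn] := fP _ xn xt.
  by split=> //; exact: valid_leaf (vnu _ xn) xt.
have [i [j [ij jn xij]]] : exists i j, [/\ i < j, j <= n & x i = x j].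
  have : ~~ uniq (traject f v n.+1).
    apply/negP => /(fun u => uniq_leq_size u (s2 := iota 0 n)) h.
    suff: size (traject f v n.+1) <= size (iota 0 n) by rewrite size_traject size_iota ltnn.
    apply: h => a /trajectP[k _ ->]; rewrite mem_iota add0n /=.
    by case: (xP k).
  case/(uniqPn v)=> i [j [ij]]; rewrite size_traject => jn.
  by rewrite !nth_traject // => [E|]; [exists i, j | exact: ltn_trans jn].
pose l := j - i.
have per t : i <= t -> x (t + l) = x t.
  move=> it; have -> : t + l = (t - i) + j by rewrite /l; move: it ij; clear; lia.
  by rewrite /x iterD -/(x j) -xij -iterD subnK.
have [m /andP[im mj] mm] : exists2 m, i <= m < j &
    forall t, i <= t < j -> pr (x t) <= pr (x m).
  case: (@arg_maxnP 'I_j (Ordinal ij) (fun t => i <= t) (fun t => pr (x t))) => //= m im mm.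
  exists m; first by rewrite im ltn_ord.
  by move=> t /andP[it tj]; exact: (mm (Ordinal tj)).
(* Periodicity extends the maximum over one turn to the whole tail, because [even_cycle] speaks of
   an infinite walk. *)
have mx t : i <= t -> pr (x t) <= pr (x m).
  elim: t {-2}t (leqnn t) => [|t IH] s st' is'.
    by apply: mm; rewrite is' /=; move: st' ij; clear; lia.
  case: (ltnP s j) => sj; first by apply: mm; rewrite is'.
  have [ls is2 s2t] : [/\ l <= s, i <= s - l & s - l <= t].
    by rewrite /l; move: sj st' ij; clear => *; split; lia.
  by rewrite -(subnK ls) per //; exact: IH.
set p := pr (x m); have [xmn _] := xP m; have pd : p <= d by exact: pr_le.
pose T t := vtrunc (oddup p) (nu (x (m + t))).
have dec t : vle (T t.+1) (T t).
  rewrite /T addnS; have [_ nv _] := st (m + t).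
  have pm : pr (x (m + t)) <= p by apply: mx; exact: leq_trans (leq_addr _ _).
  by apply: NV_trunc pm pd _ _ nv => //; apply: vnu; exact: (xP _).1.
have decs t s : vle (T (t + s)) (T t).
  elim: s => [|s IH]; first by rewrite addn0 vle_refl.
  by rewrite addnS; exact: vle_trans (dec _) IH.
have Tl : T l = T 0 by rewrite /T addn0 per.
have TE t : t <= l -> T t = T 0.
  move=> tl; apply: vle_anti; first by have := decs 0 t; rewrite add0n.
  by rewrite -Tl -{1}(subnKC tl); exact: decs.
have ep : ~~ odd p.
  apply/negP => op; have [_ nv lm] := st m.
  move: nv; rewrite /NV -/p op => /orP[|/andP[/eqP E _]]; last first.
    by have := leaf_neq_top d_gt0 lm; rewrite E eqxx.
  have := TE 1; rewrite /T addn0 addn1 => ->; first by rewrite vlt_irr.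
  by rewrite subn_gt0.
exists (upper p.+1 (nu (x m))), x, m; split=> //; first exact: leq_trans jn.
  by move=> t; have [] := st t.
exists l, (fun t => x (m + t)); split.
- by split=> //; rewrite ?subn_gt0 // /l; exact: leq_trans (leq_subr _ _) jn.
- by rewrite addn0.
- exact: per.
- move=> t; rewrite addnS; have [? ? ?] := st (m + t); split=> //.
  by apply: mx; exact: leq_trans (leq_addr _ _).
- split=> // t tl; have := TE t tl; rewrite /T addn0 /oddup.
  by rewrite (negPf ep).
Qed.

(** * The rounds and their invariant *)

Definition demote (cur : nat) (c : nat -> nat) : nat -> nat :=
  fun v => if (c v == cur) && ~~ supported c v then cur.-1 else c v.

(** The active nodes are those with [c v = cur]. A demoted node is frozen, since only nodes at the
    current bound ever move. *)
Definition promote (cur : nat) (c : nat -> nat) : nat -> nat :=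
  fun v => if c v == cur then cur.+1 else c v.

(** The second clause says that everything below the current bound is settled. The third says that
    no node was frozen too early: the base of an even cycle stays active until its bound admits the
    [k] tokens of the cycle. *)
Definition inv (cur : nat) (c : nat -> nat) : Prop :=
  [/\ forall v, v < n -> c v <= cur,
      stable (fun v => minn (c v) cur.-1) &
      forall nu b k, even_cycle nu b k -> minn cur k.+1 <= c b].

Lemma stable_ext c c' : bounded c -> (forall v, v < n -> c v = c' v) ->
  stable c -> stable c'.
Proof.
move=> bc E sc v vn; have bc' : bounded c' by move=> u un; rewrite -E //; exact: bc.
apply: supported_anti (sc v vn) => //; last exact: E.
by move=> u un; rewrite E.
Qed.

(** With all bounds 0 every base label is top, which any arc supports. *)
Lemma inv_init : inv 0 (fun=> 0).
Proof.
split=> // v vn.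
have bc : bounded (fun=> minn 0 0.-1) by [].
apply/(supportedP bc vn); have [w vw] := arcs_succ vn; exists w => //.
have /andP[_ wn] := arcs_lt vw.
rewrite /base Xf_none; [|done|by rewrite /noX min0n orbT|exact: mu_valid].
by apply: valid_le_top => //; apply: lift_valid => //; [exact: pr_le|exact: run_valid].
Qed.

(** An unsupported active node is the base of no even cycle with [cur <= k + 1], by
    [even_cycle_supported], so [cur - 1] respects the third clause. The cap at [cur - 1] hides the
    change from the second. *)
Lemma inv_demote cur c : inv cur c -> cur <= R.+1 -> inv cur (demote cur c).
Proof.
move=> [cc sc lc] cR; have bc : bounded c by move=> v vn; exact: leq_trans (cc v vn) cR.
split.
- by move=> v vn; rewrite /demote; case: ifP => _; [exact: leq_pred|exact: cc].
- apply: stable_ext sc => [v vn|v vn]; first by have := cc v vn; lia.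
  by rewrite /demote; case: ifP => // /andP[/eqP -> _]; lia.
- move=> nu b k cyc; have := lc _ _ _ cyc; rewrite /demote.
  case: ifP => // /andP[/eqP E ns] _; case: (leqP cur k.+1) => h; last lia.
  by move: ns; rewrite (even_cycle_supported cyc) // E.
Qed.

(** Frozen nodes inherit support from the capped bounds through [supported_anti]; the active ones
    are supported by assumption. Hence [c] itself is stable. *)
Lemma inv_promote cur c : inv cur c -> cur <= R.+1 ->
  (forall v, v < n -> c v = cur -> supported c v) -> inv cur.+1 (promote cur c).
Proof.
move=> [cc sc lc] cR act; have bc : bounded c by move=> v vn; exact: leq_trans (cc v vn) cR.
split.
- by move=> v vn; rewrite /promote; case: ifP => // _; have := cc v vn; lia.
- have sc' : stable c.
    move=> v vn; case: (eqVneq (c v) cur) => [E|ne]; first exact: act.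
    apply: supported_anti (sc v vn) => //; first by move=> u un; lia.
    by have := cc v vn; lia.
  apply: stable_ext sc' => // v vn; rewrite /promote /=.
  by have := cc v vn; case: eqP => [->|]; lia.
- move=> nu b k cyc; have := lc _ _ _ cyc; rewrite /promote.
  by case: eqP; case: cyc => l [x [[_ _ _ _] <- _ /(_ 0)[/arcs_lt/andP[bn _] _ _ _] _]];
    have := cc _ bn; lia.
Qed.

(** The cap [R + 1] admits [R] tokens, as many as any leaf has. So every even cycle has its base
    label below its own label, and the path leading to the cycle transports this to each node below
    top. *)
Lemma inv_final c : inv R.+2 c -> let D := run (fun v => minn (c v) R.+1) in
  [/\ validl D, lel mu D, feasv D &
      forall nu, validl nu -> lel mu nu -> feasv nu -> lel D nu].
Proof.
move=> [cc sc lc] D; have bc : bounded (fun v => minn (c v) R.+1) by move=> v vn; lia.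
split; [exact: run_valid|exact: run_ge|exact: stable_feasible|].
move=> nu vnu mnu fnu v vn; case: (eqVneq (nu v) vtop) => [->|nt].
  by apply: valid_le_top => //; exact: run_valid.
have [k [x [j [jn x0 st cyc]]]] := even_cycle_exists vnu mnu fnu vn nt.
have xn i : x i < n by have [/arcs_lt/andP[]] := st i.
have kR : k <= R.
  case: cyc => l [y [[_ _ _ _] y0 _ /(_ 0)[_ _ + _] [_ <- _]]]; rewrite y0 => lf.
  exact: upper_leaf.
rewrite -x0; apply: (@bellman_path j n x (fun i => nu (x i))) => //.
- exact: base_valid.
- exact: ltnW.
- by move=> i _; exact: vnu.
- apply: (even_cycle_base cyc); last lia.
  by have := lc _ _ _ cyc; lia.
Qed.

End LeastFeasible.

(** * Leaves as words *)

Lemma bits_lt_irr s : bits_lt s s = false.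
Proof. by elim: s => //= b s ->; rewrite eqxx. Qed.

Lemma bits_lt_total s t : ~~ bits_lt s t -> ~~ bits_lt t s -> s = t.
Proof.
elim: s t => [|b s IH] [|c t] //=; first by case: c.
  by case: b.
by case: eqP => [->|]; [rewrite eqxx => h1 h2; rewrite (IH t)|case: b; case: c].
Qed.

Lemma lex_lt_irr s : lex_lt s s = false.
Proof. by elim: s => //= a s ->; rewrite bits_lt_irr andbF. Qed.

Lemma lex_lt_total s t : size s = size t -> ~~ lex_lt s t -> ~~ lex_lt t s -> s = t.
Proof.
elim: s t => [|a s IH] [|b t] //= [sst]; rewrite !negb_or => /andP[h1 h2] /andP[h3 h4].
have ab := bits_lt_total h1 h3; subst b; move: h2 h4; rewrite eqxx /= => h2 h4.
by rewrite (IH t).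
Qed.

Section Tokens.
Variable d : nat.

Definition toks (I : seq nat) (s : seq bitseq) : seq nat :=
  flatten [seq [seq tok d c.1 b | b <- c.2] | c <- zip I s].

Definition pad (N : nat) (l : seq nat) : seq nat := l ++ nseq (N - size l) d.

#[local] Arguments pad : simpl never.

Lemma idx_tok i b : i <= d -> idx d (tok d i b) = i.
Proof. by rewrite /idx /tok; case: b; lia. Qed.

Lemma toks_cons i I a s : toks (i :: I) (a :: s) = [seq tok d i b | b <- a] ++ toks I s.
Proof. by []. Qed.

Lemma pad_cons N t l : size l <= N -> pad N.+1 (t :: l) = t :: pad N l.
Proof. by []. Qed.

Lemma size_pad N l : size l <= N -> size (pad N l) = N.
Proof. by move=> lN; rewrite size_cat size_nseq subnKC. Qed.

Lemma size_toks I s : size I = size s -> size (toks I s) = sumn [seq size a | a <- s].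
Proof.
elim: I s => [|i I IH] [|a s] //= [sI].
by rewrite toks_cons size_cat size_map IH.
Qed.

Lemma mem_toks I s t : all (fun i => i <= d) I -> t \in toks I s -> idx d t \in I.
Proof.
elim: I s => [|i I IH] [|a s] //= /andP[id Id].
rewrite toks_cons mem_cat inE => /orP[/mapP[b _ ->]|/(IH _ Id) ->]; last by rewrite orbT.
by rewrite idx_tok ?eqxx.
Qed.

Lemma tr_tok q i b : i <= d -> q <= i -> tr d q (tok d i b) = tok d i b.
Proof. by move=> id qi; rewrite /tr idx_tok // ltnNge qi. Qed.

(** For the place where one bit string ends and the other goes on: the ended one continues with a
    token of smaller index, which [tok_lt] puts between the tokens of the bits 0 and 1, as in 0s <
    epsilon < 1s'. *)
Lemma vtrunc_toks_head q i I s N : all (fun j => j < i) I -> i <= d -> 0 < i ->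
  exists h r, vtrunc d q (pad N.+1 (toks I s)) = h :: r /\ idx d h < i.
Proof.
move=> Ii id i0.
have : forall t, t \in vtrunc d q (pad N.+1 (toks I s)) -> idx d t < i.
  move=> t /mapP[u + ->]; rewrite /tr; case: ifP; rewrite ?idx_d // => _.
  rewrite mem_cat mem_nseq => /orP[h|/andP[_ /eqP ->]]; last by rewrite idx_d.
  apply: (allP Ii); apply: mem_toks h.
  by apply/allP => j /(allP Ii) ji; exact: leq_trans (ltnW ji) id.
case E: (vtrunc _ _ _) => [|h r] H; last by exists h, r; split; rewrite ?H ?mem_head.
have := congr1 size E; rewrite size_map size_cat size_nseq /=.
by case: (toks I s) => //=.
Qed.

Lemma tok_lt i h b : idx d h < i -> i <= d ->
  [/\ (h < tok d i b) = b, (tok d i b < h) = ~~ b & (h == tok d i b) = false].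
Proof.
by move=> hi id; rewrite /tok; case: b; rewrite /idx in hi; split; lia.
Qed.

Lemma vtrunc_toks_low q I s N : all (fun i => i <= d) I -> all (fun i => i < q) I ->
  size (toks I s) <= N -> vtrunc d q (pad N (toks I s)) = nseq N d.
Proof.
move=> Id Iq sN; rewrite -{2}(size_pad sN) -(size_vtrunc d q); apply/all_pred1P/allP.
move=> t /mapP[u + ->]; rewrite /tr mem_cat mem_nseq => /orP[|/andP[_ /eqP ->]].
  by move/(mem_toks Id)/(allP Iq) => -> /=.
by case: ifP => /=.
Qed.

Lemma mask_none T (p : nat) I (s : seq T) : all (fun i => i < p) I ->
  mask [seq p <= i | i <- I] s = [::].
Proof.
elim: I s => [|i I IH] [|a s] //= /andP[ip Ip].
by rewrite leqNgt ip /= IH.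
Qed.

(** Induction on the components, and inside on the bits of the highest one; components below the cut
    contribute only erased tokens. The two cuts need to agree on the indices only, so that [q] can
    be [oddup p]. *)
Lemma vlt_toks p q I s t N : sorted gtn I ->
  all (fun i => (0 < i <= d) && ((p <= i) == (q <= i))) I ->
  size s = size I -> size t = size I ->
  size (toks I s) <= N -> size (toks I t) <= N ->
  vlt (vtrunc d q (pad N (toks I s))) (vtrunc d q (pad N (toks I t))) =
    lex_lt (mask [seq p <= i | i <- I] s) (mask [seq p <= i | i <- I] t).
Proof.
elim: I s t N => [|i I IH] [|a s] [|b t] N //; first by move=> _ _ _ _ _ _; rewrite vlt_irr.
rewrite /= path_sortedE; last by move=> x y z /=; lia.
case/andP=> Ii sI /andP[/andP[/andP[i0 id] /eqP pqi] aI] [ss] [st].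
have Id : all (fun j => j <= d) I.
  by apply/allP => j /(allP Ii) /= ji; exact: leq_trans (ltnW ji) id.
case: (leqP p i) pqi => pi /esym qi; last first.
  have Ip : all (fun j => j < p) I.
    by apply/allP => j /(allP Ii) /= ji; exact: ltn_trans ji pi.
  have Iq : all (fun j => j < q) (i :: I).
    rewrite /= ltnNge qi; apply/allP => j jI; move: (allP Ip j jI) (allP aI j jI).
    by rewrite !ltnNge => /negPf -> /andP[_ /eqP <-].
  move=> sN tN; rewrite !vtrunc_toks_low //= ?id //.
  by rewrite !mask_none // vlt_irr.
rewrite !toks_cons /=.
elim: a b N => [|x a IHa] [|y b] N.
- by move=> sN tN; rewrite eqxx /=; exact: IH.
- case: N => // N sN tN; rewrite cat0s map_cons cat_cons pad_cons //.
  have [h [r [-> hi]]] := vtrunc_toks_head q s N Ii id i0.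
  rewrite vtrunc_cons tr_tok //=; have [-> _ ->] := tok_lt y hi id.
  by rewrite !orbF.
- case: N => // N sN tN; rewrite cat0s map_cons cat_cons pad_cons //.
  have [h [r [-> hi]]] := vtrunc_toks_head q t N Ii id i0.
  rewrite vtrunc_cons tr_tok //=; have [_ -> e] := tok_lt x hi id.
  by rewrite eq_sym e !orbF.
case: N => // N sN tN; rewrite !map_cons !cat_cons !pad_cons //.
rewrite !vtrunc_cons !tr_tok //= IHa // eqseq_cons.
have [E|ne] := eqVneq x y; first by rewrite E ltnn eqxx.
have -> : (tok d i x < tok d i y) = y by clear sN tN; rewrite /tok; case: x y ne => [] [] //=; lia.
have -> : (tok d i x == tok d i y) = false by clear sN tN; rewrite /tok; case: x y ne => [] [] //=; lia.
by rewrite !orbF.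
Qed.

End Tokens.

(** * Labels and valid words correspond to each other *)

Lemma indicesS h : indices h.+1 = h.*2.+1 :: indices h.
Proof.
by rewrite /indices -(add1n h) iotaD map_cat /= (iotaDl 1 0) -map_comp.
Qed.

Lemma size_indices h : size (indices h) = h.
Proof. by rewrite size_map size_iota. Qed.

Lemma indicesP h : all (fun i => odd i && (i < h.*2)) (indices h).
Proof.
elim: h => // h IH; rewrite indicesS /= odd_double /= doubleS; apply/andP; split; first by lia.
by apply: sub_all IH => i /andP[-> ih] /=; lia.
Qed.

Lemma indices_sorted h : sorted gtn (indices h).
Proof.
elim: h => // h IH; rewrite indicesS /= path_sortedE; last by move=> x y z /=; lia.
by rewrite IH andbT; apply: sub_all (indicesP h) => i /andP[_] /=; lia.
Qed.

Lemma vtrunc1 d x : vtrunc d 1 x = x.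
Proof.
rewrite /vtrunc -[RHS]map_id; apply: eq_map => t; rewrite /tr.
by case: ifP => //; rewrite /idx; lia.
Qed.

Section Vectors.
Variables n h : nat.
Notation d := (h.*2).
Notation R := (trunc_log 2 n).

Definition vec (x : label n h) : seq nat :=
  if x is Some xi then pad d R.+1 (toks d (indices h) (val xi)) else vtop d R.

Lemma size_leaf (xi : leaf n h) : size (toks d (indices h) (val xi)) <= R.
Proof. by rewrite size_toks ?size_indices ?size_tuple //; exact: (valP xi). Qed.

Lemma vs_pad_toks k s m : k <= h -> size s = k ->
  vs d k.*2.-1 (toks d (indices k) s ++ nseq m.+1 d).
Proof.
elim: k s => [|k IH] [|a s] //; first by move=> _ _; exact: vs_nseq.
move=> kh [sk]; rewrite indicesS toks_cons -catA doubleS /=.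
have {}IH : vs d k.*2.+1 (toks d (indices k) s ++ nseq m.+1 d).
  by apply: vs_leq (IH s _ sk); lia.
elim: a => //= b a IHa; rewrite vs_cons; last by rewrite !size_cat /=; lia.
by rewrite idx_tok ?IHa /= ?odd_double ?leqnn ?orbT //; lia.
Qed.

Lemma vec_leaf xi : leafv d R (vec (Some xi)).
Proof.
have := size_leaf xi; rewrite /leafv /vec => sl.
rewrite size_pad ?eqxx ?andbT; last exact: leqW.
by rewrite /pad subSn //; apply: vs_pad_toks => //; rewrite size_tuple.
Qed.

Lemma vec_valid x : valid d R (vec x).
Proof. by case: x => [xi|]; [apply: leaf_valid; exact: vec_leaf|exact: top_valid]. Qed.

(** Decreasing odd indices leave one way to cut a word into components: read bits of the highest
    component while its index occurs, then pass to the next one. *)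
Lemma toks_surj k B l : B <= k.*2.-1 -> k <= h -> all (fun t => 0 < idx d t) l ->
  vs d B (rcons l d) -> exists2 s, size s = k & toks d (indices k) s = l.
Proof.
elim: k B l => [|k IH] B l Bk kh al vl.
  exists [::] => //; case: l al vl => //= t l /andP[t0 _] /vs_inv[[E _]|[_ _ tB]].
    by case: (l) E.
  by have := idx_leq tB; lia.
elim: l B Bk al vl => [|t l IHl] B Bk al vl.
  have [||s sk E] := IH 0 [::] (leq0n _) _ al; [lia|exact: (vs_nseq d 0 0)|].
  by exists ([::] :: s); rewrite /= ?sk // indicesS toks_cons E.
have /andP[t0 al'] := al.
have [[E _]|[_ vl' tB]] := vs_inv vl; first by case: (l) E.
have [ot tB'] : odd (idx d t) /\ idx d t <= k.*2.+1.
  by case: tB => [E|[ot tB]]; [move: t0; rewrite E idx_d|split=> //; lia].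
case: (eqVneq (idx d t) k.*2.+1) => [Et|ne].
  have [|[|a s] sk E] := IHl (idx d t) _ al' vl'; [by rewrite Et|by []|].
  exists (((d < t) :: a) :: s) => //; rewrite indicesS toks_cons /=.
  rewrite indicesS toks_cons in E; rewrite E /tok -Et.
  by move: t0; rewrite /idx => t0; case: ltnP => dt; congr cons; lia.
(* All remaining indices are below the highest one, whose bit string is therefore empty. *)
have h2 : vs d k.*2.-1 (rcons (t :: l) d).
  rewrite /= vs_cons ?size_rcons // vl' ot andbT /=.
  by rewrite (_ : idx d t <= _) ?orbT //; lia.
have [|s sk E] := IH _ _ (leqnn _) _ al h2; first lia.
by exists ([::] :: s); rewrite /= ?sk // indicesS toks_cons E.
Qed.

Hypothesis h_gt0 : 0 < h.

Let d_gt0 : 0 < d.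
Proof. by rewrite double_gt0. Qed.

(** Truncation at 1 erases nothing, so splitting at 1 separates the bits from the trailing
    padding. *)
Lemma vec_surj v : valid d R v -> exists x, vec x == v.
Proof.
case/orP=> [/eqP ->|/andP[vv /eqP sv]]; first by exists None.
have [k1 k2 k3 _] := vs_split d_gt0 (isT : odd 1) vv.
set k := upper d 1 v in k1 k2 k3; rewrite sv in k1 k2.
rewrite vtrunc1 in k2.
have [s sh E] : exists2 s, size s = h & toks d (indices h) s = take k v.
  apply: (@toks_surj h h.*2.-1) => //.
  rewrite k2 subSn // in vv; move: vv; rewrite -cat_rcons.
  elim: (take k v) (_.-1) => [|t l IH] B; first by rewrite vs1.
  rewrite rcons_cons cat_cons => /vs_inv[[E _]|[_ vl tB]]; first by case: (l) E.
  rewrite vs_cons ?size_rcons // IH // andbT.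
  by case: tB => [->|[-> ->]]; rewrite ?eqxx ?orbT.
have sw : size s == h by rewrite sh.
have bs : sumn [seq size a | a <- Tuple sw] <= R.
  rewrite -(@size_toks d (indices h)) ?size_indices //= E size_take sv k1; lia.
exists (Some (exist _ (Tuple sw) bs : leaf n h)); rewrite /vec /= E.
by rewrite /pad size_take sv k1 -k2.
Qed.

Lemma vec_lt p x y : 0 < p <= d ->
  top_lt (trunc p x) (trunc p y) = vlt (vtrunc d (oddup p) (vec x)) (vtrunc d (oddup p) (vec y)).
Proof.
case/andP=> p0 pd; have d0 := leq_trans p0 pd; have qd := oddup_le pd.
have lt z : vlt (vtrunc d (oddup p) (vec (Some z))) (vtop d R).
  by apply/leaf_lt_top => //; exact/leaf_vtrunc/vec_leaf.
have vN : vec None = vtop d R by [].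
case: x y => [x|] [y|]; rewrite ?vN ?vtrunc_top // ?vlt_irr //.
- have := size_leaf x; have := size_leaf y => sy sx.
  rewrite (@vlt_toks _ p) ?size_tuple ?size_indices ?(leqW sx) ?(leqW sy) //.
    exact: indices_sorted.
  apply: sub_all (indicesP h) => i /andP[oi ih].
  by rewrite /oddup; case: ifP => op; apply/andP; split; try apply/eqP; lia.
- by apply/esym; exact: lt.
- by apply/esym/negbTE/negP => H; have := vlt_trans (lt y) H; rewrite vlt_irr.
Qed.

Lemma vec_None x : (x == None) = (vec x == vtop d R).
Proof. by case: x => [x|]; rewrite ?eqxx // (negPf (leaf_neq_top d_gt0 (vec_leaf x))). Qed.

(** Both orders are total, so equality of truncations means that neither is smaller; this reduces
    the weak case to [vec_lt]. *)
Lemma vec_le p x y : 0 < p <= d ->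
  top_le (trunc p x) (trunc p y) = vle (vtrunc d (oddup p) (vec x)) (vtrunc d (oddup p) (vec y)).
Proof.
move=> pd; rewrite /top_le /vle -vec_lt //; congr (_ || _).
have irr z : top_lt z z = false by case: z => // s; exact: lex_lt_irr.
apply/eqP/eqP => [E|E].
  apply: vle_anti; rewrite vleNgt ?size_vtrunc ?(size_valid (vec_valid _)) //.
    by rewrite -vec_lt // E irr.
  by rewrite -vec_lt // E irr.
have nlt u v : vtrunc d (oddup p) (vec u) = vtrunc d (oddup p) (vec v) ->
    top_lt (trunc p u) (trunc p v) = false.
  by move=> Euv; rewrite vec_lt // Euv vlt_irr.
have := nlt _ _ E; have := nlt _ _ (esym E).
case: (x) (y) => [s|] [t|] //= /negbT h1 /negbT h2; congr Some.
by apply: lex_lt_total => //; rewrite !size_mask ?size_map ?size_indices ?size_tuple.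
Qed.

Lemma trunc1 (x : label n h) : trunc 1 x = label_seq x.
Proof.
case: x => [x|] //=; congr Some.
rewrite (_ : map _ _ = nseq h true) ?mask_true ?size_tuple //.
rewrite -{2}(size_indices h); elim: (indices h) (indicesP h) => //= i I IH /andP[/andP[oi _] /IH ->].
by case: i oi.
Qed.

Lemma vec_label_le x y : label_le x y = vle (vec x) (vec y).
Proof. by rewrite /label_le -!trunc1 vec_le ?d_gt0 // !vtrunc1. Qed.

End Vectors.

(** * From the game to numbered nodes and words *)

Section Game.
Variables (G : parity_game) (tau : G -> G) (mu : labeling G) (arcs : seq (G * G)).

Notation n := #|G|.
Notation h := (maxprio G)./2.
Notation d := (h.*2).
Notation R := (trunc_log 2 n).

Definition on_node T (x : T) (f : G -> T) (i : nat) : T :=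
  if insub i is Some j then f (@enum_val G G j) else x.

Definition tau_arcs : seq (nat * nat) :=
  [seq (enc_node e.1, enc_node e.2) | e <- arcs & e \in edges_odd tau].

Definition nprio : nat -> nat := on_node 0 (@prio G).

Definition nvec (nu : labeling G) : nat -> seq nat := on_node [::] (fun v => vec (nu v)).

Lemma enc_node_lt (v : G) : enc_node v < n.
Proof. exact: ltn_ord. Qed.

Lemma on_nodeE T (x : T) f v : on_node x f (enc_node v) = f v.
Proof.
rewrite /on_node /enc_node; case: insubP => [j _ E|]; last by rewrite ltn_ord.
by rewrite (_ : j = enum_rank v) ?enum_rankK //; exact/val_inj.
Qed.

Lemma enc_nodeP i : i < n -> exists v : G, i = enc_node v.
Proof.
by move=> ilt; exists (enum_val (Ordinal ilt)); rewrite /enc_node enum_valK.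
Qed.

Lemma enc_node_inj : injective (@enc_node G).
Proof. by move=> v w /val_inj/enum_rank_inj. Qed.

Lemma maxprioE : d = maxprio G.
Proof. by rewrite even_halfK // maxprio_even. Qed.

Lemma prio_gt0_le (v : G) : 0 < prio v <= d.
Proof. by rewrite maxprioE; exact: prio_bounds. Qed.

Lemma h_gt0 (v : G) : 0 < h.
Proof. by rewrite -double_gt0; case/andP: (prio_gt0_le v) => h1 /(leq_trans h1). Qed.

Lemma nonviolatedE (nu : labeling G) v w :
  nonviolated nu v w = NV d R (prio v) (vec (nu v)) (vec (nu w)).
Proof.
have h0 := h_gt0 v; have p0 := prio_gt0_le v.
by rewrite /nonviolated /NV vec_lt // vec_le // !vec_None.
Qed.

Hypothesis tau_ok : odd_strategy tau.
Hypothesis no_loose : forall v w, (v, w) \in edges_odd tau -> ~ loose mu v w.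
Hypothesis arcs_ok : perm_eq arcs (enum (edges G)).

Lemma tau_arcsP (v w : G) :
  ((enc_node v, enc_node w) \in tau_arcs) = ((v, w) \in edges_odd tau).
Proof.
apply/mapP/idP => [[[a b]]|vw].
  by rewrite mem_filter => /andP[/= ab _] [/enc_node_inj -> /enc_node_inj ->].
exists (v, w) => //; rewrite mem_filter vw (perm_mem arcs_ok) mem_enum.
by move: vw; rewrite inE => /andP[].
Qed.

Lemma tau_arcs_inv i j : (i, j) \in tau_arcs ->
  exists v w : G, [/\ i = enc_node v, j = enc_node w & (v, w) \in edges_odd tau].
Proof.
case/mapP=> [[v w]]; rewrite mem_filter => /andP[vw _] [-> ->].
by exists v, w.
Qed.

Lemma tau_arcs_lt i j : (i, j) \in tau_arcs -> (i < n) && (j < n).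
Proof. by case/tau_arcs_inv=> v [w [-> -> _]]; rewrite !enc_node_lt. Qed.

Lemma edges_odd_succ (v : G) : exists w, (v, w) \in edges_odd tau.
Proof.
case ev: (v \in even_nodes G).
  by have [w vw] := has_succ v; exists w; rewrite inE vw /= ev.
exists (tau v); rewrite inE /= eqxx orbT andbT; apply: tau_ok.
by rewrite inE ev.
Qed.

Lemma tau_arcs_succ i : i < n -> exists j, (i, j) \in tau_arcs.
Proof.
case/enc_nodeP=> v ->; have [w vw] := edges_odd_succ v.
by exists (enc_node w); rewrite tau_arcsP.
Qed.

Lemma nvec_valid nu i : i < n -> valid d R (nvec nu i).
Proof. by case/enc_nodeP=> v ->; rewrite /nvec on_nodeE vec_valid. Qed.

Lemma d_gt0 i : i < n -> 0 < d.
Proof. by case/enc_nodeP=> v _; rewrite double_gt0 h_gt0. Qed.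

(* An arc with [lift (mu w) < mu v] would be non-violated but not tight. *)
Lemma nvec_lift i j : (i, j) \in tau_arcs ->
  vle (nvec mu i) (lift d R (nprio i) (nvec mu j)).
Proof.
case/tau_arcs_inv=> v [w [-> -> vw]]; rewrite /nvec /nprio !on_nodeE.
have h0 := h_gt0 v; have d0 : 0 < d by rewrite double_gt0.
have /andP[p0 pd] := prio_gt0_le v.
have vl : valid d R (lift d R (prio v) (vec (mu w))).
  by apply: lift_valid => //; exact: vec_valid.
rewrite (valid_leNgt (vec_valid _) vl); apply/negP => lt.
have [x /eqP xE] := vec_surj h0 vl.
apply: (no_loose vw); split.
  rewrite nonviolatedE lift_NV //; try exact: vec_valid.
  exact: vlt_vle.
case=> _ /(_ x); rewrite vec_label_le // xE => H.
suff nv : nonviolated (substitute mu v x) v w.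
  by have := vlt_vle_trans lt (H nv); rewrite vlt_irr.
(* On a self-loop the substitution changes the head as well, so [lift_NV] does not apply directly.
   For odd priority a strict increase of truncations would contradict that the lift lies below
   [mu v]. *)
rewrite nonviolatedE /substitute eqxx; case: (eqVneq w v) => [E|ne].
  subst w; case op: (odd (prio v)); last by rewrite /NV op vle_refl.
  have : NV d R (prio v) (lift d R (prio v) (vec (mu v))) (vec (mu v)).
    by rewrite lift_NV ?vle_refl //; exact: vec_valid.
  rewrite /NV op; case/orP=> [h1|/andP[/eqP h1 _]]; last by rewrite xE h1 !eqxx orbT.
  have : vle (vtrunc d (oddup (prio v)) (lift d R (prio v) (vec (mu v))))
             (vtrunc d (oddup (prio v)) (vec (mu v))).
    by apply: (vtrunc_mono _ _ vl) => //; [exact: oddup_le|exact: vec_valid|exact: vlt_vle].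
  by move/(vlt_vle_trans h1); rewrite vlt_irr.
by rewrite xE lift_NV ?vle_refl //; exact: vec_valid.
Qed.

(** In [edges_odd tau] a node of Odd has the single arc to [tau v], so one non-violated arc per node
    amounts to a strategy for Even. *)
Lemma feasv_feasible (nu : labeling G) :
  feasible tau nu <-> feasv d R n tau_arcs nprio (nvec nu).
Proof.
split=> [[sigma [es nv]] i|fe].
  case/enc_nodeP=> v ->; right; rewrite /nvec /nprio !on_nodeE.
  have [w [vw nvw]] : exists w, (v, w) \in edges_odd tau /\ nonviolated nu v w.
    case ev: (v \in even_nodes G).
      have vs : (v, sigma v) \in edges_odd tau by rewrite inE es //= ev.
      exists (sigma v); split=> //; apply: nv; rewrite inE vs inE es //=.
      by rewrite eqxx orbT.
    have [w vw] := edges_odd_succ v; exists w; split=> //; apply: nv.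
    by move: (vw); rewrite !inE ev /= => /andP[-> ->].
  exists (enc_node w); first by rewrite tau_arcsP.
  by rewrite on_nodeE -nonviolatedE.
have fP v : exists w, ((v, w) \in edges_odd tau) && nonviolated nu v w.
  have := fe _ (enc_node_lt v); rewrite /nprio /nvec !on_nodeE => -[E|[j vj nv]].
    have [w vw] := edges_odd_succ v; exists w; rewrite vw nonviolatedE.
    have h0 := h_gt0 v; have d0 : 0 < d by rewrite double_gt0.
    have /andP[p0 pd] := prio_gt0_le v.
    rewrite lift_NV ?E //; [|exact: vec_valid|exact: top_valid].
    by apply: valid_le_top => //; apply: lift_valid => //; exact: vec_valid.
  have [u [w [/enc_node_inj E Ej vw]]] := tau_arcs_inv vj; subst u j.
  by exists w; rewrite vw nonviolatedE; move: nv; rewrite on_nodeE.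
pose sigma v := xchoose (fP v).
have sP v : ((v, sigma v) \in edges_odd tau) && nonviolated nu v (sigma v) := xchooseP (fP v).
exists sigma; split=> [v ev|v w]; first by have /andP[] := sP v; rewrite inE => /andP[].
have /andP[vs nv] := sP v; rewrite !inE /= => /andP[/andP[vw e1] /andP[_ e2]].
suff -> : w = sigma v by [].
case/orP: e2 => [ov|/eqP //]; move: vs e1; rewrite inE /= => /andP[_].
by rewrite (negPf ov) /= => /eqP -> /eqP ->.
Qed.

Lemma nvec_label_le (nu nu' : labeling G) :
  labeling_le nu nu' <-> lel n (nvec nu) (nvec nu').
Proof.
split=> [le i|le v].
  case/enc_nodeP=> v ->; rewrite /nvec !on_nodeE -vec_label_le //; exact: h_gt0 v.
rewrite vec_label_le; last exact: h_gt0 v.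
by have := le _ (enc_node_lt v); rewrite /nvec !on_nodeE.
Qed.

Lemma least_feasible_of (D : nat -> seq nat) :
  validl d R n D -> lel n (nvec mu) D -> feasv d R n tau_arcs nprio D ->
  (forall nu, validl d R n nu -> lel n (nvec mu) nu ->
    feasv d R n tau_arcs nprio nu -> lel n D nu) ->
  exists2 nu, is_least_feasible tau mu nu & forall v, vec (nu v) = D (enc_node v).
Proof.
move=> vD muD fD lD.
have sur (v : G) : exists x : label n h, vec x == D (enc_node v).
  by apply: (vec_surj (h_gt0 v)); exact: (vD _ (enc_node_lt v)).
pose nu v := xchoose (sur v).
have nuE v : vec (nu v) = D (enc_node v) by apply/eqP; exact: (xchooseP (sur v)).
have E i : i < n -> nvec nu i = D i.
  by case/enc_nodeP=> v ->; rewrite /nvec on_nodeE nuE.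
exists nu => //; split.
- by apply/nvec_label_le => i ilt; rewrite E //; exact: muD.
- apply/feasv_feasible => i ilt; rewrite E //.
  case: (fD i ilt) => [->|[j ij nv]]; [by left|right; exists j => //].
  by rewrite E //; have /andP[] := tau_arcs_lt ij.
- move=> nu' /nvec_label_le le /feasv_feasible fe; apply/nvec_label_le => i ilt.
  by rewrite E //; apply: lD => // k klt; exact: nvec_valid.
Qed.

End Game.

(** * Running programs *)

Definition bounded_state (W : nat) (s : state) : Prop :=
  (forall x, regs s x <= W) /\ (forall a, cells s a <= W).

Definition den_op (op : binop) (a b : nat) : nat :=
  match op with
  | Add => a + b
  | Defs.Sub => a - b
  | Mul => a * b
  | Div => a %/ b
  | Mod => a %% b
  | Lt => a < b
  | Eq => a == b
  end.

(** The partial [eval] is split into this total value and the condition [safe]: values are found by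
    rewriting, and absence of overflow becomes plain arithmetic. *)
Fixpoint den (s : state) (e : expr) : nat :=
  match e with
  | Const k => k
  | Reg x => regs s x
  | Cell e1 => cells s (den s e1)
  | Bin op e1 e2 => den_op op (den s e1) (den s e2)
  end.

Definition safe_op (W : nat) (op : binop) (a b : nat) : Prop :=
  match op with
  | Add => a + b <= W
  | Mul => a * b <= W
  | Div | Mod => 0 < b
  | _ => True
  end.

Fixpoint safe (W : nat) (s : state) (e : expr) : Prop :=
  match e with
  | Const k => k <= W
  | Reg _ => True
  | Cell e1 => safe W s e1
  | Bin op e1 e2 =>
      [/\ safe W s e1, safe W s e2 & safe_op W op (den s e1) (den s e2)]
  end.

Definition set_reg (s : state) (x k : nat) : state :=
  State (update (regs s) x k) (cells s).

Definition set_cell (s : state) (a k : nat) : state :=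
  State (regs s) (update (cells s) a k).

Section Runs.
Variable W : nat.
Hypothesis W_gt0 : 0 < W.

Lemma den_le s e : bounded_state W s -> safe W s e -> den s e <= W.
Proof.
case=> br bc; elim: e => //= op e1 IH1 e2 IH2 [/IH1 h1 /IH2 h2].
case: op => //=; move: (den s e1) (den s e2) h1 h2 => a b ha hb.
- by move=> _; lia.
- by move=> _; apply: leq_trans ha; exact: leq_div.
- by move=> _; apply: leq_trans ha; exact: leq_mod.
- by move=> _; apply: leq_trans W_gt0; exact: leq_b1.
- by move=> _; apply: leq_trans W_gt0; exact: leq_b1.
Qed.

Lemma eval_den s e : bounded_state W s -> safe W s e -> eval W s e = Some (den s e).
Proof.
move=> bs; have [br bc] := bs; elim: e => [k|x|e IH|op e1 IH1 e2 IH2] sf.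
- by rewrite /= /word (sf : k <= W).
- by rewrite /= /word br.
- by rewrite /= IH //= /word bc.
have le := den_le bs sf; case: sf => s1 s2 so; rewrite /= IH1 //= IH2 //=.
by case: op so le => //= so le; rewrite ?(gtn_eqF so) /= /word le.
Qed.

Lemma eval_le s e k : eval W s e = Some k -> k <= W.
Proof.
have w j i : word W j = Some i -> i <= W by rewrite /word; case: ifP => // h [<-].
case: e => [j|x|e|op e1 e2] /=; [exact: w|exact: w| |].
  by case: (eval W s e) => //= a; exact: w.
case: (eval W s e1) => //= a; case: (eval W s e2) => //= b.
by case: (eval_binop op a b) => //= c; exact: w.
Qed.

Lemma exec_bounded c s s' t : exec W c s s' t -> bounded_state W s -> bounded_state W s'.
Proof.
elim=> {c s s' t} //.
- move=> s x e k /eval_le kW [br bc]; split=> //= y; rewrite /update.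
  by case: ifP.
- move=> s e1 e2 a k _ /eval_le kW [br bc]; split=> //= y; rewrite /update.
  by case: ifP.
- by move=> c1 c2 s s1 s2 t1 t2 _ IH1 _ IH2 /IH1/IH2.
- by move=> e c s s1 s2 k t1 t2 _ _ IH1 _ IH2 /IH1/IH2.
Qed.

Lemma exec_seq_inv c1 c2 s s' t : exec W (Seq c1 c2) s s' t ->
  exists s1 t1 t2, [/\ exec W c1 s s1 t1, exec W c2 s1 s' t2 & t = (t1 + t2).+1].
Proof. by move=> ex; inversion ex; subst; exists s1, t1, t2. Qed.

(** A total correctness triple with a time budget. Boundedness of the state is a premise here, and
    [exec_bounded] passes it on, so no invariant has to mention it. *)
Definition runs (c : cmd) (s : state) (t : nat) (Q : state -> Prop) : Prop :=
  bounded_state W s ->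
  exists s' t', [/\ exec W c s s' t', t' <= t & Q s'].

Lemma runs_conseq c s t t' (Q Q' : state -> Prop) : runs c s t Q -> t <= t' ->
  (forall s', Q s' -> Q' s') -> runs c s t' Q'.
Proof.
move=> r tt qq bs; have [s' [u [ex ut qs]]] := r bs.
by exists s', u; split=> //; [exact: leq_trans tt|exact: qq].
Qed.

Lemma runs_le t' c s t Q : t' <= t -> runs c s t' Q -> runs c s t Q.
Proof. by move=> tt r; exact: runs_conseq r tt (fun _ h => h). Qed.

Lemma runs_bounded c s t Q :
  (bounded_state W s -> runs c s t Q) -> runs c s t Q.
Proof. by move=> h bs; exact: h. Qed.

Lemma runs_skip s t (Q : state -> Prop) : 0 < t -> Q s -> runs Skip s t Q.
Proof. by move=> t0 qs _; exists s, 1; split=> //; constructor. Qed.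

Lemma runs_reg s x e t (Q : state -> Prop) : safe W s e -> cost e < t ->
  Q (set_reg s x (den s e)) -> runs (SetReg x e) s t Q.
Proof.
move=> sf ct qs bs; exists (set_reg s x (den s e)), (cost e).+1; split=> //.
by constructor; exact: eval_den.
Qed.

Lemma runs_cell s e1 e2 t (Q : state -> Prop) : safe W s e1 -> safe W s e2 ->
  cost e1 + cost e2 < t ->
  Q (set_cell s (den s e1) (den s e2)) -> runs (SetCell e1 e2) s t Q.
Proof.
move=> sf1 sf2 ct qs bs.
exists (set_cell s (den s e1) (den s e2)), (cost e1 + cost e2).+1; split=> //.
by constructor; exact: eval_den.
Qed.

Lemma runs_seq c1 c2 s t1 t (Q1 Q : state -> Prop) : runs c1 s t1 Q1 -> t1 < t ->
  (forall s1, Q1 s1 -> runs c2 s1 (t - t1.+1) Q) -> runs (Seq c1 c2) s t Q.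
Proof.
move=> r1 tt r2 bs; have [s1 [u1 [ex1 ut1 qs1]]] := r1 bs.
have [s2 [u2 [ex2 ut2 qs2]]] := r2 _ qs1 (exec_bounded ex1 bs).
exists s2, (u1 + u2).+1; split=> //; first by econstructor; eauto.
by lia.
Qed.

Lemma runs_seq_k t1 c1 c2 s t Q : t1 < t ->
  runs c1 s t1 (fun s1 => runs c2 s1 (t - t1.+1) Q) -> runs (Seq c1 c2) s t Q.
Proof. by move=> tt r; exact: (runs_seq r). Qed.

Lemma runs_if e c1 c2 s t Q : safe W s e -> cost e < t ->
  (den s e != 0 -> runs c1 s (t - (cost e).+1) Q) ->
  (den s e = 0 -> runs c2 s (t - (cost e).+1) Q) -> runs (If e c1 c2) s t Q.
Proof.
move=> sf ct r1 r2 bs; have ev := eval_den bs sf.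
have [s' [u [ex ut qs]]] : exists s' t', [/\ exec W (if den s e != 0 then c1 else c2) s s' t',
    t' <= t - (cost e).+1 & Q s'].
  by case: eqP => h; [exact: r2|apply: r1 => //; exact/eqP].
exists s', (cost e + u).+1; split=> //; last lia.
by econstructor; eauto.
Qed.

Lemma runs_seq_reg x e c s t Q : safe W s e -> (cost e).+1 < t ->
  runs c (set_reg s x (den s e)) (t - (cost e).+2) Q -> runs (Seq (SetReg x e) c) s t Q.
Proof.
move=> sf ct r; apply: (@runs_seq _ _ _ (cost e).+1 _ (eq (set_reg s x (den s e)))).
- exact: runs_reg.
- by [].
- by move=> _ <-.
Qed.

Lemma runs_seq_cell e1 e2 c s t Q : safe W s e1 -> safe W s e2 ->
  (cost e1 + cost e2).+1 < t ->
  runs c (set_cell s (den s e1) (den s e2)) (t - (cost e1 + cost e2).+2) Q ->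
  runs (Seq (SetCell e1 e2) c) s t Q.
Proof.
move=> sf1 sf2 ct r.
apply: (@runs_seq _ _ _ (cost e1 + cost e2).+1 _ (eq (set_cell s (den s e1) (den s e2)))).
- exact: runs_cell.
- by [].
- by move=> _ <-.
Qed.

Lemma runs_seq_skip c s t Q : 1 < t -> runs c s (t - 2) Q -> runs (Seq Skip c) s t Q.
Proof.
move=> t1 r; apply: (@runs_seq _ _ _ 1 _ (eq s)) => //; first exact: runs_skip.
by move=> _ <-.
Qed.

Lemma runs_seq_assoc c1 c2 c3 s t Q : runs (Seq c1 (Seq c2 c3)) s t Q ->
  runs (Seq (Seq c1 c2) c3) s t Q.
Proof.
move=> r bs; have [s' [u [ex ut qs]]] := r bs; exists s', u; split=> //.
have [s1 [t1 [u2 [ex1 ex2 ->]]]] := exec_seq_inv ex.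
have [s2 [t2 [t3 [ex3 ex4 ->]]]] := exec_seq_inv ex2.
rewrite (_ : (t1 + (t2 + t3).+1).+1 = ((t1 + t2).+1 + t3).+1); last lia.
by apply: ExecSeq ex4; apply: ExecSeq ex3.
Qed.

(** The continuation is pushed into both branches, so that symbolic execution needs no assertion at
    the point where they join. *)
Lemma runs_seq_if e c1 c2 c s t Q : safe W s e -> cost e < t ->
  (den s e != 0 -> runs (Seq c1 c) s (t - (cost e).+1) Q) ->
  (den s e = 0 -> runs (Seq c2 c) s (t - (cost e).+1) Q) ->
  runs (Seq (If e c1 c2) c) s t Q.
Proof.
move=> sf ct r1 r2 bs; have ev := eval_den bs sf.
have [s' [u [ex ut qs]]] : exists s' t',
    [/\ exec W (Seq (if den s e != 0 then c1 else c2) c) s s' t',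
    t' <= t - (cost e).+1 & Q s'].
  by case: eqP => h; [exact: r2|apply: r1 => //; exact/eqP].
exists s', (cost e + u).+1; split=> //; last lia.
have [s1 [t1 [t2 [ex1 ex2 ->]]]] := exec_seq_inv ex.
rewrite (_ : (cost e + (t1 + t2).+1).+1 = ((cost e + t1).+1 + t2).+1); last lia.
by apply: ExecSeq ex2; apply: ExecIf ex1.
Qed.

Lemma runs_while_stop e c s t (Q : state -> Prop) : safe W s e -> cost e < t ->
  den s e = 0 -> Q s -> runs (While e c) s t Q.
Proof.
move=> sf ct d0 qs bs; exists s, (cost e).+1; split=> //.
by constructor; rewrite (eval_den bs sf) d0.
Qed.

Lemma runs_while_step e c s t Q : safe W s e -> cost e < t -> den s e != 0 ->
  runs (Seq c (While e c)) s (t - cost e) Q -> runs (While e c) s t Q.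
Proof.
move=> sf ct; case E: (den s e) => [|k] // _ r bs.
have [s' [u [ex ut qs]]] := r bs; have [s1 [t1 [t2 [ex1 ex2 E2]]]] := exec_seq_inv ex.
exists s', (cost e + t1 + t2).+1; split=> //; last lia.
by apply: ExecWhileStep ex1 ex2; rewrite (eval_den bs sf) E.
Qed.

(* [k] bounds the number of remaining iterations. *)
Lemma runs_while (I : nat -> state -> Prop) e c k tb s t (Q : state -> Prop) :
  I k s ->
  (forall k s, I k s -> safe W s e) ->
  (forall k s, I k s -> den s e != 0 ->
     0 < k /\ runs c s tb (fun s' => exists2 k', k' < k & I k' s')) ->
  (forall k s, I k s -> den s e = 0 -> Q s) ->
  k * (tb + cost e).+1 + (cost e).+1 <= t ->
  runs (While e c) s t Q.
Proof.
move=> Is sf st fin; elim: k {-2}k (leqnn k) s t Is => [|N IH] k kN s t Is tt.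
  have k0 : k = 0 by lia.
  apply: runs_while_stop; [exact: sf Is|lia| |]; case: (eqVneq (den s e) 0) => // h.
  - by have [] := st _ _ Is h; rewrite k0.
  - exact: fin Is h.
  - by have [] := st _ _ Is h; rewrite k0.
case: (eqVneq (den s e) 0) => h.
  apply: runs_while_stop => //; [exact: sf Is|lia|exact: fin Is h].
have [k0 r] := st _ _ Is h.
have kt : (tb + cost e).+1 + (k.-1 * (tb + cost e).+1 + (cost e).+1) <= t.
  by rewrite addnA -mulSn prednK.
have tbt : tb + (cost e).*2.+1 < t.
  by apply: leq_trans kt; move: (k.-1 * _) => X; lia.
apply: runs_while_step => //; [exact: sf Is|lia|].
apply: (runs_seq r); first lia.
move=> s1 [k' kk I1]; apply: (IH k') => //; first lia.
have : k' * (tb + cost e).+1 <= k.-1 * (tb + cost e).+1 by rewrite leq_mul2r; lia.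
by move: kt; move: (k.-1 * _) (k' * _) => X Y; lia.
Qed.

Definition For (x : nat) (e : expr) (c : cmd) : cmd :=
  Seq (SetReg x (Const 0))
    (While (Bin Lt (Reg x) e) (Seq c (SetReg x (Bin Add (Reg x) (Const 1))))).

Lemma runs_for (I : nat -> state -> Prop) x e c N tb s t (Q : state -> Prop) :
  N < W ->
  (forall i s, I i s -> safe W s e /\ den s e = N) ->
  (forall i s, I i s -> regs s x = i) ->
  I 0 (set_reg s x 0) ->
  (forall i s, i < N -> I i s ->
     runs c s tb (fun s' => regs s' x = i /\ I i.+1 (set_reg s' x i.+1))) ->
  (forall s, I N s -> Q s) ->
  N * (tb + cost e + 8) + cost e + 6 <= t ->
  runs (For x e c) s t Q.
Proof.
move=> NW se rx I0 st fin tt; apply: runs_seq_reg => //=; first lia.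
pose J k s := I (N - k) s /\ k <= N.
apply: (@runs_while J _ _ N (tb + 5)).
- by split; rewrite ?subnn.
- by move=> k s1 [Ik _] /=; have [sf _] := se _ _ Ik.
- move=> k s1 [Ik kN] /=; have [_ dE] := se _ _ Ik; rewrite dE (rx _ _ Ik).
  case: ltnP => // lt _; split; first lia.
  apply: (runs_seq (st _ _ lt Ik)); first lia.
  move=> s2 [rx2 I2]; apply: runs_reg => //=; rewrite ?rx2; [split=> //=; lia|lia|].
  exists k.-1; first lia.
  rewrite addn1; split; last lia.
  by rewrite (_ : N - k.-1 = (N - k).+1) //; lia.
- move=> k s1 [Ik kN] /=; have [_ dE] := se _ _ Ik; rewrite dE (rx _ _ Ik).
  case: ltnP => // h _; apply: fin; rewrite (_ : N = N - k) //; lia.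
- rewrite /=; have -> : tb + 5 + (cost e).+2 = tb + cost e + 7 by lia.
  by move: tt; rewrite addnS; lia.
Qed.

End Runs.

(** * The program *)

Section Scan.
Variables d R : nat.
Notation idx := (idx d).
Notation low := (low d).

(* The position and the value of the token at which the result of [gl] departs from
   its argument; [pos] and [u] are the best ones found so far. *)
Fixpoint scan (weak : bool) (q s B j pos u : nat) (x : seq nat) : nat * nat :=
  if x is t :: x' then
    if s < j then (pos, u)
    else if idx t < q then
      if weak then (j, low q) else if (j < s) && (q <= B) then (j, d + q) else (pos, u)
    else
      let c :=
        if j < s then
          if t < d then (j, d - (idx t - 2))
          else if idx t + 2 <= B then (j, t + 2) else (pos, u)
        else if t < d then (j, low q) else (pos, u) in
      scan weak q s (idx t) j.+1 c.1 c.2 x'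
  else (pos, u).

(** A closed form of the words built by [gl]: after the departure, [d - idx c.2] is the most
    negative token allowed by the index just placed. Position [R + 1] stands for failure, hence for
    top. *)
Definition out (q s : nat) (x : seq nat) (c : nat * nat) (k : nat) : nat :=
  if c.1 == R.+1 then d.*2.+1
  else if k == R then d
  else if k < c.1 then nth 0 x k
  else if k == c.1 then c.2
  else if k < s then d - idx c.2
  else low q.

Definition outv q s x c : seq nat := mkseq (out q s x c) R.+1.

Lemma nth_fl a b s n k : k < n ->
  nth 0 (fl d a b s n) k = if k == n.-1 then d else if k < s then a else b.
Proof.
elim: n s k => // -[|n] IH s k kn; first by case: k kn.
case: s => [|s]; rewrite ?fl0 ?flS; case: k kn => //= k kn; rewrite IH //.
Qed.

Lemma outv_pre q s pre t x u : size (pre ++ t :: x) = R.+1 ->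
  outv q s (pre ++ t :: x) (size pre, u) =
  pre ++ (if size x == 0 then d else u) :: fl d (d - idx u) (low q) (s - (size pre).+1) (size x).
Proof.
rewrite size_cat /= => sz; apply: (@eq_from_nth _ 0).
  by rewrite size_mkseq size_cat /= size_fl.
move=> k; rewrite size_mkseq => kR; rewrite nth_mkseq // /out /= nth_cat.
rewrite [size pre == _]ltn_eqF; last lia.
rewrite nth_cat; case: (ltngtP k (size pre)) => kp.
- by rewrite ltn_eqF //; lia.
- have -> : k - size pre = (k - (size pre).+1).+1 by lia.
  have kx : k - (size pre).+1 < size x by lia.
  rewrite /= nth_fl //; case: (eqVneq k R) => kR'.
    by rewrite ifT //; apply/eqP; lia.
  have -> : (k - (size pre).+1 == (size x).-1) = false by lia.
  by have -> : (k - (size pre).+1 < s - (size pre).+1) = (k < s) by lia.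
- rewrite kp subnn /=; case: (posnP (size x)) => x0; first by rewrite ifT //; apply/eqP; lia.
  by rewrite ifF //; apply/eqP; lia.
Qed.

(** On the way out of its recursion [gl] settles for the deepest position where a change is
    possible. Scanning forwards, it suffices to overwrite the last candidate. *)
Lemma scan_gl weak q s B pos u x pre : size (pre ++ x) = R.+1 -> size pre <= s -> s <= R ->
  let c := scan weak q s B (size pre) pos u x in
  if gl d weak q B (s - size pre) x is Some r
  then c.1 <= R /\ outv q s (pre ++ x) c = pre ++ r
  else c = (pos, u).
Proof.
elim: x B pos u pre => [|t x IH] B pos u pre //= sz ps sR.
have -> : (s < size pre) = false by rewrite ltnNge ps.
have sz' := sz; rewrite size_cat /= in sz'.
have lowE : d - idx (low q) = low q by rewrite /low /idx; lia.
have weakE : pre ++ (if size x == 0 then d else low q) ::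
    fl d (d - idx (low q)) (low q) (s - (size pre).+1) (size x) =
    pre ++ fl d (low q) (low q) (s - size pre) (size x).+1.
  congr (_ ++ _); case: (size x) => [|m] //=; rewrite lowE.
  case: (s - size pre) => [|k]; rewrite ?fl0 ?flS; congr cons; exact: fl_same.
case: ltnP => tq.
  case: weak IH => IH; first by split; [rewrite /=; lia|rewrite outv_pre // weakE].
  rewrite subn_gt0; case: ifP => // /andP[js qB]; split; first by rewrite /=; lia.
  have x0 : (size x == 0) = false by lia.
  rewrite outv_pre // x0; congr (_ ++ _).
  have -> : d - idx (d + q) = d - q by rewrite /idx; lia.
  by rewrite -subnS.
case: (ltnP (size pre) s) => js; last first.
  rewrite (_ : s - size pre = 0); last lia.
  have E pos' u' : scan weak q s (idx t) (size pre).+1 pos' u' x = (pos', u').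
    by case: (x) => //= ? ?; rewrite ltnS js.
  rewrite E /=; case: ifP => tld //; split; first by rewrite /=; lia.
  rewrite outv_pre // weakE; congr (_ ++ _).
  by rewrite (_ : s - size pre = 0) //; lia.
rewrite (_ : s - size pre = (s - (size pre).+1).+1); last lia.
set c := (if t < d then (size pre, _) else _).
have := IH (idx t) c.1 c.2 (rcons pre t).
rewrite cat_rcons size_rcons => /(_ sz js sR).
case: (gl _ _ _ _ _ x) => [r|->] //; first by rewrite cat_rcons.
have x0 : (size x == 0) = false by lia.
rewrite /c -surjective_pairing; case: (ltnP t d) => tld.
  split; first by rewrite /=; lia.
  rewrite outv_pre // x0; congr (_ ++ _).
  have -> : d - idx (d - (idx t - 2)) = d - (idx t - 2) by rewrite /idx; lia.
  by case: (size x) x0 => // m _; rewrite flS.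
case: ifP => // tB; split; first by rewrite /=; lia.
rewrite outv_pre // x0; congr (_ ++ _ :: _).
by have -> : d - idx (t + 2) = d - (idx t + 2) by rewrite /idx; lia.
Qed.

Lemma scan_LF weak q s x : size x = R.+1 -> s <= R ->
  outv q s x (scan weak q s d.-1 0 R.+1 0 x) = LF d R weak q s x.
Proof.
move=> sx sR; have := @scan_gl weak q s d.-1 R.+1 0 x [::] sx (leq0n _) sR.
rewrite subn0 /LF /=; case: (gl _ _ _ _ _ _) => [r [_ ->] //|->].
rewrite /= /outv /vtop; apply: (@eq_from_nth _ 0); rewrite size_mkseq ?size_nseq // => k kR.
by rewrite nth_mkseq // nth_nseq kR /out /= eqxx.
Qed.

Lemma valid_le x : 0 < d -> valid d R x -> all (fun t => t <= d.*2.+1) x.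
Proof.
move=> d0; case/orP=> [/eqP ->|/andP[vx _]]; first by rewrite /vtop all_nseq leqnn orbT.
have : d.-1 <= d by lia.
elim: x (d.-1) vx => // t x IH B vx Bd; case: (vs_inv vx) => [[-> ->]|[_ vx' tB]] /=.
  by rewrite andbT; lia.
have iB := idx_leq tB; rewrite (IH _ vx') ?andbT; last exact: leq_trans iB Bd.
by move: iB; rewrite /idx; lia.
Qed.

Lemma size_LF wk q s x : size x = R.+1 -> s <= R -> size (LF d R wk q s x) = R.+1.
Proof. by move=> sx sR; rewrite -scan_LF // size_mkseq. Qed.

End Scan.

(* Program syntax and symbolic execution *)
Declare Scope expr_scope.
Delimit Scope expr_scope with X.
Notation "# k" := (Const k) (at level 1, format "# k") : expr_scope.
Notation "$ x" := (Reg x) (at level 1, format "$ x") : expr_scope.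
Notation "'mem' [ e ]" := (Cell e) (at level 1) : expr_scope.
Infix "+" := (Bin Add) : expr_scope.
Infix "-" := (Bin Defs.Sub) : expr_scope.
Infix "*" := (Bin Mul) : expr_scope.
Infix "%%" := (Bin Mod) : expr_scope.
Infix "<" := (Bin Lt) : expr_scope.
Infix "==" := (Bin Eq) : expr_scope.

Declare Scope cmd_scope.
Delimit Scope cmd_scope with C.
Notation "x :=r e" := (SetReg x e%X) (at level 70) : cmd_scope.
Notation "[ a ] :=m e" := (SetCell a%X e%X) (at level 0, e at level 69) : cmd_scope.
Infix ";;" := Seq (at level 90, right associativity) : cmd_scope.

Definition idxE (e : expr) : expr := ((e - $2) + ($2 - e))%X.

(* Registers 30 to 34 hold the address of the word, the address of the result, [q], [s]
   and [weak]; 35 to 38 hold [j], [B], [pos] and [u]; 41 is cleared to stop. *)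
Definition scan_body : cmd := (
  39 :=r mem[$30 + $35] ;;
  40 :=r idxE $39 ;;
  If ($40 < $32)%X
    (41 :=r #0 ;;
     If ($34)%X
       (37 :=r $35 ;; 38 :=r $2 - ($32 - #2))
       (If (($35 < $33) * ($32 < $36 + #1))%X
          (37 :=r $35 ;; 38 :=r $2 + $32)
          Skip))
    (If ($35 < $33)%X
       (If ($39 < $2)%X
          (37 :=r $35 ;; 38 :=r $2 - ($40 - #2))
          (If ($40 + #2 < $36 + #1)%X
             (37 :=r $35 ;; 38 :=r $39 + #2)
             Skip))
       (If ($39 < $2)%X
          (37 :=r $35 ;; 38 :=r $2 - ($32 - #2))
          Skip) ;;
     36 :=r $40) ;;
  35 :=r $35 + #1)%C.

(** Register 41 is 0 or 1, so the test means [j <= s] and not stopped; as [s <= R], it also keeps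
    the scan inside the word. *)
Definition scan_loop : cmd := While ($35 < $41 * ($33 + #1))%X scan_body.

Definition same_regs (k : nat) (s s' : state) : Prop :=
  forall x, x < k -> regs s' x = regs s x.

Ltac norm E := rewrite /= /update /= ?mulnb ?E ?mulnb.
Ltac safe_tac E := norm E; repeat split; try lia.
Ltac cond_pos := let c := fresh "c" in move=> c; rewrite ?eqb0 ?negbK in c.
Ltac cond_neg := let c := fresh "c" in
  first [move/eqP => c; rewrite eqb0 in c | move=> c].
(** One step of symbolic execution; [E] collects the equations for the registers and cells that are
    read. *)
Ltac rstep E := lazymatch goal with
  | |- runs _ (Seq (Seq _ _) _) _ _ _ => apply: runs_seq_assoc; [lia|]
  | |- runs _ (Seq (SetReg _ _) _) _ _ _ =>
      apply: runs_seq_reg; [lia|safe_tac E|rewrite /=; lia|norm E]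
  | |- runs _ (Seq (SetCell _ _) _) _ _ _ =>
      apply: runs_seq_cell; [lia|safe_tac E|safe_tac E|rewrite /=; lia|norm E]
  | |- runs _ (Seq (If _ _ _) _) _ _ _ =>
      apply: runs_seq_if; [lia|safe_tac E|rewrite /=; lia|norm E; cond_pos|norm E; cond_neg]
  | |- runs _ (Seq Skip _) _ _ _ => apply: runs_seq_skip; [lia|lia|]
  | |- runs _ (SetReg _ _) _ _ _ => apply: runs_reg; [lia|safe_tac E|rewrite /=; lia|norm E]
  | |- runs _ (SetCell _ _) _ _ _ =>
      apply: runs_cell; [lia|safe_tac E|safe_tac E|rewrite /=; lia|norm E]
  | |- runs _ (If _ _ _) _ _ _ =>
      apply: runs_if; [lia|safe_tac E|rewrite /=; lia|norm E; cond_pos|norm E; cond_neg]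
  | |- runs _ Skip _ _ _ => apply: runs_skip; [lia|]
  end.

Lemma same_regs_le k k' s s' : k <= k' -> same_regs k' s s' -> same_regs k s s'.
Proof. by move=> kk h x xk; apply: h; exact: leq_trans xk kk. Qed.

Lemma same_regs_trans k s s1 s2 : same_regs k s s1 -> same_regs k s1 s2 -> same_regs k s s2.
Proof. by move=> h h' x xk; rewrite h' ?h. Qed.

Lemma same_set k s0 s x v : same_regs k s0 s -> k <= x ->
  same_regs k s0 (set_reg s x v).
Proof.
move=> ss kx y yk; rewrite /= /update ifN ?ss //.
by apply/eqP => E; move: (leq_trans yk kx); rewrite E ltnn.
Qed.

Section Macros.
Variables W d R : nat.
Hypothesis W_big : 8 * d + 2 * R + 50 <= W.

Let W_gt0 : 0 < W.
Proof. lia. Qed.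

Definition arr (s : state) (a : nat) (x : seq nat) : Prop :=
  forall k, k < size x -> cells s (a + k) = nth 0 x k.

Lemma scan_runs s0 src q sb (wk : bool) x : forall j B pos u s,
  regs s0 2 = d -> regs s0 30 = src -> regs s0 32 = q -> regs s0 33 = sb ->
  regs s0 34 = wk ->
  src + R.+1 <= W -> q <= d + 3 -> sb <= R -> B <= d.+1 ->
  all (fun t => t <= d.*2.+1) x ->
  arr s0 (src + j) x -> j + size x = R.+1 ->
  same_regs 35 s0 s -> cells s = cells s0 ->
  [/\ regs s 35 = j, regs s 36 = B, regs s 37 = pos, regs s 38 = u & regs s 41 = 1] ->
  runs W scan_loop s (size x * 100 + 20) (fun s' =>
    [/\ same_regs 35 s0 s', cells s' = cells s0 &
        (regs s' 37, regs s' 38) = scan d wk q sb B j pos u x]).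
Proof.
elim: x => [|t x IH] j B pos u s e2 e30 e32 e33 e34 sW qd sR Bd tx ax jx ss cs [r35 r36 r37 r38 r41].
all: have [r2 r30 r32 r33 r34] : [/\ regs s 2 = d, regs s 30 = src, regs s 32 = q,
    regs s 33 = sb & regs s 34 = wk] by rewrite !ss.
  apply: runs_while_stop => //=; rewrite ?r41 ?r35 ?r33.
  - repeat split; lia.
  - by rewrite addn0 in jx; lia.
  - by split; rewrite ?r37 ?r38.
case: (ltnP sb j) => js.
  apply: runs_while_stop => //=; rewrite ?r35 ?r33 ?r41.
  - repeat split; lia.
  - lia.
  - by split=> //; rewrite r37 r38 js.
apply: runs_while_step => //=; rewrite ?r35 ?r33 ?r41.
- repeat split; lia.
- lia.
rewrite {1}/scan_body; set Q := (fun s' : state => _).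
have ct : cells s (src + j) = t by have := ax 0 isT; rewrite addn0 cs.
have [t2 tx'] : t <= d.*2.+1 /\ all (fun t => t <= d.*2.+1) x by move/andP: tx.
have ei : t - d + (d - t) = idx d t by [].
have it : idx d t <= d.+1 by rewrite /idx; lia.
have E := (r2, r30, r32, r33, r34, r35, r36, r37, r38, r41, ct, ei).
have tm : (size x).+1 * 100 = size x * 100 + 100 by lia.
rewrite tm; set tt := (_ - _)%N.
have tt0 : size x * 100 + 110 <= tt by rewrite /tt /=; lia.
clearbody tt.
have stop s1 t1 : 20 <= t1 -> regs s1 33 = sb -> regs s1 41 = 0 -> Q s1 ->
    runs W scan_loop s1 t1 Q.
  move=> t1l e1 e2' q1; apply: runs_while_stop => //=; rewrite ?e1 ?e2'; try lia.
  by repeat split; lia.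
have next B' pos' u' s1 t1 : same_regs 35 s0 s1 -> cells s1 = cells s0 ->
    [/\ regs s1 35 = j.+1, regs s1 36 = B', regs s1 37 = pos', regs s1 38 = u' &
        regs s1 41 = 1] -> B' <= d.+1 -> size x * 100 + 20 <= t1 ->
    scan d wk q sb B' j.+1 pos' u' x = scan d wk q sb B j pos u (t :: x) ->
    runs W scan_loop s1 t1 Q.
  move=> ss1 cs1 rs1 B'd t1l sE.
  apply: (runs_conseq (IH _ _ _ _ s1 e2 e30 e32 e33 e34 sW qd sR B'd tx' _ _ ss1 cs1 rs1)) t1l _.
  - move=> k kx; rewrite (_ : src + j.+1 + k = src + j + k.+1); last lia.
    exact: (ax k.+1 kx).
  - by rewrite addSnnS.
  - by move=> s' [h1 h2 h3]; split=> //; rewrite h3 sE.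
have js' : (sb < j) = false by lia.
repeat rstep E; fold scan_loop.
all: try (apply: stop; [lia|by rewrite /= /update /= r33|by []|split=> //; [by do !apply: same_set|]];
  rewrite /= js' /update /= ?r37 ?r38; repeat (case: ifP => ?; try (exfalso; lia)); by []).
all: apply: next; [by do !apply: same_set|by []|split; rewrite /= /update /=
  ?addn1 ?r36 ?r37 ?r38 ?r41; reflexivity|lia|lia|].
all: rewrite /= js'; repeat (case: ifP => ?; try (exfalso; lia)); by [].
Qed.

End Macros.

(** * Subroutines on words *)

Definition copy_cmd : cmd := For 42 ($10)%X ([$31 + $42] :=m mem[$30 + $42])%C.

(** Register 44 stays 1 as long as the prefixes agree, so that 43 is set only at the first
    difference. *)
Definition cmp_cmd : cmd := (
  43 :=r #0 ;; 44 :=r #1 ;;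
  For 42 ($10)%X
    (43 :=r $43 + $44 * (mem[$30 + $42] < mem[$31 + $42]) ;;
     44 :=r $44 * (mem[$30 + $42] == mem[$31 + $42])))%C.

Definition write_body : cmd := (
  If ($37 == $10)%X ([$31 + $42] :=m $2 * #2 + #1)
    (If ($42 == $3)%X ([$31 + $42] :=m $2)
       (If ($42 < $37)%X ([$31 + $42] :=m mem[$30 + $42])
          (If ($42 == $37)%X ([$31 + $42] :=m $38)
             (If ($42 < $33)%X ([$31 + $42] :=m $2 - idxE $38)
                ([$31 + $42] :=m $2 - ($32 - #2)))))))%C.

Definition lift_cmd : cmd := (
  35 :=r #0 ;; 36 :=r $2 - #1 ;; 37 :=r $10 ;; 38 :=r #0 ;; 41 :=r #1 ;;
  scan_loop ;; For 42 ($10)%X write_body)%C.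

Definition same_cells (a n : nat) (s s' : state) : Prop :=
  forall b, b < a \/ a + n <= b -> cells s' b = cells s b.

Section Macros.
Variables W d R : nat.
Hypothesis W_big : 8 * d + 2 * R + 50 <= W.

Let W_gt0 : 0 < W.
Proof. lia. Qed.

Lemma runs_fill (f : nat -> nat) x e c dst N tb s t (Q : state -> Prop) :
  N < W ->
  (forall s1, (forall y, y != x -> regs s1 y = regs s y) -> safe W s1 e /\ den s1 e = N) ->
  (forall i s1, i < N -> (forall y, y != x -> regs s1 y = regs s y) -> regs s1 x = i ->
     (forall b, cells s1 b = if dst <= b < dst + i then f (b - dst) else cells s b) ->
     runs W c s1 tb (fun s2 => (forall y, regs s2 y = regs s1 y) /\
       forall b, cells s2 b = update (cells s1) (dst + i) (f i) b)) ->
  (forall s', (forall y, y != x -> regs s' y = regs s y) ->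
     (forall k, k < N -> cells s' (dst + k) = f k) -> same_cells dst N s s' -> Q s') ->
  N * (tb + cost e + 8) + cost e + 6 <= t ->
  runs W (For x e c) s t Q.
Proof.
move=> NW se st fin tt.
pose I i s1 := [/\ forall y, y != x -> regs s1 y = regs s y, regs s1 x = i &
  forall b, cells s1 b = if dst <= b < dst + i then f (b - dst) else cells s b].
apply: (@runs_for W W_gt0 I _ _ _ N tb) => //.
- by move=> i s1 [h _ _]; exact: se.
- by move=> i s1 [].
- split=> [y yx|/=|b /=]; rewrite /= /update ?eqxx ?(negPf yx) //.
  by case: ifP => //; lia.
- move=> i s1 iN [h1 h2 h3]; apply: runs_conseq (st i s1 iN h1 h2 h3) (leqnn _) _.
  move=> s2 [r2 c2]; split; first by rewrite r2.
  split=> [y yx|/=|b].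
  + by rewrite /= /update (negPf yx) r2 h1.
  + by rewrite /update eqxx.
  + rewrite /= c2 /update h3; case: eqP => [->|ne].
      by rewrite leq_addr addnS ltnS leqnn /= addKn.
    by congr (if _ then _ else _); lia.
- move=> s1 [h1 _ h3]; apply: fin => // [k kN|b].
    by rewrite h3 leq_addr ltn_add2l kN /= addKn.
  by rewrite h3; case: ifP => //; lia.
Qed.

Lemma copy_runs s x t (Q : state -> Prop) :
  regs s 10 = R.+1 -> size x = R.+1 -> arr s (regs s 30) x ->
  regs s 30 + R.+1 <= W -> regs s 31 + R.+1 <= W ->
  regs s 30 + R.+1 <= regs s 31 \/ regs s 31 + R.+1 <= regs s 30 ->
  (forall s', same_regs 35 s s' -> arr s' (regs s 31) x ->
     same_cells (regs s 31) R.+1 s s' -> Q s') ->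
  R.+1 * 20 + 20 <= t ->
  runs W copy_cmd s t Q.
Proof.
move=> e10 sx ax sW dW dj fin tt.
apply: (@runs_fill (nth 0 x) 42 _ _ (regs s 31) R.+1 10) => //.
- lia.
- by move=> s1 h; rewrite /= h.
- move=> i s1 iR h1 h2 h3; have h y : y != 42 -> regs s1 y = regs s y by exact: h1.
  have ci : cells s1 (regs s 30 + i) = nth 0 x i.
    by rewrite h3 ifF ?ax ?sx //; lia.
  rstep (h2, h 31 isT, h 30 isT, ci); split=> // b.
- move=> s' h1 h2 h3; apply: fin => //.
    by move=> y yk; apply: h1; lia.
  by move=> k; rewrite sx; exact: h2.
- by rewrite /=; lia.
Qed.

Lemma vlt_take i x y : i < size x -> i < size y ->
  vlt (take i.+1 x) (take i.+1 y) =
    vlt (take i x) (take i y) || (take i x == take i y) && (nth 0 x i < nth 0 y i).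
Proof.
elim: x y i => [|a x IH] [|b y] [|i] //= ix iy.
  by rewrite !take0 /= andbF orbF.
rewrite IH // eqseq_cons; case: (ltngtP a b) => //= _.
Qed.

Lemma eq_take i (x y : seq nat) : i < size x -> i < size y ->
  (take i.+1 x == take i.+1 y) = (take i x == take i y) && (nth 0 x i == nth 0 y i).
Proof. by move=> ix iy; rewrite !(take_nth 0) // eqseq_rcons. Qed.

Lemma cmp_runs s x y t (Q : state -> Prop) :
  regs s 10 = R.+1 -> size x = R.+1 -> size y = R.+1 ->
  arr s (regs s 30) x -> arr s (regs s 31) y ->
  regs s 30 + R.+1 <= W -> regs s 31 + R.+1 <= W ->
  (forall s', same_regs 35 s s' -> cells s' = cells s -> regs s' 43 = vlt x y -> Q s') ->
  R.+1 * 40 + 30 <= t ->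
  runs W cmp_cmd s t Q.
Proof.
move=> e10 sx sy ax ay sW dW fin tt; rewrite /cmp_cmd.
rstep e10. rstep e10.
set s0 := set_reg _ _ _.
pose I i s1 := [/\ same_regs 35 s s1, cells s1 = cells s, regs s1 42 = i,
  regs s1 43 = vlt (take i x) (take i y) & regs s1 44 = (take i x == take i y)].
apply: (@runs_for W W_gt0 I _ _ _ R.+1 30).
- lia.
- by move=> i s1 [h _ _ _ _]; rewrite /= h.
- by move=> i s1 [].
- by split=> //=; [do !apply: same_set|rewrite !take0 /update /= ?eqxx..].
- move=> i s1 iR [h c i1 l1 q1].
  have ci : cells s1 (regs s 30 + i) = nth 0 x i by rewrite c ax ?sx.
  have cj : cells s1 (regs s 31 + i) = nth 0 y i by rewrite c ay ?sy.
  have E := (i1, l1, q1, h 30 isT, h 31 isT, ci, cj).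
  have b1 (b : bool) : b <= 1 by exact: leq_b1.
  rstep E.
  rstep E.
  rewrite ?mulnb -eq_take ?sx ?sy //.
  split; first by rewrite /= /update /= ?i1.
  split=> //=.
  + by do !apply: same_set.
  + rewrite /update /= vlt_take ?sx ?sy //; case: eqP => [->|_]; rewrite ?vlt_irr ?orbF ?addn0 //.
- move=> s1 [h c _ l1 _]; apply: fin => //; rewrite l1 !take_oversize ?sx ?sy //.
- by rewrite /=; lia.
Qed.

Lemma lift_runs s q sb (wk : bool) x t (Q : state -> Prop) :
  [/\ regs s 2 = d, regs s 3 = R & regs s 10 = R.+1] ->
  regs s 32 = q -> regs s 33 = sb -> regs s 34 = wk ->
  q <= d + 3 -> sb <= R ->
  size x = R.+1 -> all (fun t => t <= d.*2.+1) x -> arr s (regs s 30) x ->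
  regs s 30 + R.+1 <= W -> regs s 31 + R.+1 <= W ->
  regs s 30 + R.+1 <= regs s 31 \/ regs s 31 + R.+1 <= regs s 30 ->
  (forall s', same_regs 35 s s' -> arr s' (regs s 31) (LF d R wk q sb x) ->
     same_cells (regs s 31) R.+1 s s' -> Q s') ->
  R.+1 * 200 + 100 <= t ->
  runs W lift_cmd s t Q.
Proof.
move=> [e2 e3 e10] e32 e33 e34 qd sR sx tx ax sW dW dj fin tt; rewrite /lift_cmd.
do 5 rstep (e2, e10).
set s0 := set_reg _ _ _.
have ss0 : same_regs 35 s s0 by do !apply: same_set.
apply: (@runs_seq W W_gt0 _ _ _ (size x * 100 + 20) _ (fun s' =>
    [/\ same_regs 35 s s', cells s' = cells s &
        (regs s' 37, regs s' 38) = scan d wk q sb d.-1 0 R.+1 0 x])).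
- apply: (runs_conseq (@scan_runs W d R W_big s (regs s 30) q sb wk x 0 d.-1 R.+1 0 s0
    e2 erefl e32 e33 e34 sW qd sR _ tx _ _ ss0 erefl _)) => //; try lia.
  + by move=> k kx; rewrite addn0 ax.
  + by rewrite /s0 /= /update /=; split=> //; rewrite ?e2 ?subn1.
- by rewrite sx /=; lia.
move=> s1 [ss1 cs1 c1]; set c := scan _ _ _ _ _ _ _ _ _ in c1.
have cE : outv d R q sb x c = LF d R wk q sb x by exact: scan_LF.
clearbody c.
have r37 : regs s1 37 = c.1 by rewrite -c1.
have r38 : regs s1 38 = c.2 by rewrite -c1.
have r y : y < 35 -> regs s1 y = regs s y by exact: ss1.
apply: (@runs_fill (out d R q sb x c) 42 _ _ (regs s 31) R.+1 60) => //.
- lia.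
- by move=> s2 h; rewrite /= h // r.
{ move=> i s2 iR h1 h2 h3.
  have h y : y < 35 -> regs s2 y = regs s y by move=> y35; rewrite h1 ?r //; lia.
  have ci : cells s2 (regs s 30 + i) = nth 0 x i.
    by rewrite h3 ifF ?cs1 ?ax ?sx //; lia.
  have g37 : regs s2 37 = c.1 by rewrite h1.
  have g38 : regs s2 38 = c.2 by rewrite h1.
  have E := (h2, h 2 isT, h 3 isT, h 10 isT, h 30 isT, h 31 isT, h 32 isT, h 33 isT,
    g37, g38, e2, e3, e10, e32, e33, ci).
  apply: runs_bounded => [[b2 _]]; have c2b : c.2 <= W by rewrite -g38.
  rewrite /write_body; repeat rstep E.
  all: split=> // b; congr (if _ then _ else _); rewrite /out.
  all: repeat (case: ifP => ?; try (exfalso; lia)); rewrite /idx /low; lia. }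
- move=> s' h1 h2 h3; apply: fin.
  + by move=> y y35; rewrite h1 ?r //; lia.
  + by move=> k; rewrite -cE size_mkseq => kR; rewrite h2 // nth_mkseq.
  + by move=> b bb; rewrite h3 // cs1.
- by rewrite /= sx; lia.
Qed.

End Macros.

(** * The rounds as a program *)

Definition row (base i : expr) : expr := (base + i * $10)%X.

Definition prioE (v : expr) : expr := (mem[#3 + $0 + v])%X.

(** The first [lift_cmd] finds the least leaf in the subtree of [mu v], and comparing it with [mu v]
    gives the flag of [Xf]. Adding [d + 2 - prio] to [prio + 1] produces the [d + 3] that suppresses
    the base label. *)
Definition init_body : cmd := (
  30 :=r row $4 $15 ;; 31 :=r $9 ;; 32 :=r prioE $15 + #1 ;; 33 :=r $3 ;; 34 :=r #1 ;;
  lift_cmd ;;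
  30 :=r $9 ;; 31 :=r row $4 $15 ;;
  cmp_cmd ;;
  17 :=r prioE $15 %% #2 ;; 18 :=r mem[$7 + $15] ;;
  34 :=r (#1 - $17) * ((#0 < $18) * (#1 - $43)) ;;
  33 :=r $18 - #1 ;;
  32 :=r (prioE $15 + #1) + (#0 < $17 + ($18 == #0)) * ($2 + #2 - prioE $15) ;;
  30 :=r row $4 $15 ;; 31 :=r row $5 $15 ;;
  lift_cmd ;;
  30 :=r row $5 $15 ;; 31 :=r row $6 $15 ;;
  copy_cmd ;;
  [$8 + $15] :=m #0)%C.

(** The sum of the two tests is a disjunction: the tail belongs to Even, or the arc is the choice of
    [tau]. The value put in register 32 is [oddup] of the priority. *)
Definition arcs_body (body : cmd) : cmd := (
  15 :=r mem[#3 + #3 * $0 + #2 * $14] ;;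
  16 :=r mem[#4 + #3 * $0 + #2 * $14] ;;
  If ((mem[#3 + $15] == #0) + (mem[#3 + #2 * $0 + $15] == $16))%X
    (30 :=r row $6 $16 ;; 31 :=r $9 ;;
     17 :=r prioE $15 ;; 18 :=r $17 %% #2 ;;
     32 :=r $17 + #1 - $18 ;; 33 :=r $3 ;; 34 :=r #1 - $18 ;;
     lift_cmd ;; body)
    Skip)%C.

Definition arcs_cmd (body : cmd) : cmd := For 14 ($1)%X (arcs_body body).

Definition relax_body : cmd := (
  30 :=r $9 ;; 31 :=r row $6 $15 ;; cmp_cmd ;; If ($43)%X copy_cmd Skip)%C.

Definition check_body : cmd := (
  30 :=r row $5 $15 ;; 31 :=r $9 ;; cmp_cmd ;;
  If ($43)%X Skip ([$8 + $15] :=m #1))%C.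

Definition demote_body : cmd := (
  If ((mem[$7 + $15] == $11) * (mem[$8 + $15] == #0))%X
    ([$7 + $15] :=m $11 - #1 ;; 12 :=r #1) Skip)%C.

Definition promote_body : cmd := (
  If (mem[$7 + $15] == $11)%X ([$7 + $15] :=m $11 + #1) Skip)%C.

(** Register 12 records a demotion; the bound is raised only in a round without any. *)
Definition round : cmd := (
  For 15 ($0)%X init_body ;;
  For 13 ($0)%X (arcs_cmd relax_body) ;;
  arcs_cmd check_body ;;
  12 :=r #0 ;;
  For 15 ($0)%X demote_body ;;
  If ($12)%X Skip (For 15 ($0)%X promote_body ;; 11 :=r $11 + #1))%C.

Definition main_loop : cmd := (11 :=r #0 ;; While ($11 < $3 + #2)%X round)%C.

Definition set_at T (f : nat -> T) (v : nat) (y : T) : nat -> T :=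
  fun u => if u == v then y else f u.

(** * Memory layout and correctness of the rounds *)

Section Heap.
Variables W n m d R aM aX aD aC aO aT : nat.
Variables (own : nat -> bool) (tv pr : nat -> nat) (ar : seq (nat * nat)).
Variable mu : nat -> seq nat.
Hypothesis leM : 3 + 3 * n + 2 * m <= aM.
Hypothesis leX : aM + n * R.+1 <= aX.
Hypothesis leD : aX + n * R.+1 <= aD.
Hypothesis leC : aD + n * R.+1 <= aC.
Hypothesis leO : aC + n <= aO.
Hypothesis leT : aO + n <= aT.
Hypothesis leW : aT + 8 * d + 4 * R + 100 <= W.

Let W_gt0 : 0 < W.
Proof. lia. Qed.

Let W_big : 8 * d + 2 * R + 50 <= W.
Proof. lia. Qed.

(* The contents of the registers 0 to 10; [aM], [aX], [aD] are the addresses of tables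
   of words for [mu], the base labels and the current labels, [aC] and [aO] those of the
   bounds and of the flags for justified nodes, and [aT] that of an auxiliary word. *)
Definition globals : seq nat := [:: n; m; d; R; aM; aX; aD; aC; aO; aT; R.+1].

Definition arrs (s : state) (a : nat) (X : nat -> seq nat) : Prop :=
  forall v, v < n -> size (X v) = R.+1 /\ arr s (a + v * R.+1) (X v).

Record heap (s : state) (X D : nat -> seq nat) (c ok : nat -> nat) : Prop := Heap {
  heap_glob : forall x, x < 11 -> regs s x = nth 0 globals x;
  heap_own : forall v, v < n -> cells s (3 + v) = own v;
  heap_pr : forall v, v < n -> cells s (3 + n + v) = pr v;
  heap_tau : forall v, v < n -> cells s (3 + 2 * n + v) = tv v;
  heap_arc1 : forall k, k < m -> cells s (3 + 3 * n + 2 * k) = (nth (0, 0) ar k).1;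
  heap_arc2 : forall k, k < m -> cells s (4 + 3 * n + 2 * k) = (nth (0, 0) ar k).2;
  heap_mu : arrs s aM mu;
  heap_X : arrs s aX X;
  heap_D : arrs s aD D;
  heap_c : forall v, v < n -> cells s (aC + v) = c v;
  heap_ok : forall v, v < n -> cells s (aO + v) = ok v }.

Lemma row_le v : v < n -> v * R.+1 + R.+1 <= n * R.+1.
Proof. by move=> vn; rewrite addnC -mulSn leq_mul2r vn orbT. Qed.

Lemma arrs_eq s s' a X : (forall b, a <= b < a + n * R.+1 -> cells s' b = cells s b) ->
  arrs s a X -> arrs s' a X.
Proof.
move=> eq aX' v vn; have [sX aXv] := aX' v vn; split=> // k kX.
rewrite eq ?aXv //; have := row_le vn; rewrite sX in kX; lia.
Qed.

Lemma arrs_set s s' a X v y : v < n -> size y = R.+1 -> arrs s a X ->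
  arr s' (a + v * R.+1) y -> same_cells (a + v * R.+1) R.+1 s s' ->
  arrs s' a (set_at X v y).
Proof.
move=> vn sy aX' ay sc u un; rewrite /set_at; case: eqVneq => [->|uv] //.
have [sX aXu] := aX' u un; split=> // k kX; rewrite sc ?aXu //.
rewrite sX in kX; case: (ltngtP u v) uv => // uv _.
  by have : u * R.+1 + R.+1 <= v * R.+1; [rewrite addnC -mulSn leq_mul2r uv orbT|lia].
by have : v * R.+1 + R.+1 <= u * R.+1; [rewrite addnC -mulSn leq_mul2r uv orbT|lia].
Qed.

Ltac frame sc := split=> //;
  try (by move=> ? ?; rewrite sc; [auto|lia]);
  try (by match goal with h : arrs ?s ?a ?X |- arrs _ ?a ?X =>
    apply: arrs_eq h => b bb; rewrite sc //; lia end).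

Lemma heap_scratch s s' X D c ok : heap s X D c ok -> same_regs 11 s s' ->
  same_cells aT R.+1 s s' -> heap s' X D c ok.
Proof.
case=> h1 h2 h3 h4 h5 h6 h7 h8 h9 h10 h11 sr sc; frame sc.
by move=> x x11; rewrite sr ?h1.
Qed.

Lemma heap_regs s s' X D c ok : heap s X D c ok -> same_regs 11 s s' ->
  cells s' = cells s -> heap s' X D c ok.
Proof. by move=> h sr cs; apply: heap_scratch h sr _ => b _; rewrite cs. Qed.

Lemma heap_set_X s s' X D c ok v y : v < n -> size y = R.+1 -> heap s X D c ok ->
  same_regs 11 s s' -> arr s' (aX + v * R.+1) y -> same_cells (aX + v * R.+1) R.+1 s s' ->
  heap s' (set_at X v y) D c ok.
Proof.
move=> vn sy [h1 h2 h3 h4 h5 h6 h7 h8 h9 h10 h11] sr ay sc; have rl := row_le vn; frame sc.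
- by move=> x x11; rewrite sr ?h1.
- exact: arrs_set h8 ay sc.
Qed.

Lemma heap_set_D s s' X D c ok v y : v < n -> size y = R.+1 -> heap s X D c ok ->
  same_regs 11 s s' -> arr s' (aD + v * R.+1) y -> same_cells (aD + v * R.+1) R.+1 s s' ->
  heap s' X (set_at D v y) c ok.
Proof.
move=> vn sy [h1 h2 h3 h4 h5 h6 h7 h8 h9 h10 h11] sr ay sc; have rl := row_le vn; frame sc.
- by move=> x x11; rewrite sr ?h1.
- exact: arrs_set h9 ay sc.
Qed.

Lemma heap_set_c s X D c ok v y : v < n -> heap s X D c ok ->
  heap (set_cell s (aC + v) y) X D (set_at c v y) ok.
Proof.
move=> vn [h1 h2 h3 h4 h5 h6 h7 h8 h9 h10 h11]; have rl := row_le vn.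
have ne b : b != aC + v -> cells (set_cell s (aC + v) y) b = cells s b.
  by move=> bv; rewrite /= /update (negPf bv).
frame ne.
by move=> u un; rewrite /= /update /set_at eqn_add2l; case: ifP => // _; exact: h10.
Qed.

Lemma heap_set_ok s X D c ok v y : v < n -> heap s X D c ok ->
  heap (set_cell s (aO + v) y) X D c (set_at ok v y).
Proof.
move=> vn [h1 h2 h3 h4 h5 h6 h7 h8 h9 h10 h11]; have rl := row_le vn.
have ne b : b != aO + v -> cells (set_cell s (aO + v) y) b = cells s b.
  by move=> bv; rewrite /= /update (negPf bv).
frame ne.
by move=> u un; rewrite /= /update /set_at eqn_add2l; case: ifP => // _; exact: h11.
Qed.

Definition active_arc (e : nat * nat) : bool := ~~ own e.1 || (tv e.1 == e.2).

Notation acts := (filter active_arc ar).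
Notation valid := (valid d R).
Notation validl := (validl d R n).
Notation base := (base d R pr mu).
Notation relax := (relax d R pr).
Notation lift := (lift d R).

Hypothesis d_gt0 : 0 < n -> 0 < d.
Hypothesis ar_size : size ar = m.
Hypothesis ar_lt : forall e, e \in ar -> (e.1 < n) && (e.2 < n).
Hypothesis pr_le : forall v, v < n -> 0 < pr v <= d.
Hypothesis mu_valid : forall v, v < n -> valid (mu v).

Lemma heap_g s X D c ok : heap s X D c ok ->
  (regs s 0 = n) * (regs s 1 = m) * (regs s 2 = d) * (regs s 3 = R) *
  (regs s 4 = aM) * (regs s 5 = aX) * (regs s 6 = aD) * (regs s 7 = aC) *
  (regs s 8 = aO) * (regs s 9 = aT) * (regs s 10 = R.+1).
Proof. by case=> g _ _ _ _ _ _ _ _ _ _; do !split; rewrite g. Qed.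

Lemma heap_lift s s0 s1 X D c ok : heap s X D c ok -> same_regs 30 s s0 ->
  cells s0 = cells s -> same_regs 35 s0 s1 -> same_cells aT R.+1 s0 s1 ->
  same_regs 30 s s1 /\ heap s1 X D c ok.
Proof.
move=> hp sr cs sr1 sc1.
have sr2 : same_regs 30 s s1 by apply: same_regs_trans sr _; exact: same_regs_le sr1.
split=> //; apply: (heap_scratch hp); first exact: same_regs_le sr2.
by move=> b bb; rewrite sc1 // cs.
Qed.

Lemma init_body_runs s v X D c ok t (Q : state -> Prop) :
  heap s X D c ok -> regs s 15 = v -> v < n -> c v <= R.+1 ->
  (forall s', same_regs 17 s s' -> heap s' (set_at X v (base c v))
     (set_at D v (base c v)) c (set_at ok v 0) -> Q s') ->
  R.+1 * 500 + 600 <= t ->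
  runs W init_body s t Q.
Proof.
move=> hp r15 vn cv fin tt.
have G := heap_g hp; have rl := row_le vn; have pv := pr_le vn.
have prv : cells s (3 + n + v) = pr v by apply: (heap_pr hp).
have cvE : cells s (aC + v) = c v by apply: (heap_c hp).
have vm := mu_valid vn; have sm := size_valid vm.
have d0 := d_gt0 (leq_ltn_trans (leq0n v) vn); have tm := valid_le d0 vm.
have [_ am] := heap_mu hp vn.
rewrite /init_body /row /prioE.
do 5 rstep (r15, G, prv).
apply: (@runs_seq_k W W_gt0 (R.+1 * 200 + 100)); first by rewrite /=; lia.
set s0 := set_reg _ _ _.
have ss0 : same_regs 30 s s0 by do !apply: same_set.
apply: (@lift_runs W d R W_big s0 (pr v + 1) R true (mu v)) => //.
all: try (rewrite /s0 /= /update /= ?G ?addn1 //; lia).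
rewrite (_ : regs s0 31 = aT); last by rewrite /s0 /= /update /= ?G.
move=> s1 ss1; rewrite addn1 => as1 sc1; have [sr1 hp1] := heap_lift hp ss0 erefl ss1 sc1.
apply: (@runs_le _ (R.+1 * 300 + 450)); first by rewrite /=; lia.
have G1 := heap_g hp1; have r15' : regs s1 15 = v by rewrite sr1.
do 2 rstep (r15', G1).
apply: (@runs_seq_k W W_gt0 (R.+1 * 40 + 30)); first by rewrite /=; lia.
clear ss0 ss1 sc1; clearbody s0; clear s0.
set s2 := set_reg _ _ _.
have [_ am1] := heap_mu hp1 vn.
apply: (@cmp_runs W d R W_big s2 (LF d R true (pr v).+1 R (mu v)) (mu v)) => //.
all: try (rewrite /s2 /= /update /= ?G1 ?size_LF //; lia).
move=> s3 sr3 cs3 r43.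
have sr3' : same_regs 30 s1 s3.
  by apply: (same_regs_trans (s1 := s2)); [do !apply: same_set|exact: same_regs_le sr3].
have hp3 : heap s3 X D c ok.
  by apply: (heap_regs hp1); [exact: same_regs_le sr3'|].
apply: (@runs_le _ (R.+1 * 260 + 380)); first by rewrite /=; lia.
have G3 := heap_g hp3; have r153 : regs s3 15 = v by rewrite sr3'.
have pr3 : cells s3 (3 + n + v) = pr v by apply: (heap_pr hp3).
have c3 : cells s3 (aC + v) = c v by apply: (heap_c hp3).
have m2 := modn2 (pr v).
have b1 (b : bool) : b <= 1 by exact: leq_b1.
have bo := b1 (odd (pr v)).
do 7 rstep (r153, G3, pr3, c3, m2, r43).
apply: (@runs_seq_k W W_gt0 (R.+1 * 200 + 100)); first by rewrite /=; lia.
set s4 := set_reg _ _ _; set q := if noX (c v) (pr v) then d + 3 else (pr v).+1.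
set wk := ~~ noX (c v) (pr v) && ~~ vlt (LF d R true (pr v).+1 R (mu v)) (mu v).
have e32 : regs s4 32 = q.
  rewrite /s4 /= /update /= /q /noX; case: (odd (pr v)); case: eqP => /= ?; lia.
have e33 : regs s4 33 = (c v).-1 by rewrite /s4 /= /update /= subn1.
have e34 : regs s4 34 = wk.
  rewrite /s4 /= /update /= /wk /noX; case: (odd (pr v)) => //=.
  by case: (c v) => //= ?; case: (vlt _ _).
have e30 : regs s4 30 = aM + v * R.+1 by rewrite /s4 /= /update /= ?G3 ?r153.
have e31 : regs s4 31 = aX + v * R.+1 by rewrite /s4 /= /update /= ?G3 ?r153.
have ss4 : same_regs 17 s3 s4 by do !apply: same_set.
have cs4 : cells s4 = cells s3 by [].
have G4 : [/\ regs s4 2 = d, regs s4 3 = R & regs s4 10 = R.+1].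
  by rewrite !ss4 // !G3.
clearbody s4; have [_ am3] := heap_mu hp3 vn.
have qd : q <= d + 3 by rewrite /q; case: ifP => _; lia.
apply: (@lift_runs W d R W_big s4 q (c v).-1 wk (mu v)) => //; rewrite ?e30 ?e31; try lia.
  by move=> k kx; rewrite cs4 am3.
rewrite -/(Xf d R (c v) (pr v) (mu v)) -/(base c v) => s5 ss5 as5 sc5.
have vX : valid (base c v) by apply: (Xf_valid d0) => //; case/andP: pv.
have sX := size_valid vX.
have sr5 : same_regs 17 s3 s5 by apply: same_regs_trans ss4 _; exact: same_regs_le ss5.
have hp5 : heap s5 (set_at X v (base c v)) D c ok.
  apply: (heap_set_X vn sX hp3 _ as5).
    exact: same_regs_le sr5.
  by move=> b bb; rewrite sc5 // cs4.
apply: (@runs_le _ (R.+1 * 60 + 150)); first by rewrite /=; lia.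
have G5 := heap_g hp5; have r155 : regs s5 15 = v by rewrite sr5.
clear -W_gt0 W_big leM leX leD leC leO leT leW fin G5 r155 hp5 sr5 sr3' sr1 vn rl sX as5.
do 2 rstep (r155, G5).
apply: (@runs_seq_k W W_gt0 (R.+1 * 20 + 20)); first by rewrite /=; lia.
set s6 := set_reg _ _ _.
have e60 : regs s6 30 = aX + v * R.+1 by rewrite /s6 /= /update /= ?G5 ?r155.
have e61 : regs s6 31 = aD + v * R.+1 by rewrite /s6 /= /update /= ?G5 ?r155.
have e610 : regs s6 10 = R.+1 by rewrite /s6 /= /update /= ?G5.
have ss6 : same_regs 30 s5 s6 by do !apply: same_set.
have cs6 : cells s6 = cells s5 by [].
clearbody s6.
apply: (@copy_runs W d R W_big s6 (base c v)) => //; rewrite ?e60 ?e61; try lia.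
  by move=> k kx; rewrite cs6 as5.
move=> s7 ss7 as7 sc7.
have sr7 : same_regs 30 s5 s7 by apply: same_regs_trans ss6 _; exact: same_regs_le ss7.
have hp7 : heap s7 (set_at X v (base c v)) (set_at D v (base c v)) c ok.
  apply: (heap_set_D vn sX hp5 _ as7).
    exact: same_regs_le sr7.
  by move=> b bb; rewrite sc7 // cs6.
apply: (@runs_le _ 60); first by rewrite /=; lia.
have G7 := heap_g hp7; have r157 : regs s7 15 = v by rewrite sr7.
rstep (r157, G7).
apply: fin; last exact: (heap_set_ok 0 vn hp7).
move=> y y17; rewrite /= sr7 ?sr5 ?sr3' ?sr1 //; lia.
Qed.

Section Loop.
Variables (body : cmd) (tb : nat) (X : nat -> seq nat) (c : nat -> nat).
Variables (DF : seq (nat * nat) -> nat -> seq nat) (okF : seq (nat * nat) -> nat -> nat).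
Notation pre i := (filter (active_arc) (take i ar)).
Hypothesis DF_valid : forall i, validl (DF (pre i)).
Hypothesis body_runs : forall l e s (Q : state -> Prop), e \in ar -> active_arc e ->
  validl (DF l) -> heap s X (DF l) c (okF l) -> regs s 15 = e.1 ->
  arr s aT (lift (pr e.1) (DF l e.2)) ->
  (forall s', same_regs 17 s s' -> heap s' X (DF (rcons l e)) c (okF (rcons l e)) -> Q s') ->
  runs W body s tb Q.

Lemma arcs_body_runs i s t (Q : state -> Prop) :
  i < m -> regs s 14 = i -> heap s X (DF (pre i)) c (okF (pre i)) ->
  (forall s', same_regs 15 s s' -> heap s' X (DF (pre i.+1)) c (okF (pre i.+1)) -> Q s') ->
  tb + R.+1 * 200 + 300 <= t ->
  runs W (arcs_body body) s t Q.
Proof.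
move=> im r14 hp fin tt; have G := heap_g hp.
have iar : i < size ar by rewrite ar_size.
set e := nth (0, 0) ar i.
have ear : e \in ar by exact: mem_nth.
have /andP[e1n e2n] := ar_lt ear.
have preS : pre i.+1 = if active_arc e then rcons (pre i) e else pre i.
  by rewrite (take_nth (0, 0)) // filter_rcons.
have vD := DF_valid i; set l := pre i in hp vD preS.
have c1 : cells s (3 + 3 * n + 2 * i) = e.1 by exact: (heap_arc1 hp).
have c2 : cells s (4 + 3 * n + 2 * i) = e.2 by exact: (heap_arc2 hp).
clearbody e; case: e ear e1n e2n preS c1 c2 => e1 e2 /= ear e1n e2n preS c1 c2.
have co : cells s (3 + e1) = own e1 by exact: (heap_own hp).
have ct : cells s (3 + 2 * n + e1) = tv e1 by exact: (heap_tau hp).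
have cp : cells s (3 + n + e1) = pr e1 by exact: (heap_pr hp).
have rl := row_le e2n; have pv := pr_le e1n.
have n0 : 0 < n by exact: leq_ltn_trans e1n.
have bo : (own e1 : nat) <= 1 := leq_b1 _.
have m2 := modn2 (pr e1); have bp : (odd (pr e1) : nat) <= 1 := leq_b1 _.
rewrite /arcs_body /row /prioE.
do 2 rstep (r14, G, c1, c2).
rstep (r14, G, c1, c2, co, ct); last first.
  rstep G; apply: fin; first by do !apply: same_set.
  rewrite preS ifF; first by apply: heap_regs hp _ _ => //; do !apply: same_set.
  apply/negbTE; rewrite /active_arc negb_or negbK.
  by move: c0; case: (own _); case: (tv _ == _) => //=; lia.
have act : active_arc (e1, e2).
  by move: c0; rewrite /active_arc; case: (own _) => //=; case: eqP => //=; lia.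
rewrite act in preS.
apply: (@runs_le _ (tb + R.+1 * 200 + 250)); first by rewrite /=; lia.
do 7 rstep (G, cp, m2).
apply: (@runs_seq_k W W_gt0 (R.+1 * 200 + 100)); first by rewrite /=; lia.
set s1 := set_reg _ _ _.
have ss1 : same_regs 15 s s1 by do !apply: same_set.
have cs1 : cells s1 = cells s by [].
have e30 : regs s1 30 = aD + e2 * R.+1 by rewrite /s1 /= /update /= ?G.
have e31 : regs s1 31 = aT by rewrite /s1 /= /update /= ?G.
have e32 : regs s1 32 = oddup (pr e1).
  by rewrite /s1 /= /update /= /oddup; case: ifP => _; lia.
have e33 : regs s1 33 = R by rewrite /s1 /= /update /= ?G.
have e34 : regs s1 34 = ~~ odd (pr e1).
  by rewrite /s1 /= /update /=; case: (odd _).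
have e15 : regs s1 15 = e1 by rewrite /s1 /= /update /=.
have G1 : [/\ regs s1 2 = d, regs s1 3 = R & regs s1 10 = R.+1] by rewrite !ss1 // !G.
clearbody s1.
have hp1 : heap s1 X (DF l) c (okF l) by apply: heap_regs hp _ cs1; exact: same_regs_le ss1.
have [_ aDe] := heap_D hp1 e2n; have vDe := vD _ e2n.
have d0 := d_gt0 n0.
apply: (@lift_runs W d R W_big s1 (oddup (pr e1)) R (~~ odd (pr e1)) (DF l e2)) => //;
  rewrite ?e30 ?e31; try lia.
- by rewrite /oddup; case: ifP; lia.
- exact: size_valid vDe.
- exact: valid_le d0 vDe.
- exact: aDe.
move=> s2 ss2 as2 sc2.
have sr2 : same_regs 17 s1 s2 by exact: same_regs_le ss2.
have hp2 : heap s2 X (DF l) c (okF l).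
  apply: (heap_scratch hp1) => //.
  exact: same_regs_le ss2.
apply: (runs_conseq (t := tb) (body_runs (Q := Q) ear act vD hp2 _ as2 _)) => //.
- by rewrite sr2.
- move=> s3 ss3 hp3; apply: fin; last by rewrite preS.
  apply: same_regs_trans ss1 _; apply: same_regs_trans (same_regs_le _ sr2) _ => //.
  exact: same_regs_le ss3.
- by rewrite /=; lia.
Qed.

(** [DF] and [okF] give the tables as functions of the active arcs already treated; relaxing and
    checking are two instances of the same loop. *)
Lemma arcs_runs s t (Q : state -> Prop) :
  heap s X (DF [::]) c (okF [::]) ->
  (forall s', same_regs 14 s s' -> heap s' X (DF acts) c (okF acts) -> Q s') ->
  m * (tb + R.+1 * 200 + 310) + 20 <= t ->
  runs W (arcs_cmd body) s t Q.
Proof.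
move=> hp fin tt.
pose I i s1 := [/\ same_regs 14 s s1, regs s1 14 = i & heap s1 X (DF (pre i)) c (okF (pre i))].
apply: (@runs_for W W_gt0 I _ _ _ m (tb + R.+1 * 200 + 300)).
- lia.
- by move=> i s1 [_ _ /heap_g G]; rewrite /= G.
- by move=> i s1 [].
- split; [by do !apply: same_set|by []|].
  by rewrite take0; apply: heap_regs hp _ _ => //; do !apply: same_set.
- move=> i s1 im [ss1 r14 hp1].
  apply: (arcs_body_runs im r14 hp1) => // s2 ss2 hp2; split; first by rewrite ss2.
  split=> //.
    by apply: same_set => //; apply: same_regs_trans ss1 _; exact: same_regs_le ss2.
  by apply: heap_regs hp2 _ _ => //; do !apply: same_set.
- move=> s1 [ss1 _ hp1]; apply: fin => //.
  by move: hp1; rewrite take_oversize // ar_size.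
- by rewrite /=; lia.
Qed.

End Loop.

Notation bellman := (bellman d R acts pr).
Notation run := (run d R n acts pr mu).
Notation supported := (supported d R n acts pr mu).
Notation bounded := (bounded R n).
Notation inv := (inv d R n acts pr mu).
Notation demote := (demote d R n acts pr mu).

Hypothesis acts_succ : forall v, v < n -> exists w : nat, (v, w) \in acts.
Hypothesis mu_lift : forall v w : nat, (v, w) \in acts -> vle (mu v) (lift (pr v) (mu w)).

Let acts_lt (v w : nat) : (v, w) \in acts -> (v < n) && (w < n).
Proof. by rewrite mem_filter => /andP[_ /ar_lt]. Qed.

Let pr_le_d v : v < n -> pr v <= d.
Proof. by move=> /pr_le/andP[]. Qed.

Lemma heap_ext s X D c ok X' D' c' ok' : heap s X D c ok ->
  (forall v, v < n -> [/\ X' v = X v, D' v = D v, c' v = c v & ok' v = ok v]) ->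
  heap s X' D' c' ok'.
Proof.
case=> h1 h2 h3 h4 h5 h6 h7 h8 h9 h10 h11 E; split=> //.
- by move=> v vn; case: (E v vn) => -> _ _ _; exact: h8.
- by move=> v vn; case: (E v vn) => _ -> _ _; exact: h9.
- by move=> v vn; case: (E v vn) => _ _ -> _; exact: h10.
- by move=> v vn; case: (E v vn) => _ _ _ ->; exact: h11.
Qed.

Lemma foldl_relax_valid D i : validl D ->
  validl (foldl relax D (filter (active_arc) (take i ar))).
Proof.
case: (posnP n) => [-> _ v //|n0 vD].
have ss : {subset filter (active_arc) (take i ar) <= acts}.
  by move=> e; rewrite !mem_filter => /andP[-> /mem_take].
by case: (relax_foldl (d_gt0 n0) acts_lt pr_le_d ss vD).
Qed.

Lemma bellman_validl k D : validl D -> validl (bellman k D).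
Proof.
case: (posnP n) => [-> _ v //|n0 vD].
exact (bellman_valid (d_gt0 n0) acts_lt pr_le_d k vD).
Qed.

Lemma base_validl c : bounded c -> validl (base c).
Proof.
case: (posnP n) => [-> _ v //|n0 bc].
exact (base_valid (d_gt0 n0) pr_le_d mu_valid bc).
Qed.

Lemma relax_body_runs D X c ok s (e : nat * nat) t (Q : state -> Prop) :
  e \in ar -> validl D -> heap s X D c ok -> regs s 15 = e.1 ->
  arr s aT (lift (pr e.1) (D e.2)) ->
  (forall s', same_regs 17 s s' -> heap s' X (relax D e) c ok -> Q s') ->
  R.+1 * 60 + 100 <= t -> runs W relax_body s t Q.
Proof.
case: e => v w /= ea vD hp r15 aL fin tt; have /andP[/= vn wn] := ar_lt ea.
have G := heap_g hp; have rl := row_le vn; rewrite /relax_body /row.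
do 2 rstep (r15, G).
apply: (@runs_seq_k W W_gt0 (R.+1 * 40 + 30)); first by rewrite /=; lia.
set s1 := set_reg _ _ _.
have ss1 : same_regs 17 s s1 by do !apply: same_set.
have cs1 : cells s1 = cells s by [].
have e30 : regs s1 30 = aT by rewrite /s1 /= /update /= ?G.
have e31 : regs s1 31 = aD + v * R.+1 by rewrite /s1 /= /update /= ?G.
have e10 : regs s1 10 = R.+1 by rewrite ss1 // G.
clearbody s1.
have vL : valid (lift (pr v) (D w)).
  by apply: lift_valid; [exact: d_gt0 (leq_ltn_trans (leq0n v) vn)|exact: pr_le_d|exact: vD].
have sL := size_valid vL; have [sD aDv] := heap_D hp vn.
apply: (@cmp_runs W d R W_big s1 (lift (pr v) (D w)) (D v)) => //; rewrite ?e30 ?e31; try lia.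
- by move=> k kx; rewrite cs1 aL.
- by move=> k kx; rewrite cs1 aDv.
move=> s2 ss2 cs2 r43.
have sr2 : same_regs 17 s s2 by apply: same_regs_trans ss1 _; exact: same_regs_le ss2.
have hp2 : heap s2 X D c ok.
  by apply: heap_regs hp _ _; [exact: same_regs_le sr2|rewrite cs2].
have e30' : regs s2 30 = aT by rewrite ss2.
have e31' : regs s2 31 = aD + v * R.+1 by rewrite ss2.
apply: (@runs_le _ (R.+1 * 20 + 50)); first by rewrite /=; lia.
rstep (r43, e30').
- apply: (@copy_runs W d R W_big s2 (lift (pr v) (D w))) => //; rewrite ?e30' ?e31'; try lia.
  + by rewrite ss2.
  + by move=> k kx; rewrite cs2 cs1 aL.
  move=> s3 ss3 as3 sc3.
  have sr3 : same_regs 17 s2 s3 by exact: same_regs_le ss3.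
  apply: fin; first exact: same_regs_trans sr2 sr3.
  by rewrite /relax /= c0; apply: heap_set_D sL hp2 _ as3 sc3 => //; exact: same_regs_le sr3.
rstep G; apply: fin => //.
by rewrite /relax /= (negPf c0).
Qed.

Lemma check_body_runs D X c (ok ok' : nat -> nat) s (e : nat * nat) t (Q : state -> Prop) :
  e \in ar -> validl D -> validl X -> heap s X D c ok -> regs s 15 = e.1 ->
  arr s aT (lift (pr e.1) (D e.2)) ->
  (forall u, u < n -> ok' u =
    if (e.1 == u) && ~~ vlt (X u) (lift (pr e.1) (D e.2)) then 1 else ok u) ->
  (forall s', same_regs 17 s s' -> heap s' X D c ok' -> Q s') ->
  R.+1 * 40 + 100 <= t -> runs W check_body s t Q.
Proof.
case: e => v w /= ea vD vX hp r15 aL okE fin tt; have /andP[/= vn wn] := ar_lt ea.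
have G := heap_g hp; have rl := row_le vn; rewrite /check_body /row.
do 2 rstep (r15, G).
apply: (@runs_seq_k W W_gt0 (R.+1 * 40 + 30)); first by rewrite /=; lia.
set s1 := set_reg _ _ _.
have ss1 : same_regs 17 s s1 by do !apply: same_set.
have cs1 : cells s1 = cells s by [].
have e30 : regs s1 30 = aX + v * R.+1 by rewrite /s1 /= /update /= ?G.
have e31 : regs s1 31 = aT by rewrite /s1 /= /update /= ?G.
have e10 : regs s1 10 = R.+1 by rewrite ss1 // G.
clearbody s1.
have vL : valid (lift (pr v) (D w)).
  by apply: lift_valid; [exact: d_gt0 (leq_ltn_trans (leq0n v) vn)|exact: pr_le_d|exact: vD].
have sL := size_valid vL; have [sX aXv] := heap_X hp vn.
apply: (@cmp_runs W d R W_big s1 (X v) (lift (pr v) (D w))) => //; rewrite ?e30 ?e31; try lia.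
- by move=> k kx; rewrite cs1 aXv.
- by move=> k kx; rewrite cs1 aL.
move=> s2 ss2 cs2 r43.
have sr2 : same_regs 17 s s2 by apply: same_regs_trans ss1 _; exact: same_regs_le ss2.
have hp2 : heap s2 X D c ok.
  by apply: heap_regs hp _ _; [exact: same_regs_le sr2|rewrite cs2].
have G2 := heap_g hp2; have r152 : regs s2 15 = v by rewrite sr2.
apply: (@runs_le _ 40); first by rewrite /=; lia.
rstep (r43, G2).
  rstep G2; apply: fin => //; apply: heap_ext hp2 _ => u un; split=> //.
  by rewrite okE //; case: eqP => //= <-; rewrite c0.
rstep (r152, G2); apply: fin; first by move=> y y17; rewrite /= sr2.
apply: heap_ext (heap_set_ok 1 vn hp2) _ => u un; split=> //.
rewrite okE // /set_at eq_sym; case: eqP => //= ->.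
by rewrite c0.
Qed.

Lemma init_loop_runs s X D c ok t (Q : state -> Prop) : bounded c ->
  heap s X D c ok ->
  (forall s', same_regs 15 s s' -> heap s' (base c) (base c) c (fun=> 0) -> Q s') ->
  n * (R.+1 * 500 + 620) + 20 <= t ->
  runs W (For 15 ($0)%X init_body) s t Q.
Proof.
move=> bc hp fin tt.
pose I i s1 := [/\ same_regs 15 s s1, regs s1 15 = i & exists X D ok, heap s1 X D c ok /\
  forall u, u < i -> [/\ X u = base c u, D u = base c u & ok u = 0]].
apply: (@runs_for W W_gt0 I _ _ _ n (R.+1 * 500 + 600)).
- lia.
- by move=> i s1 [_ _ [X1 [D1 [ok1 [/heap_g G _]]]]]; rewrite /= G.
- by move=> i s1 [].
- split; [by do !apply: same_set|by []|exists X, D, ok; split=> //].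
  by apply: heap_regs hp _ _ => //; do !apply: same_set.
- move=> i s1 iN [ss1 r15 [X1 [D1 [ok1 [hp1 E1]]]]].
  apply: (init_body_runs hp1 r15 iN (bc i iN)) => //.
  move=> s2 ss2 hp2; split; first by rewrite ss2.
  split=> //.
    by apply: same_set => //; apply: same_regs_trans ss1 _; exact: same_regs_le ss2.
  exists (set_at X1 i (base c i)), (set_at D1 i (base c i)), (set_at ok1 i 0); split.
    by apply: heap_regs hp2 _ _ => //; do !apply: same_set.
  move=> u; rewrite ltnS leq_eqVlt /set_at => /orP[/eqP ->|ui]; first by rewrite eqxx.
  by rewrite ltn_eqF //; exact: E1.
- move=> s1 [ss1 _ [X1 [D1 [ok1 [hp1 E1]]]]]; apply: fin => //.
  by apply: heap_ext hp1 _ => v vn; case: (E1 v vn).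
- by rewrite /=; lia.
Qed.

Lemma bellman_loop_runs s X D c ok t (Q : state -> Prop) : validl D ->
  heap s X D c ok ->
  (forall s', same_regs 13 s s' -> heap s' X (bellman n D) c ok -> Q s') ->
  n * (m * (R.+1 * 260 + 410) + 30) + 20 <= t ->
  runs W (For 13 ($0)%X (arcs_cmd relax_body)) s t Q.
Proof.
move=> vD hp fin tt.
pose I i s1 := [/\ same_regs 13 s s1, regs s1 13 = i & heap s1 X (bellman i D) c ok].
apply: (@runs_for W W_gt0 I _ _ _ n (m * (R.+1 * 60 + 100 + R.+1 * 200 + 310) + 20)).
- lia.
- by move=> i s1 [_ _ /heap_g G]; rewrite /= G.
- by move=> i s1 [].
- split; [by do !apply: same_set|by []|].
  by apply: heap_regs hp _ _ => //; do !apply: same_set.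
- move=> i s1 iN [ss1 r13 hp1].
  have vB := bellman_validl i vD.
  apply: (arcs_runs (tb := R.+1 * 60 + 100) (X := X) (c := c)
    (DF := fun l => foldl relax (bellman i D) l) (okF := fun=> ok) _ _ hp1) => //.
  + by move=> j; exact: foldl_relax_valid.
  + move=> l e s2 Q' ea _ vl hp2 r15 aT2 fin2; rewrite foldl_rcons in fin2.
    exact: relax_body_runs ea vl hp2 r15 aT2 fin2 (leqnn _).
  move=> s2 ss2 hp2; split; first by rewrite ss2.
  split=> //.
    by apply: same_set => //; apply: same_regs_trans ss1 _; exact: same_regs_le ss2.
  by rewrite bellmanS; apply: heap_regs hp2 _ _ => //; do !apply: same_set.
- by move=> s1 [ss1 _ hp1]; exact: fin.
- rewrite /=; apply: leq_trans tt.
  have -> : R.+1 * 60 + 100 + R.+1 * 200 + 310 = R.+1 * 260 + 410 by lia.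
  have -> : m * (R.+1 * 260 + 410) + 20 + 1 + 8 = m * (R.+1 * 260 + 410) + 29 by lia.
  by rewrite -addnA leq_add // leq_mul2l; lia.
Qed.

Lemma check_loop_runs s c t (Q : state -> Prop) : bounded c ->
  heap s (base c) (run c) c (fun=> 0) ->
  (forall s', same_regs 14 s s' ->
     heap s' (base c) (run c) c (fun v => nat_of_bool (supported c v)) -> Q s') ->
  m * (R.+1 * 240 + 410) + 20 <= t ->
  runs W (arcs_cmd check_body) s t Q.
Proof.
move=> bc hp fin tt; have vX := base_validl bc; have vD : validl (run c) := bellman_validl n vX.
pose okF l u := nat_of_bool
  (has (fun e => (e.1 == u) && ~~ vlt (base c u) (lift (pr e.1) (run c e.2))) l).
apply: (arcs_runs (tb := R.+1 * 40 + 100) (X := base c) (c := c)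
  (DF := fun=> run c) (okF := okF) _ _ hp) => //.
- move=> l e s2 Q' ea _ vl hp2 r15 aT2 fin2.
  apply: (check_body_runs (ok' := okF (rcons l e)) ea vD vX hp2 r15 aT2 _ fin2) => //.
  move=> u un; rewrite /okF has_rcons; case: (_ && _) => //.
- by apply: leq_trans tt; rewrite leq_add2r leq_mul2l; lia.
Qed.

(** The flags were all computed before any bound changes, so the demotions of a round refer to one
    and the same [c]. *)
Lemma demote_loop_runs s X D c ok cur t (Q : state -> Prop) : cur <= R.+2 ->
  heap s X D c ok -> regs s 11 = cur -> regs s 12 = 0 ->
  let fail u := (c u == cur) && (ok u == 0) in
  (forall s', same_regs 12 s s' -> regs s' 12 = has fail (iota 0 n) ->
     heap s' X D (fun u => if fail u then cur.-1 else c u) ok -> Q s') ->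
  n * 60 + 20 <= t ->
  runs W (For 15 ($0)%X demote_body) s t Q.
Proof.
move=> curR hp r11 r12 fail fin tt.
pose I i s1 := [/\ same_regs 12 s s1, regs s1 15 = i, regs s1 12 = has fail (iota 0 i) &
  heap s1 X D (fun u => if (u < i) && fail u then cur.-1 else c u) ok].
apply: (@runs_for W W_gt0 I _ _ _ n 45).
- lia.
- by move=> i s1 [_ _ _ /heap_g G]; rewrite /= G.
- by move=> i s1 [].
- split; [by do !apply: same_set|by []|by rewrite /= /update /= r12|].
  by apply: heap_regs hp _ _ => //; do !apply: same_set.
- move=> i s1 iN [ss1 r15 f12 hp1]; have G := heap_g hp1.
  have ci : cells s1 (aC + i) = c i by rewrite (heap_c hp1) // ltnn.
  have oi : cells s1 (aO + i) = ok i by exact: (heap_ok hp1).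
  have q11 : regs s1 11 = cur by rewrite ss1.
  have hasS : has fail (iota 0 i.+1) = has fail (iota 0 i) || fail i.
    by rewrite -addn1 iotaD has_cat /= orbF.
  have E := (r15, q11, G, ci, oi).
  rewrite /demote_body; rstep E.
  + do 2 rstep E; split; first by rewrite /= /update /=.
    have fi : fail i by exact: c0.
    split; [by do !apply: same_set|by []|by rewrite hasS fi orbT|].
    apply: (heap_regs (s := set_cell s1 (aC + i) (cur - 1))); [|by do !apply: same_set|by []].
    apply: heap_ext (heap_set_c (cur - 1) iN hp1) _ => u un; split=> //.
    rewrite /set_at ltnS leq_eqVlt; case: (eqVneq u i) => [->|//] /=.
    by rewrite fi subn1.
  + rstep E; split; first by rewrite /= /update /=.
    have fi : fail i = false by apply/negbTE.
    split; [by do !apply: same_set|by []|by rewrite hasS fi orbF|].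
    apply: (heap_regs (s := s1)); [|by do !apply: same_set|by []].
    apply: heap_ext hp1 _ => u un; split=> //.
    by rewrite ltnS leq_eqVlt; case: (eqVneq u i) => [->|//] /=; rewrite fi ltnn.
- move=> s1 [ss1 _ f12 hp1]; apply: fin => //.
  by apply: heap_ext hp1 _ => u un; rewrite un.
- by rewrite /=; lia.
Qed.

Lemma promote_loop_runs s X D c ok cur t (Q : state -> Prop) : cur <= R.+2 ->
  heap s X D c ok -> regs s 11 = cur ->
  (forall s', same_regs 12 s s' -> heap s' X D (promote cur c) ok -> Q s') ->
  n * 60 + 20 <= t ->
  runs W (For 15 ($0)%X promote_body) s t Q.
Proof.
move=> curR hp r11 fin tt.
pose I i s1 := [/\ same_regs 12 s s1, regs s1 15 = i &
  heap s1 X D (fun u => if (u < i) && (c u == cur) then cur.+1 else c u) ok].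
apply: (@runs_for W W_gt0 I _ _ _ n 45).
- lia.
- by move=> i s1 [_ _ /heap_g G]; rewrite /= G.
- by move=> i s1 [].
- split; [by do !apply: same_set|by []|].
  by apply: heap_regs hp _ _ => //; do !apply: same_set.
- move=> i s1 iN [ss1 r15 hp1]; have G := heap_g hp1.
  have ci : cells s1 (aC + i) = c i by rewrite (heap_c hp1) // ltnn.
  have q11 : regs s1 11 = cur by rewrite ss1.
  have E := (r15, q11, G, ci).
  rewrite /promote_body; rstep E.
  + rstep E; split; first by rewrite /= /update /=.
    split; [by do !apply: same_set|by []|].
    apply: (heap_regs (s := set_cell s1 (aC + i) (cur + 1))); [|by do !apply: same_set|by []].
    apply: heap_ext (heap_set_c (cur + 1) iN hp1) _ => u un; split=> //.
    rewrite /set_at ltnS leq_eqVlt; case: (eqVneq u i) => [->|//] /=.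
    by rewrite c0 addn1.
  + rstep E; split; first by rewrite /= /update /=.
    split; [by do !apply: same_set|by []|].
    apply: (heap_regs (s := s1)); [|by do !apply: same_set|by []].
    apply: heap_ext hp1 _ => u un; split=> //.
    by rewrite ltnS leq_eqVlt; case: (eqVneq u i) => [->|//] /=; rewrite (negPf c0) ltnn.
- move=> s1 [ss1 _ hp1]; apply: fin => //.
  by apply: heap_ext hp1 _ => u un; rewrite un.
- by rewrite /=; lia.
Qed.

Definition round_time : nat :=
  n * (R.+1 * 500 + 620) + n * (m * (R.+1 * 260 + 410) + 30) +
  m * (R.+1 * 240 + 410) + n * 120 + 200.

Lemma round_runs s X D c ok cur (Q : state -> Prop) : cur <= R.+1 ->
  (forall v, v < n -> c v <= cur) -> heap s X D c ok -> regs s 11 = cur ->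
  (forall s' ok', heap s' (base c) (run c) (demote cur c) ok' -> regs s' 11 = cur ->
     (exists2 v, v < n & (c v == cur) && ~~ supported c v) -> Q s') ->
  (forall s' ok', heap s' (base c) (run c) (promote cur c) ok' -> regs s' 11 = cur.+1 ->
     (forall v, v < n -> c v = cur -> supported c v) -> Q s') ->
  runs W round s round_time Q.
Proof.
move=> curR cc hp r11 fin1 fin2; rewrite /round.
have bc : bounded c by move=> v vn; exact: leq_trans (cc v vn) curR.
apply: (@runs_seq_k W W_gt0 (n * (R.+1 * 500 + 620) + 20)); first by rewrite /round_time; lia.
apply: (init_loop_runs bc hp) => // s1 ss1 hp1.
set B := n * (m * (R.+1 * 260 + 410) + 30).
set C := m * (R.+1 * 240 + 410).
apply: (@runs_le _ (B + C + n * 120 + 170)); first by rewrite /round_time -/B -/C; lia.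
apply: (@runs_seq_k W W_gt0 (B + 20)); first by lia.
apply: (bellman_loop_runs (base_validl bc) hp1) => // s2 ss2 hp2.
apply: (@runs_le _ (C + n * 120 + 140)); first by lia.
apply: (@runs_seq_k W W_gt0 (C + 20)); first by lia.
apply: (check_loop_runs bc hp2) => // s3 ss3 hp3.
have r113 : regs s3 11 = cur by rewrite ss3 // ss2 // ss1.
apply: (@runs_le _ (n * 120 + 110)); first by lia.
have G3 := heap_g hp3; rstep G3.
apply: (@runs_seq_k W W_gt0 (n * 60 + 20)); first by rewrite /=; lia.
set s4 := set_reg _ _ _.
have ss4 : same_regs 12 s3 s4 by do !apply: same_set.
have hp4 : heap s4 (base c) (run c) c (fun v => nat_of_bool (supported c v)).
  by apply: heap_regs hp3 _ _ => //; do !apply: same_set.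
have r114 : regs s4 11 = cur by rewrite ss4.
have r124 : regs s4 12 = 0 by [].
clearbody s4.
apply: (demote_loop_runs (leqW curR) hp4 r114 r124) => // s5 ss5 f5 hp5.
have G5 := heap_g hp5; have r115 : regs s5 11 = cur by rewrite ss5.
have failE u : (nat_of_bool (supported c u) == 0) = ~~ supported c u by case: (supported c u).
apply: (@runs_le _ (n * 60 + 70)); first by rewrite /=; lia.
rstep (f5, G5).
  rstep G5; apply: (fin1 _ _ _ r115).
    by apply: heap_ext hp5 _ => u un; split=> //; rewrite /demote failE.
  case/hasP: c0 => v; rewrite mem_iota add0n /= failE => vn fv.
  by exists v.
have nf v : v < n -> c v = cur -> supported c v.
  move=> vn cv; apply: contraNT c0 => ns; apply/hasP; exists v.
    by rewrite mem_iota add0n.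
  by rewrite cv eqxx failE ns.
apply: (@runs_seq_k W W_gt0 (n * 60 + 20)); first by rewrite /=; lia.
have hp5' : heap s5 (base c) (run c) c (fun v => nat_of_bool (supported c v)).
  apply: heap_ext hp5 _ => u un; split=> //; rewrite failE.
  by case: eqP => //= cu; rewrite (nf u un cu).
apply: (promote_loop_runs (leqW curR) hp5' r115) => // s6 ss6 hp6.
have r116 : regs s6 11 = cur by rewrite ss6.
have G6 := heap_g hp6.
apply: (@runs_le _ 10); first by rewrite /=; lia.
rstep (r116, G6).
apply: (fin2 _ (fun v => nat_of_bool (supported c v))) => //.
  by apply: heap_regs hp6 _ _ => //; do !apply: same_set.
by rewrite /= /update /= addn1.
Qed.

(** Without nodes [d] may be 0, while the theory of [inv] assumes [0 < d]; hence the guard. *)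
Definition invn (cur : nat) (c : nat -> nat) : Prop := 0 < n -> inv cur c.

Definition n_active (cur : nat) (c : nat -> nat) : nat :=
  count (fun v => c v == cur) (iota 0 n).

Lemma inv_le cur c : invn cur c -> forall v, v < n -> c v <= cur.
Proof. by move=> h v vn; case: (h (leq_ltn_trans (leq0n v) vn)) => + _ _; apply. Qed.

(** A round with a demotion loses an active node, and promotion moves the active nodes together. So
    [R + 2 - cur + n_active] drops in every round, which bounds their number by [n + R + 2]. *)
Lemma n_active_demote cur c v : invn cur c -> cur <= R.+1 -> v < n ->
  (c v == cur) && ~~ supported c v -> n_active cur (demote cur c) < n_active cur c.
Proof.
move=> ic curR vn fv; have n0 := leq_ltn_trans (leq0n v) vn; have [cc sc _] := ic n0.
(* At bound 0 a demotion would change nothing, but there every node is supported. *)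
have cur0 : 0 < cur.
  rewrite lt0n; apply/eqP => E; case/andP: fv => _ /negP; apply.
  have bc' : bounded (fun v => minn (c v) cur.-1) by move=> u un; have := cc u un; lia.
  apply: (stable_ext (d_gt0 n0) acts_lt pr_le_d mu_valid bc' _ sc vn) => u un /=.
  by have := cc u un; lia.
rewrite /n_active -!size_filter.
have vin : v \in filter (fun v => c v == cur) (iota 0 n).
  by case/andP: fv => cv _; rewrite mem_filter cv mem_iota add0n.
have sub : {subset filter (fun v => demote cur c v == cur) (iota 0 n) <=
            rem v (filter (fun v => c v == cur) (iota 0 n))}.
  move=> u; rewrite mem_rem_uniq ?filter_uniq ?iota_uniq // !mem_filter inE /demote.
  case: ifP => [_|nf /andP[cu ui]]; first by rewrite ltn_eqF ?ltn_predL.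
  by rewrite !mem_filter cu ui !andbT; apply/eqP => E; rewrite E fv in nf.
have b0 : 0 < size (filter (fun v => c v == cur) (iota 0 n)).
  by case: (filter _ _) vin.
have := uniq_leq_size (filter_uniq _ (iota_uniq 0 n)) sub.
by rewrite size_rem // => h; rewrite -(prednK b0) ltnS.
Qed.

Lemma n_active_promote cur c : (forall v, v < n -> c v <= cur) ->
  n_active cur.+1 (promote cur c) = n_active cur c.
Proof.
move=> cc; apply: eq_in_count => v; rewrite mem_iota add0n /= => vn.
rewrite /promote; case: (eqVneq (c v) cur) => [_|_]; first by rewrite eqxx.
by apply: ltn_eqF; rewrite ltnS cc.
Qed.

Lemma main_loop_runs s X D ok t (Q : state -> Prop) :
  heap s X D (fun=> 0) ok ->
  (forall s' X' D' c' ok', heap s' X' D' c' ok' -> validl D' ->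
     (0 < n -> [/\ lel n mu D', feasv d R n acts pr D' &
       forall nu, validl nu -> lel n mu nu -> feasv d R n acts pr nu -> lel n D' nu]) ->
     Q s') ->
  (n + R.+2) * (round_time + 10) + 30 <= t ->
  runs W main_loop s t Q.
Proof.
move=> hp fin tt; rewrite /main_loop.
have G := heap_g hp; have rt : 30 + (n + R.+2) * (round_time + 10) <= t by lia.
apply: runs_seq_reg => //=; first by lia.
(* The last clause holds because the final promotion alters no bound capped at [R + 1]: the labels
   of the last round are already those of [inv_final]. *)
pose J k s1 := exists cur c X D ok, [/\ heap s1 X D c ok, regs s1 11 = cur, cur <= R.+2,
  invn cur c & (k = R.+2 - cur + n_active cur c /\
  (cur = R.+2 -> forall v, v < n -> D v = run (fun v => minn (c v) R.+1) v))].
apply: (@runs_while W W_gt0 J _ _ (R.+2 - 0 + n_active 0 (fun=> 0)) round_time).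
- exists 0, (fun=> 0), X, D, ok; split=> //.
    by apply: heap_regs hp _ _ => //; do !apply: same_set.
  by move=> n0; apply: (inv_init (d_gt0 n0) acts_lt acts_succ pr_le_d mu_valid).
- move=> k s1 [cur [c1 [X1 [D1 [ok1 [/heap_g G1 _ _ _ _]]]]]] /=; rewrite G1.
  by repeat split; lia.
- move=> k s1 [cur [c1 [X1 [D1 [ok1 [hp1 r11 curR ic [kE _]]]]]]] /=.
  have G1 := heap_g hp1; rewrite G1 r11 eqb0 negbK addn2 ltnS => curR1.
  have k0 : 0 < k by lia.
  split=> //; apply: (round_runs curR1 (inv_le ic) hp1 r11).
  + move=> s2 ok2 hp2 r112 [v vn fv].
    exists (R.+2 - cur + n_active cur (demote cur c1)).
      by rewrite kE ltn_add2l; exact: n_active_demote ic curR1 vn fv.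
    exists cur, (demote cur c1), (base c1), (run c1), ok2; split=> //; last by split=> //; lia.
    by move=> n0; exact: (inv_demote (d_gt0 n0) acts_lt pr_le_d mu_valid (ic n0) curR1).
  + move=> s2 ok2 hp2 r112 sup.
    exists (R.+2 - cur.+1 + n_active cur.+1 (promote cur c1)).
      by rewrite kE n_active_promote; [lia|exact: inv_le ic].
    exists cur.+1, (promote cur c1), (base c1), (run c1), ok2; split=> //.
      by move=> n0; exact: (inv_promote (d_gt0 n0) acts_lt pr_le_d mu_valid (ic n0) curR1 sup).
    split=> // ecur v vn; have n0 := leq_ltn_trans (leq0n v) vn.
    have Ec : cur = R.+1 by lia.
    clear r11; subst cur.
    have E u : u < n -> minn (promote R.+1 c1 u) R.+1 = c1 u.
      by move=> un; have := inv_le ic un; rewrite /promote; case: eqP; lia.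
    have bm : bounded (fun v => minn (promote R.+1 c1 v) R.+1) by move=> u un; exact: geq_minr.
    have bc1 : bounded c1 by exact: inv_le ic.
    apply: vle_anti.
      apply: (run_anti (d_gt0 n0) acts_lt pr_le_d mu_valid bc1) => // u un.
      by rewrite E.
    apply: (run_anti (d_gt0 n0) acts_lt pr_le_d mu_valid bm) => // u un.
    by rewrite E.
- move=> k s1 [cur [c1 [X1 [D1 [ok1 [hp1 r11 curR ic [kE DE]]]]]]] /=.
  have G1 := heap_g hp1; rewrite G1 r11 => /eqP; rewrite eqb0 -leqNgt addn2 => curR1.
  have Ec : cur = R.+2 by apply/eqP; rewrite eqn_leq curR.
  clear r11; subst cur; have {}DE := DE erefl.
  apply: (fin _ _ _ _ _ hp1).
    move=> v vn; rewrite DE //; have n0 := leq_ltn_trans (leq0n v) vn.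
    by have [h _ _ _] := inv_final (d_gt0 n0) acts_lt pr_le_d mu_valid mu_lift (ic n0); exact: h.
  move=> n0; have [h1 h2 h3 h4] := inv_final (d_gt0 n0) acts_lt pr_le_d mu_valid mu_lift (ic n0).
  split.
  + by move=> v vn; rewrite DE //; exact: h2.
  + move=> v vn; rewrite DE //; case: (h3 v vn) => [|[w vw nv]]; [by left|right].
    by exists w => //; rewrite DE //; case/andP: (acts_lt vw).
  + by move=> nu vnu mnu fnu v vn; rewrite DE //; exact: h4.
- have an : n_active 0 (fun=> 0) <= n by rewrite /n_active (leq_trans (count_size _ _)) ?size_iota.
  have : (R.+2 - 0 + n_active 0 (fun=> 0)) * (round_time + 10) <= (n + R.+2) * (round_time + 10).
    by rewrite leq_mul2r; lia.
  have le1 : (R.+2 - 0 + n_active 0 (fun=> 0)) * (round_time + (cost ($11 < $3 + #2)%X)).+1 <=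
      (R.+2 - 0 + n_active 0 (fun=> 0)) * (round_time + 10) by rewrite leq_mul2l /=; lia.
  by move=> le2; rewrite /= in le1 *; lia.
Qed.

End Heap.

Definition setup_cmd : cmd := (
  0 :=r mem[#0] ;; 1 :=r mem[#1] ;; 2 :=r mem[#2] ;; 3 :=r #0 ;; 11 :=r #1 ;;
  While ($11 * #2 < $0 + #1)%X (11 :=r $11 * #2 ;; 3 :=r $3 + #1) ;;
  10 :=r $3 + #1 ;;
  4 :=r #3 + #3 * $0 + #2 * $1 + #2 * ($0 * $10) ;;
  5 :=r $4 + $0 * $10 ;; 6 :=r $5 + $0 * $10 ;; 7 :=r $6 + $0 * $10 ;;
  8 :=r $7 + $0 ;; 9 :=r $8 + $0)%C.

(** For a bit [b] of component [i], [d + 2 b i - i] is [d + i] or [d - i]; adding first keeps the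
    truncated subtraction exact. *)
Definition parse_entry : cmd := (
  If ($18 == #0)%X ([row $4 $15 + $19] :=m $2 * #2 + #1)
    (If ($19 + #1 < $18)%X
       ([row $4 $15 + $19] :=m $2 + #2 * (mem[$17 + #1] * mem[$17]) - mem[$17] ;;
        17 :=r $17 + #2)
       ([row $4 $15 + $19] :=m $2)))%C.

Definition parse_label : cmd := (
  18 :=r mem[$17] ;; 17 :=r $17 + #1 ;; For 19 ($10)%X parse_entry)%C.

Definition parse_cmd : cmd := (
  17 :=r #3 + #3 * $0 + #2 * $1 ;; For 15 ($0)%X parse_label)%C.

Definition output_entry : cmd := (
  21 :=r mem[row $6 $15 + $19] ;;
  If ($21 == $2)%X Skip
    ([$17] :=m idxE $21 ;; [$17 + #1] :=m ($2 < $21) ;;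
     17 :=r $17 + #2 ;; 20 :=r $20 + #1))%C.

(** The length is known only after the tokens have been read, so its cell is reserved in register 18
    and filled last. *)
Definition output_label : cmd := (
  If (mem[row $6 $15] == $2 * #2 + #1)%X ([$17] :=m #0 ;; 17 :=r $17 + #1)
    (18 :=r $17 ;; 17 :=r $17 + #1 ;; 20 :=r #0 ;;
     For 19 ($10)%X output_entry ;; [$18] :=m $20 + #1))%C.

Definition output_cmd : cmd := (17 :=r #0 ;; For 15 ($0)%X output_label)%C.

Lemma arr_cat s a x y : arr s a (x ++ y) <-> arr s a x /\ arr s (a + size x) y.
Proof.
split=> [h|[h1 h2] k].
  split=> k kx; first by rewrite h ?size_cat ?ltn_addr // nth_cat kx.
  rewrite -addnA h ?size_cat ?ltn_add2l // nth_cat ifN; last by rewrite -leqNgt leq_addr.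
  by rewrite addKn.
rewrite size_cat nth_cat => kx; case: ltnP => kl; first exact: h1.
by rewrite -{1}(subnKC kl) addnA h2 //; lia.
Qed.

Section Setup.
Variables W n m d R aM aX aD aC aO aT : nat.
Hypothesis R_eq : R = trunc_log 2 n.
Hypothesis eM : aM = 3 + 3 * n + 2 * m + 2 * (n * R.+1).
Hypothesis eX : aX = aM + n * R.+1.
Hypothesis eD : aD = aX + n * R.+1.
Hypothesis eC : aC = aD + n * R.+1.
Hypothesis eO : aO = aC + n.
Hypothesis eT : aT = aO + n.
Hypothesis leW : aT + 8 * d + 4 * R + 100 <= W.

Let W_gt0 : 0 < W.
Proof. by move: leW; clear; lia. Qed.

(** [R] is found by doubling. The table for [mu] starts past the longest possible input, which has
    at most [2 (R + 1)] numbers per label, so parsing overwrites nothing unread. *)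
Lemma setup_runs s t (Q : state -> Prop) : arr s 0 [:: n; m; d] ->
  (forall s', cells s' = cells s ->
     (forall x, x < 11 -> regs s' x = nth 0 (globals n m d R aM aX aD aC aO aT) x) -> Q s') ->
  R * 30 + 150 <= t ->
  runs W setup_cmd s t Q.
Proof.
move=> a3 fin tt.
have c0 : cells s 0 = n by exact: (a3 0).
have c1 : cells s 1 = m by exact: (a3 1).
have c2 : cells s 2 = d by exact: (a3 2).
have n3 : 3 * n + 100 <= W by move: leW eM eX eD eC eO eT; clear; lia.
have m2 : 2 * m <= W by move: leW eM eX eD eC eO eT; clear; lia.
have RW : R.+1 <= W by move: leW; clear; lia.
have nR : 5 * (n * R.+1) + 3 + 3 * n + 2 * m + 2 * n <= W.
  by move: leW eM eX eD eC eO eT; clear; lia.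
have w0 := W_gt0.
rewrite /setup_cmd.
rstep c0; rstep (c0, c1); rstep (c0, c1, c2); do 2 rstep (c0, c1, c2).
set s1 := set_reg _ _ _.
pose J k s' := exists r, [/\ r <= R, k = R - r, cells s' = cells s &
  [/\ regs s' 0 = n, regs s' 1 = m, regs s' 2 = d, regs s' 3 = r & regs s' 11 = 2 ^ r]].
have pR r : r < R -> 2 ^ r * 2 <= n.
  move=> rR; case: (posnP n) => [n0|n0]; first by move: rR; rewrite R_eq n0.
  apply: leq_trans (@trunc_logP 2 n isT n0).
  by rewrite -R_eq mulnC -expnS leq_exp2l.
have pW r : r <= R -> 2 ^ r * 2 <= W.
  case: r => [|r] rR; first by lia.
  by have := pR _ rR; rewrite expnS; lia.
apply: (@runs_seq W W_gt0 _ _ _ (R * 20 + 10) _ (fun s' => J 0 s')).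
  apply: (@runs_while W W_gt0 J _ _ R 12).
  - by exists 0; rewrite subn0; split.
  - move=> k s2 [r [rR _ _ [e0 e1 e2 e3 e11]]] /=; rewrite e11 e0; have := pW r rR.
    by move=> ?; repeat split; lia.
  - move=> k s2 [r [rR kE cs [e0 e1 e2 e3 e11]]] /=; rewrite e11 e0 eqb0 negbK addn1 ltnS => le.
    have rR1 : r < R.
      by rewrite R_eq; apply: trunc_log_max => //; rewrite expnS mulnC.
    have := pW r rR => pr; split; first lia.
    do 2 rstep (e3, e11); exists k.-1; first lia.
    exists r.+1; split=> //; first lia.
    by split=> //; rewrite /= /update /= ?addn1 // expnS mulnC.
  - move=> k s2 [r [rR kE cs [e0 e1 e2 e3 e11]]] /= h; exists r; split=> //.
    move: h; rewrite e11 e0 => /eqP; rewrite eqb0 -leqNgt addn1 => lt.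
    by case: (ltnP r R) => rR'; [have := pR r rR'; lia|lia].
  - by rewrite /=; lia.
- by rewrite /=; lia.
move=> s2 [r [rR kE cs [e0 e1 e2 e3 e11]]].
have {}e3 : regs s2 3 = R by lia.
apply: (@runs_le _ 110); first by rewrite /=; lia.
have nR1 : n * (R + 1) = n * R.+1 by rewrite addn1.
do 7 rstep (e0, e1, e2, e3, nR1).
apply: fin => // x; do 11 (case: x => [|x]; first by
  rewrite /globals /= /update /= ?addn1 ?e0 ?e1 ?e2 ?e3 //; lia).
by [].
Qed.

End Setup.

(** Labels become plain lists of indexed bits, which keeps the dependent type of leaves out of the
    loops for reading and printing. *)
Definition enc_opt (x : option (seq (nat * bool))) : seq nat :=
  if x is Some l then (size l).+1 :: flatten [seq [:: c.1; nat_of_bool c.2] | c <- l]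
  else [:: 0].

Definition vec_opt (d R : nat) (x : option (seq (nat * bool))) : seq nat :=
  if x is Some l then pad d R.+1 [seq tok d c.1 c.2 | c <- l] else vtop d R.

Definition ok_opt (d R : nat) (x : option (seq (nat * bool))) : bool :=
  if x is Some l then (size l <= R) && all (fun c => 0 < c.1 <= d) l else true.

Lemma size_pairs (l : seq (nat * bool)) :
  size (flatten [seq [:: c.1; nat_of_bool c.2] | c <- l]) = 2 * size l.
Proof. by elim: l => //= c l ->; lia. Qed.

Lemma nth_pairs (l : seq (nat * bool)) j : j < size l ->
  nth 0 (flatten [seq [:: c.1; nat_of_bool c.2] | c <- l]) (2 * j) = (nth (0, false) l j).1 /\
  nth 0 (flatten [seq [:: c.1; nat_of_bool c.2] | c <- l]) (2 * j).+1 = (nth (0, false) l j).2.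
Proof.
elim: l j => // c l IH [|j] // jl; have [h1 h2] := IH j jl.
have -> : 2 * j.+1 = (2 * j).+2 by lia.
by rewrite /= h1 h2.
Qed.

Lemma size_vec_opt d R x : ok_opt d R x -> size (vec_opt d R x) = R.+1.
Proof.
case: x => [l /andP[lR _]|_]; last by rewrite size_nseq.
by rewrite /vec_opt size_pad // size_map; exact: leqW.
Qed.

Lemma nth_vec_opt d R l j : size l <= R -> j <= R ->
  nth 0 (vec_opt d R (Some l)) j =
  if j < size l then tok d (nth (0, false) l j).1 (nth (0, false) l j).2 else d.
Proof.
move=> lR jR; rewrite /vec_opt /pad nth_cat size_map; case: ltnP => jl.
  by rewrite (nth_map (0, false)).
by rewrite nth_nseq ifT //; lia.
Qed.

Section Parse.
Variables W n m d R aM : nat.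
Hypothesis leM : 3 + 3 * n + 2 * m <= aM.
Hypothesis leW : aM + n * R.+1 + 8 * d + 4 * R + 100 <= W.

Let W_gt0 : 0 < W.
Proof. by move: leW; clear; lia. Qed.

Definition parse_regs (s : state) : Prop :=
  [/\ regs s 0 = n, regs s 1 = m, regs s 2 = d, regs s 4 = aM & regs s 10 = R.+1].

Lemma parse_label_runs s v p x t (Q : state -> Prop) :
  parse_regs s -> regs s 15 = v -> v < n -> regs s 17 = p ->
  ok_opt d R x -> arr s p (enc_opt x) -> p + size (enc_opt x) <= aM ->
  (forall s', same_regs 16 s s' -> regs s' 17 = p + size (enc_opt x) ->
     arr s' (aM + v * R.+1) (vec_opt d R x) ->
     same_cells (aM + v * R.+1) R.+1 s s' -> Q s') ->
  R.+1 * 80 + 50 <= t ->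
  runs W parse_label s t Q.
Proof.
move=> [g0 g1 g2 g4 g10] r15 vn r17 ox ax px fin tt.
have rl : v * R.+1 + R.+1 <= n * R.+1 by rewrite addnC -mulSn leq_mul2r vn orbT.
have ch : cells s p = nth 0 (enc_opt x) 0.
  by have := ax 0; rewrite addn0; apply; case: (x) => [l|] /=.
set hd := nth 0 (enc_opt x) 0 in ch.
set len := if x is Some l then size l else 0.
have pl : p + 1 + 2 * len = p + size (enc_opt x).
  by rewrite /len; case: (x) => [l|] /=; rewrite ?size_pairs; lia.
have w0 := W_gt0; rewrite /parse_label /row.
do 2 rstep (r17, ch).
set s1 := set_reg _ _ _.
have ss1 : same_regs 16 s s1 by do !apply: same_set.
have cs1 : cells s1 = cells s by [].
have h17 : regs s1 17 = p + 1 by [].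
have h18 : regs s1 18 = hd by [].
clearbody s1; set rw := aM + v * R.+1.
(* The read pointer stops at the end of the label while padding is still being written, hence the
   minimum. *)
pose I j s2 := [/\ same_regs 16 s1 s2, regs s2 19 = j, regs s2 18 = hd,
  regs s2 17 = p + 1 + 2 * minn j len &
  forall b, cells s2 b = if rw <= b < rw + j then nth 0 (vec_opt d R x) (b - rw) else cells s1 b].
apply: (@runs_for W W_gt0 I _ _ _ R.+1 60).
- by move: leW; clear; lia.
- by move=> j s2 [h _ _ _ _]; rewrite /= h // ss1 // g10.
- by move=> j s2 [].
- split=> //; first by do !apply: same_set.
  + by rewrite /= /update /= h17 min0n muln0 addn0.
  + by move=> b; rewrite addn0 /=; case: ifP => //; lia.
- move=> j s2 jR [h q19 q18 q17 qc].
  have e2 : regs s2 2 = d by rewrite h // ss1.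
  have e4 : regs s2 4 = aM by rewrite h // ss1.
  have e15 : regs s2 15 = v by rewrite h // ss1.
  have low b : b < aM -> cells s2 b = cells s b.
    by move=> bM; rewrite qc cs1 ifF //; rewrite /rw; lia.
  have post s3 : (forall y : nat, y != 17 -> regs s3 y = regs s2 y) ->
      regs s3 17 = p + 1 + 2 * minn j.+1 len ->
      (forall b, cells s3 b = update (cells s2) (rw + j) (nth 0 (vec_opt d R x) j) b) ->
      I j.+1 (set_reg s3 19 j.+1).
    move=> hr hr17 hc; split=> //.
    + by move=> y y16; rewrite /= /update ltn_eqF ?hr ?h //; lia.
    + by rewrite /= /update /= hr.
    + move=> b /=; rewrite hc /update qc; case: eqP => [->|ne].
        by rewrite leq_addr addnS ltnS leqnn /= addKn.
      by congr (if _ then _ else _); lia.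
  have jR' : j <= R by exact: jR.
  have rwW : rw + R.+1 <= W by move: rl leW; rewrite /rw; clear; lia.
  have rwE : aM + v * R.+1 = rw by [].
  have e10 : regs s2 10 = R.+1 by rewrite h // ss1.
  rewrite /parse_entry /row.
  case E0: x => [l|]; last first.
    have hE : hd = 0 by rewrite /hd E0.
    have lE : len = 0 by rewrite /len E0.
    rewrite E0 hE lE in q18 q17 post.
    rstep (q18, q19, e2, e4, e15, e10, rwE).
    + rstep (q18, q19, e2, e4, e15, e10, rwE).
      split=> //; apply: post => // b; congr (update _ _ _ _).
      by rewrite nth_nseq jR; lia.
    + by [].
  have hE : hd = (size l).+1 by rewrite /hd E0.
  have lE : len = size l by rewrite /len E0.
  rewrite E0 hE lE in q18 q17 post ox ax px pl.
  have [lR la] := andP ox.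
  rstep (q18, q19, e2, e4, e15, e10, rwE).
    by [].
  rstep (q18, q19, e2, e4, e15, e10, rwE).
  + have jl : j < size l by move: c0; lia.
    have q17' : regs s2 17 = p + 1 + 2 * j by rewrite q17; congr (_ + 2 * _); lia.
    have [n1 n2] := nth_pairs jl.
    have sz := size_pairs l.
    have c1 : cells s2 (p + 1 + 2 * j) = (nth (0, false) l j).1.
      rewrite low; last by move: px; rewrite /= sz; lia.
      transitivity (cells s (p + (2 * j).+1)); first by congr (cells s _); lia.
      by rewrite ax /= ?sz ?n1 //; lia.
    have c2 : cells s2 (p + 1 + 2 * j + 1) = (nth (0, false) l j).2.
      rewrite low; last by move: px; rewrite /= sz; lia.
      transitivity (cells s (p + (2 * j).+2)); first by congr (cells s _); lia.
      by rewrite ax /= ?sz ?n2 //; lia.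
    have /andP[i0 id] := all_nthP (0, false) la j jl.
    have bE : (nth (0, false) l j).2 * (nth (0, false) l j).1 <= d by case: (_.2); lia.
    have b1 := leq_b1 (nth (0, false) l j).2.
    have dW : 8 * d <= W by move: leW; clear; lia.
    have aMW : aM + 100 <= W by move: leW; clear; lia.
    have pj : p + 1 + 2 * j + 2 <= aM by move: px; rewrite /= sz; lia.
    have E := (q17', q18, q19, e2, e4, e15, e10, rwE, c1, c2).
    rstep E.
    have rwM : aM <= rw by rewrite /rw leq_addr.
    rstep E.
    split=> //; apply: post.
    + by move=> y; rewrite /= /update => /negPf->.
    + by rewrite /= /update /=; lia.
    + move=> b; rewrite /=; congr (update _ _ _ _).
      rewrite (nth_vec_opt d lR jR') jl /tok; case: (_.2) => /=; lia.
  + rstep (q18, q19, e2, e4, e15, e10, rwE).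
    have jl : size l <= j by move: c0; lia.
    split=> //; apply: post => //.
    + by rewrite q17; congr (_ + 2 * _); lia.
    + by move=> b; rewrite (nth_vec_opt d lR jR') ltnNge jl.
- move=> s2 [h _ _ q17 qc]; apply: fin.
  + by move=> y y16; rewrite h // ss1.
  + rewrite q17 -pl; congr (_ + 2 * _); rewrite /len; case: (x) ox => [l /andP[lR _]|_]; lia.
  + move=> k; rewrite size_vec_opt // => kR; rewrite qc leq_addr ltn_add2l kR /=.
    by rewrite addKn.
  + by move=> b bb; rewrite qc ifF ?cs1 //; rewrite /rw; lia.
- by rewrite /=; lia.
Qed.

End Parse.

Definition enc_opts (xs : seq (option (seq (nat * bool)))) : seq nat :=
  flatten (map enc_opt xs).

Lemma size_enc_opt d R x : ok_opt d R x -> size (enc_opt x) <= 2 * R.+1.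
Proof. by case: x => [l /andP[lR _]|] //=; rewrite size_pairs; lia. Qed.

Lemma size_enc_opts d R xs : all (ok_opt d R) xs ->
  size (enc_opts xs) <= 2 * (size xs * R.+1).
Proof.
elim: xs => // x xs IH /= /andP[ox oxs]; rewrite /enc_opts /= size_cat.
have := leq_add (size_enc_opt ox) (IH oxs); rewrite /enc_opts mulSn; lia.
Qed.

Lemma enc_opts_split xs v : v < size xs ->
  enc_opts xs = enc_opts (take v xs) ++ enc_opt (nth None xs v) ++ enc_opts (drop v.+1 xs).
Proof.
by move=> vs; rewrite -{1}(cat_take_drop v xs) (drop_nth None vs) /enc_opts map_cat flatten_cat.
Qed.

Lemma enc_opts_take xs v : v < size xs ->
  enc_opts (take v.+1 xs) = enc_opts (take v xs) ++ enc_opt (nth None xs v).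
Proof.
by move=> vs; rewrite (take_nth None vs) -cats1 /enc_opts map_cat flatten_cat /= cats0.
Qed.

Section Parse.
Variables W n m d R aM : nat.
Hypothesis leM : 3 + 3 * n + 2 * m + 2 * (n * R.+1) <= aM.
Hypothesis leW : aM + n * R.+1 + 8 * d + 4 * R + 100 <= W.
Hypothesis leN : n < W.

Let W_gt0 : 0 < W.
Proof. by move: leW; clear; lia. Qed.

Lemma parse_runs s xs t (Q : state -> Prop) :
  parse_regs n m d R aM s -> size xs = n -> all (ok_opt d R) xs ->
  arr s (3 + 3 * n + 2 * m) (enc_opts xs) ->
  (forall s', same_regs 15 s s' -> arrs n R s' aM (fun v => vec_opt d R (nth None xs v)) ->
     same_cells aM (n * R.+1) s s' -> Q s') ->
  n * (R.+1 * 80 + 70) + 50 <= t ->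
  runs W parse_cmd s t Q.
Proof.
move=> [g0 g1 g2 g4 g10] sx ox ax fin tt.
have leM' : 3 + 3 * n + 2 * m <= aM by move: leM; clear; lia.
have sz : size (enc_opts xs) <= 2 * (n * R.+1) by rewrite -sx; exact: size_enc_opts ox.
have w0 := W_gt0; rewrite /parse_cmd.
have p0W : 3 + 3 * n + 2 * m + 100 <= W by move: leM leW; clear; lia.
rstep (g0, g1, g2).
pose p v := 3 + 3 * n + 2 * m + size (enc_opts (take v xs)).
pose I v s2 := [/\ same_regs 15 s s2, regs s2 15 = v, regs s2 17 = p v,
  arrs v R s2 aM (fun v => vec_opt d R (nth None xs v)) & same_cells aM (v * R.+1) s s2].
apply: (@runs_for W W_gt0 I _ _ _ n (R.+1 * 80 + 50)) => //.
- by move=> v s2 [h _ _ _ _]; rewrite /= h // g0.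
- by move=> v s2 [].
- split=> //; first by do !apply: same_set.
  by rewrite /= /update /= /p take0 addn0.
- move=> v s2 vn [h r15 r17 av sc]; have vx : v < size xs by rewrite sx.
  have := ax; rewrite {1}(enc_opts_split vx) => /arr_cat[_ /arr_cat[axv _]].
  have se := size_enc_opt (allP ox _ (mem_nth None vx)).
  have pv : p v + size (enc_opt (nth None xs v)) = p v.+1.
    by rewrite /p (enc_opts_take vx) size_cat addnA.
  have pM : p v.+1 <= aM.
    have : size (enc_opts (take v.+1 xs)) <= size (enc_opts xs).
      by rewrite -{2}(cat_take_drop v.+1 xs) /enc_opts map_cat flatten_cat size_cat leq_addr.
    by rewrite /p; move: sz leM; clear; lia.
  apply: (@parse_label_runs W n m d R aM leM' leW _ v (p v) (nth None xs v)) => //.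
  + by split; rewrite h.
  + exact: (allP ox) (mem_nth None vx).
  + move=> k kx; rewrite -axv // sc; first by rewrite /p.
    by left; move: kx pv pM; clear; lia.
  + by rewrite pv.
  move=> s3 h3 q17 a3 sc3; split; first by rewrite h3.
  split=> //.
  + apply: same_set => //; apply: same_regs_trans h _; exact: same_regs_le h3.
  + by rewrite -pv -q17.
  + move=> u; rewrite ltnS leq_eqVlt => /orP[/eqP->|uv].
      by split=> //; rewrite (@size_vec_opt d R) //; exact: (allP ox) (mem_nth None vx).
    have [su au] := av u uv; split=> // k ku.
    rewrite -au //= sc3 //; left.
    by have := row_le R uv; rewrite su in ku; move: ku; clear; move: (u * _) (v * _); lia.
  + move=> b bb; rewrite /= sc3; last by move: bb; rewrite mulSn; clear; lia.
    by rewrite sc //; move: bb; rewrite mulSn; clear; lia.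
- by move=> s2 [h _ _ av sc]; exact: fin.
- by move: tt; rewrite /=; lia.
Qed.

End Parse.

Section Output.
Variables W n d R aX aD : nat.
Hypothesis leD : 2 * (n * R.+1) <= aD.
Hypothesis leW : aD + n * R.+1 + 8 * d + 4 * R + 100 <= W.
Hypothesis leN : n < W.

Let W_gt0 : 0 < W.
Proof. by move: leW; clear; lia. Qed.

Definition output_regs (s : state) : Prop :=
  [/\ regs s 0 = n, regs s 2 = d, regs s 6 = aD & regs s 10 = R.+1].

Lemma output_label_runs s v q x t (Q : state -> Prop) :
  output_regs s -> regs s 15 = v -> v < n -> regs s 17 = q ->
  ok_opt d R x -> arr s (aD + v * R.+1) (vec_opt d R x) -> q + size (enc_opt x) <= aD ->
  (forall s', same_regs 16 s s' -> regs s' 17 = q + size (enc_opt x) ->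
     arr s' q (enc_opt x) -> same_cells q (size (enc_opt x)) s s' -> Q s') ->
  R.+1 * 80 + 80 <= t ->
  runs W output_label s t Q.
Proof.
move=> [g0 g2 g6 g10] r15 vn r17 ox ax qx fin tt.
have rl := row_le R vn; set rw := aD + v * R.+1 in ax *.
have rwE : aD + v * R.+1 = rw by [].
have rwD : aD <= rw by rewrite /rw leq_addr.
have rwW : rw + R.+1 + 8 * d + 90 <= W by move: rl leW; rewrite /rw; clear; lia.
have w0 := W_gt0; rewrite /output_label /row.
have c0 : cells s rw = nth 0 (vec_opt d R x) 0.
  by rewrite -ax ?addn0 // (size_vec_opt ox).
case: x ox ax qx fin c0 => [l|] ox ax qx fin c0; last first.
  rewrite /= in c0 qx.
  rstep (g0, g2, g6, g10, r15, rwE, c0).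
  - do 2 rstep (g0, g2, g6, g10, r15, r17, rwE).
    apply: fin => //.
    + by do !apply: same_set.
    + by case=> // _; rewrite /= /update /= addn0 ?r17 ?eqxx.
    + move=> b bb; rewrite /= /update ?r17 ifN //.
      by move: bb; rewrite /=; clear; lia.
  - by move: c; lia.
have [lR la] := andP ox.
rewrite (nth_vec_opt d lR) // in c0.
have sz := size_pairs l; set ps := flatten _ in sz.
have ql : q + (2 * size l).+1 <= aD by move: qx; rewrite /= -/ps sz.
have id j : j < size l -> 0 < (nth (0, false) l j).1 <= d.
  by move=> jl; exact: all_nthP (0, false) la j jl.
(* The first token of a leaf cannot be mistaken for the token [2d + 1] of top. *)
have c0d : cells s rw <= 2 * d.
  rewrite c0; case: ifP => // [l0|]; last by clear; lia.
  by have := id 0 l0; rewrite /tok; case: (_.2); lia.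
rstep (g0, g2, g6, g10, r15, rwE); first by move: c c0d; clear; lia.
rstep r17. rstep r17. rstep r17.
set s1 := set_reg _ _ _.
have ss1 : same_regs 16 s s1 by do !apply: same_set.
have cs1 : cells s1 = cells s by [].
have q17 : regs s1 17 = q + 1 by rewrite /s1 /= /update /= ?r17.
have q18 : regs s1 18 = q by rewrite /s1 /= /update /= ?r17.
have q20 : regs s1 20 = 0 by [].
clearbody s1.
pose I j s2 := [/\ same_regs 16 s1 s2, regs s2 19 = j, regs s2 18 = q /\ regs s2 20 = minn j (size l),
  regs s2 17 = q + 1 + 2 * minn j (size l) &
  forall b, cells s2 b =
    if q + 1 <= b < q + 1 + 2 * minn j (size l) then nth 0 ps (b - (q + 1)) else cells s b].
apply: (@runs_seq W W_gt0 _ _ _ (R.+1 * 70 + 10) _ (I R.+1)).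
- apply: (@runs_for W W_gt0 I _ _ _ R.+1 60) => //.
  + by move: leW; clear; lia.
  + by move=> j s2 [h _ _ _ _]; rewrite /= h // ss1 // g10.
  + by move=> j s2 [].
  + split=> //; first by do !apply: same_set.
    * by rewrite /= /update /= min0n.
    * by rewrite /= /update /= min0n muln0 addn0 q17.
    * by move=> b; rewrite min0n muln0 addn0 /= cs1; case: ifP => //; lia.
  + move=> j s2 jR [h r19 [r18 r20] q17' qc].
    have e2 : regs s2 2 = d by rewrite h // ss1.
    have e6 : regs s2 6 = aD by rewrite h // ss1.
    have e10 : regs s2 10 = R.+1 by rewrite h // ss1.
    have e15 : regs s2 15 = v by rewrite h // ss1.
    have cj : cells s2 (rw + j) = nth 0 (vec_opt d R (Some l)) j.
      rewrite qc ifF ?ax ?(size_vec_opt ox) //.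
      by move: rwD ql; clear; lia.
    rewrite (nth_vec_opt d lR jR) in cj.
    rewrite /output_entry /row.
    have post s3 : (forall y : nat, y != 17 -> y != 20 -> y != 21 -> regs s3 y = regs s2 y) ->
        regs s3 17 = q + 1 + 2 * minn j.+1 (size l) -> regs s3 20 = minn j.+1 (size l) ->
        (forall b, cells s3 b =
          if q + 1 <= b < q + 1 + 2 * minn j.+1 (size l) then nth 0 ps (b - (q + 1))
          else cells s b) ->
        I j.+1 (set_reg s3 19 j.+1).
      move=> hr h17 h20 hc; split=> //.
      + by move=> y y16; rewrite /= /update ltn_eqF ?hr ?h //; lia.
      + by split=> //; rewrite /= /update /= hr.
    rstep (e2, e6, e10, e15, r19, rwE, cj).
    case: (ltnP j (size l)) => jl; last first.
      rstep (e2, ltnNge, jl); last by move: c1; rewrite eqxx.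
      rstep e2; split=> //; apply: post; rewrite /= /update /=.
      - by move=> y h17 h20 h21; rewrite (negPf h21).
      - by rewrite q17'; congr (_ + 2 * _); lia.
      - by rewrite r20; lia.
      - by move=> b; rewrite qc; congr (if _ then _ else _); lia.
    have /andP[i0 idd] := id j jl; have [n1 n2] := nth_pairs jl; rewrite -/ps in n1 n2.
    have m1 : minn j (size l) = j by lia.
    have m2 : minn j.+1 (size l) = j.+1 by lia.
    rewrite m1 in q17' r20 qc; rewrite m2 in post.
    set T := tok d _ _.
    have TI : T - d + (d - T) = (nth (0, false) l j).1.
      by rewrite /T /tok; case: (_.2); lia.
    have TB : (d < T) = (nth (0, false) l j).2 by rewrite /T /tok; case: (_.2); lia.
    have T0 : T != d by rewrite /T /tok; case: (_.2); lia.
    have T2 : T <= 2 * d by rewrite /T /tok; case: (_.2); lia.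
    have b1 := leq_b1 (nth (0, false) l j).2.
    have qW : q + 1 + 2 * j + 10 <= W by move: ql leW jl; clear; lia.
    clearbody T.
    have E := (e2, q17', r20, r19, TI, TB).
    rstep E; first by rewrite c1 in T0.
    do 4 rstep E; split=> //; apply: post; rewrite /= /update /=.
    - by move=> y h17 h20 h21; rewrite (negPf h17) (negPf h20) (negPf h21).
    - by lia.
    - by lia.
    - move=> b; case: eqP => [->|ne1].
        by rewrite ifT -?n2; [congr (nth _ _ _); lia|lia].
      case: eqP => [->|ne2].
        by rewrite ifT -?n1; [congr (nth _ _ _); lia|lia].
      by rewrite qc; congr (if _ then _ else _); lia.
  + by rewrite /=; clear; lia.
- by rewrite /=; lia.
move=> s2 [h _ [r18 r20] q17' qc].
have m2 : minn R.+1 (size l) = size l by move: lR; clear; lia.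
rewrite m2 in r20 q17' qc.
rstep (r18, r20).
have le : size (enc_opt (Some l)) = (2 * size l).+1 by rewrite /= -/ps sz.
apply: fin => //.
- by move=> y y16; rewrite /= h // ss1.
- by rewrite le /= q17'; clear; lia.
- case=> [|k]; rewrite le => kl; rewrite /= /update.
    by rewrite addn0 eqxx addn1.
  rewrite ifN; last by clear; lia.
  rewrite qc ifT; first by congr (nth _ _ _); clear; lia.
  by move: kl; clear; lia.
- move=> b; rewrite le => bb; rewrite /= /update ifN; last by move: bb; clear; lia.
  by rewrite qc ifF //; move: bb; clear; lia.
Qed.

(** The output grows from cell 0 over the input, but its length is at most [2 n (R + 1)], so it
    never reaches the table at [aD] that is still being read. *)
Lemma output_runs s xs t (Q : state -> Prop) :
  output_regs s -> size xs = n -> all (ok_opt d R) xs ->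
  arrs n R s aD (fun v => vec_opt d R (nth None xs v)) ->
  (forall s', arr s' 0 (enc_opts xs) -> Q s') ->
  n * (R.+1 * 80 + 100) + 50 <= t ->
  runs W output_cmd s t Q.
Proof.
move=> [g0 g2 g6 g10] sx ox ax fin tt.
have sz : size (enc_opts xs) <= 2 * (n * R.+1) by rewrite -sx; exact: size_enc_opts ox.
have w0 := W_gt0; rewrite /output_cmd.
rstep g0.
pose p v := size (enc_opts (take v xs)).
have pM v : p v <= aD.
  apply: leq_trans leD; apply: leq_trans sz.
  by rewrite /p -{2}(cat_take_drop v xs) /enc_opts map_cat flatten_cat size_cat leq_addr.
pose I v s2 := [/\ same_regs 15 s s2, regs s2 15 = v, regs s2 17 = p v,
  arr s2 0 (enc_opts (take v xs)) & forall b, aD <= b -> cells s2 b = cells s b].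
apply: (@runs_for W W_gt0 I _ _ _ n (R.+1 * 80 + 80)) => //.
- by move=> v s2 [h _ _ _ _]; rewrite /= h // g0.
- by move=> v s2 [].
- by split; rewrite /p ?take0 //; do !apply: same_set.
- move=> v s2 vn [h r15 r17 av sc]; have vx : v < size xs by rewrite sx.
  have [sv axv] := ax v vn.
  have pv : p v + size (enc_opt (nth None xs v)) = p v.+1.
    by rewrite /p (enc_opts_take vx) size_cat.
  apply: (@output_label_runs s2 v (p v) (nth None xs v)) => //.
  + by split; rewrite h.
  + exact: (allP ox) (mem_nth None vx).
  + by move=> k kx; rewrite -axv // sc // -addnA leq_addr.
  + by rewrite pv.
  move=> s3 h3 q17 a3 sc3; split; first by rewrite h3.
  split=> //.
  + apply: same_set => //; apply: same_regs_trans h _; exact: same_regs_le h3.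
  + by rewrite -pv -q17.
  + rewrite (enc_opts_take vx); apply/arr_cat; split=> //.
    by move=> k kx; rewrite /= sc3 ?av //; left.
  + by move=> b bb; rewrite /= sc3 ?sc //; right; rewrite pv; exact: leq_trans (pM _) bb.
- move=> s2 [_ _ _ av _]; apply: fin.
  by rewrite -sx take_size in av.
- by move: tt; rewrite /=; lia.
Qed.

End Output.

(** * The whole program and its cost *)

Definition program : cmd := (setup_cmd ;; parse_cmd ;; main_loop ;; output_cmd)%C.

Definition total_time (n m R : nat) : nat :=
  R * 30 + n * (R.+1 * 160 + 170) + (n + R.+2) * (round_time n m R + 10) + 300.

(** For [R <= n] and [n > 1] there are at most [3 n] rounds, and [R + 1 <= 2 R] turns the word
    length into a logarithm. Writing constants as products keeps unary numerals small. *)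
Lemma total_time_le n m R : 1 < n -> n <= m -> 0 < R -> R <= n ->
  total_time n m R <= (200 * 100) * (m * n ^ 2 * R).
Proof.
move=> n1 nm R0 Rn; set S := R.+1.
have A1 : n * S <= n * m * S by rewrite leq_mul2r leq_pmulr ?orbT //; lia.
have A2 : m * S <= n * m * S by rewrite leq_mul2r leq_pmull ?orbT //; lia.
have A3 : n * m <= n * m * S by rewrite leq_pmulr.
have A4 : n * 1 <= n * m by rewrite leq_mul2l; lia.
have rt : round_time n m R + 10 <= 3000 * (n * m * S).
  rewrite /round_time -/S.
    move: A1 A2 A3 A4; clear -n1; rewrite !mulnDr !muln1 !mulnA => *; lia.
have k3 : n + R.+2 <= 3 * n by lia.
have h := leq_mul k3 rt.
have A5 : n * m * S <= n * m * S * n by rewrite leq_pmulr //; lia.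
have Z : n * m * S * n <= 2 * (m * n ^ 2 * R).
  have -> : 2 * (m * n ^ 2 * R) = n * m * (2 * R) * n by rewrite expnS expn1; lia.
  by rewrite leq_mul2r leq_mul2l; apply/orP; right; apply/orP; right; rewrite /S; lia.
have h' : 3 * n * (3000 * (n * m * S)) = (90 * 100) * (n * m * S * n).
  by rewrite mulnACA (mulnC n); congr (_ * _); lia.
have A6 : n * (S * 160 + 170) = 160 * (n * S) + 170 * n by rewrite mulnDr; lia.
rewrite /total_time -/S A6; move: h Z A1 A2 A3 A4 A5 n1 Rn; rewrite h' muln1.
move: (n * m * S * n) (m * n ^ 2 * R) (n * m * S) (n * S) (m * S) (n * m) (_ * (_ + 10)).
by move=> a b c e f g k; clear; lia.
Qed.

Lemma total_time1 n m : n <= 1 -> m <= 1 -> total_time n m 0 <= 200 * 100.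
Proof. by case: n m => [|[|//]] [|[|//]]. Qed.

(** Every summand is at most a constant times the square of the base, and since the base is at least
    2, seven further factors absorb the constants. *)
Lemma word_size n m d R aM aT : m <= n ^ 2 -> R <= n ->
  aM = 3 + 3 * n + 2 * m + 2 * (n * R.+1) -> aT = aM + 3 * (n * R.+1) + 2 * n ->
  aT + 8 * d + 4 * R + 100 <= (n + d + 2) ^ 9.
Proof.
set B := n + d + 2 => mn Rn -> ->.
have B2 : 1 < B by rewrite /B; lia.
have nR : n * R.+1 <= B ^ 2 by rewrite expnS expn1 leq_mul // /B; lia.
have mB : m <= B ^ 2 by apply: leq_trans mn _; rewrite leq_exp2r // /B; lia.
have B1 : B * 2 ^ 6 <= B ^ 7 by rewrite (expnS B) leq_mul2l leq_exp2r // B2 orbT.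
have B3 : B ^ 2 * 2 ^ 5 <= B ^ 7 by rewrite (expnD B 2 5) leq_mul2l leq_exp2r // B2 orbT.
have B0 : 2 ^ 7 <= B ^ 7 by rewrite leq_exp2r.
have B9 : B ^ 7 * 2 ^ 2 <= B ^ 9 by rewrite (expnD B 7 2) leq_mul2l leq_exp2r // B2 orbT.
have nB : 2 * n + 2 * d <= 2 * B by rewrite /B; lia.
move: (n * R.+1) (B ^ 2) (B ^ 7) (B ^ 9) nR mB B1 B3 B0 B9 nB => x y z u; clear -Rn; lia.
Qed.

Section Labels.
Variables n h : nat.
Implicit Type x : label n h.

Lemma enc_label_opt x : enc_label x = enc_opt (omap (@enc_leaf n h) x).
Proof. by case: x. Qed.

Lemma toks_enc_leaf (xi : leaf n h) :
  toks h.*2 (indices h) (val xi) = [seq tok h.*2 c.1 c.2 | c <- enc_leaf xi].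
Proof.
rewrite /toks /enc_leaf map_flatten -map_comp; congr flatten; apply: eq_map => c /=.
by rewrite -map_comp.
Qed.

Lemma vec_enc x : vec x = vec_opt h.*2 (trunc_log 2 n) (omap (@enc_leaf n h) x).
Proof. by case: x => //= xi; rewrite toks_enc_leaf. Qed.

Lemma enc_ok x : ok_opt h.*2 (trunc_log 2 n) (omap (@enc_leaf n h) x).
Proof.
case: x => //= xi; rewrite -(size_map (fun c => tok h.*2 c.1 c.2)) -toks_enc_leaf size_leaf /=.
apply/allP=> e /flattenP[s /mapP[c cz ->] /mapP[b _ ->]] /=.
have : c.1 \in indices h.
  have : c.1 \in unzip1 (zip (indices h) (val xi)) by exact: map_f.
  by rewrite unzip1_zip // size_indices size_tuple.
by move/(allP (indicesP h))/andP=> [o lt]; case: c.1 o lt => // k _ /ltnW.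
Qed.

End Labels.

Section Instance.
Variables (G : parity_game) (tau : G -> G) (mu : labeling G) (arcs : seq (G * G)).
Notation n := #|G|.
Notation m := (size arcs).
Notation d := ((maxprio G)./2.*2).
Notation R := (trunc_log 2 n).

Definition gown : nat -> bool := on_node false (fun v : G => v \in odd_nodes G).

Definition gtau : nat -> nat :=
  on_node 0 (fun v : G => if v \in odd_nodes G then enc_node (tau v) else 0).

Definition garcs : seq (nat * nat) := [seq (enc_node e.1, enc_node e.2) | e <- arcs].

Definition genc (nu : labeling G) : seq (option (seq (nat * bool))) :=
  [seq omap (@enc_leaf _ _) (nu v) | v <- enum G].

Lemma size_enum_map T (f : G -> T) : size [seq f v | v <- enum G] = n.
Proof. by rewrite size_map -cardE. Qed.

Lemma size_genc nu : size (genc nu) = n.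
Proof. exact: size_enum_map. Qed.

Lemma enc_labeling_opts nu : enc_labeling nu = enc_opts (genc nu).
Proof.
rewrite /enc_labeling /enc_opts /genc -map_comp; congr flatten; apply: eq_map => v /=.
exact: enc_label_opt.
Qed.

Lemma genc_ok nu : all (ok_opt d R) (genc nu).
Proof. by apply/allP=> _ /mapP[v _ ->]; exact: enc_ok. Qed.

Lemma nth_enum_node T (f : G -> T) (x : T) v : nth x [seq f v | v <- enum G] (enc_node v) = f v.
Proof. by rewrite (nth_map v) ?nth_enum_rank // -cardE enc_node_lt. Qed.

Lemma nth_genc nu v : nth None (genc nu) (enc_node v) = omap (@enc_leaf _ _) (nu v).
Proof. exact: nth_enum_node. Qed.

Lemma arr_enum s a T (g : T -> nat) (f : G -> T) (x : T) :
  arr s a [seq g (f v) | v <- enum G] -> forall i, i < n -> cells s (a + i) = g (on_node x f i).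
Proof.
move=> h i; case/enc_nodeP=> v ->; rewrite on_nodeE -(nth_enum_node (fun v => g (f v)) 0).
by apply: h; rewrite size_map -cardE enc_node_lt.
Qed.

Lemma active_garcs : perm_eq arcs (enum (edges G)) ->
  filter (active_arc gown gtau) garcs = tau_arcs tau arcs.
Proof.
move=> arcs_ok; rewrite /garcs /tau_arcs filter_map; congr map; apply: eq_in_filter => [[v w]] vw /=.
have ve : (v, w) \in edges G by rewrite -mem_enum -(perm_mem arcs_ok).
have -> : ((v, w) \in edges_odd tau) = (v \in even_nodes G) || (w == tau v) by rewrite inE ve.
rewrite /active_arc /gown /gtau /= !on_nodeE [v \in odd_nodes G]inE.
case: (v \in even_nodes G) => //=; rewrite eq_sym.
by apply/eqP/eqP => [/enc_node_inj|->].
Qed.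

Lemma nth_arcs_pairs k :  k < m ->
  let L := flatten [seq [:: enc_node e.1; enc_node e.2] | e <- arcs] in
  nth 0 L (2 * k) = (nth (0, 0) garcs k).1 /\ nth 0 L (2 * k).+1 = (nth (0, 0) garcs k).2.
Proof.
rewrite /garcs; elim: arcs k => // e l IH [|k] // kl; have [h1 h2] := IH k kl.
have -> : 2 * k.+1 = (2 * k).+2 by lia.
by rewrite /= h1 h2.
Qed.

Lemma size_arcs_pairs : size (flatten [seq [:: enc_node e.1; enc_node e.2] | e <- arcs]) = 2 * m.
Proof. by elim: arcs => //= e l ->; lia. Qed.

Lemma size_instance :
  size (enc_instance arcs tau mu) = 3 + 3 * n + 2 * m + size (enc_labeling mu).
Proof. by rewrite /enc_instance !size_cat !size_enum_map size_arcs_pairs /=; lia. Qed.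

Lemma size_arcs : perm_eq arcs (enum (edges G)) -> m = #|edges G|.
Proof. by move=> arcs_ok; rewrite (perm_size arcs_ok) -cardE. Qed.

Lemma card_edges_le : #|edges G| <= n ^ 2.
Proof. by rewrite (leq_trans (max_card _)) // card_prod -mulnn. Qed.

Lemma card_node_le_edges : n <= #|edges G|.
Proof.
pose f (v : G) := (v, xchoose (has_succ v)).
have fi : injective f by move=> v w [].
rewrite -(card_codom fi); apply/subset_leq_card/subsetP=> _ /codomP[v ->].
exact: (xchooseP (has_succ v)).
Qed.

Lemma instance_bound W : 3 + n + m + d + R <= W -> all (leq^~ W) (enc_instance arcs tau mu).
Proof.
move=> h; have dE := maxprioE G; rewrite /enc_instance !all_cat.
have nW (v : G) : enc_node v <= W by have := enc_node_lt v; lia.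
apply/andP; split.
  move: h; rewrite dE /=; clear; move: (trunc_log _ _) => x.
  move: #|G| (size arcs) (maxprio G) => y z u h.
  by do !(apply/andP; split); lia.
apply/and5P; split.
- by apply/allP=> _ /mapP[v _ ->]; case: (_ \in _); lia.
- by apply/allP=> _ /mapP[v _ ->]; have /andP[_] := prio_gt0_le v; lia.
- by apply/allP=> _ /mapP[v _ ->]; case: ifP.
- by apply/allP=> b /flattenP[_ /mapP[e _ ->]]; rewrite !inE => /orP[] /eqP->.
- rewrite enc_labeling_opts; apply/allP=> b /flattenP[_ /mapP[x xe ->]].
  have := allP (genc_ok mu) _ xe; case: x {xe} => [l|_]; last by rewrite inE => /eqP->.
  case/andP=> lR la; rewrite inE => /orP[/eqP->|]; first lia.
  case/flattenP=> _ /mapP[c cl ->]; have := allP la _ cl; rewrite !inE.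
  by case/andP=> _ cd /orP[] /eqP->; [|case: c.2]; lia.
Qed.

End Instance.

Section Program.
Variables (G : parity_game) (tau : G -> G) (mu : labeling G) (arcs : seq (G * G)).
Variables W aM aX aD aC aO aT : nat.
Notation n := #|G|.
Notation m := (size arcs).
Notation d := ((maxprio G)./2.*2).
Notation R := (trunc_log 2 n).
Notation inst := (enc_instance arcs tau mu).
Hypothesis tau_ok : odd_strategy tau.
Hypothesis no_loose : forall v w : G, (v, w) \in edges_odd tau -> ~ loose mu v w.
Hypothesis arcs_ok : perm_eq arcs (enum (edges G)).
Hypothesis eM : aM = 3 + 3 * n + 2 * m + 2 * (n * R.+1).
Hypothesis eX : aX = aM + n * R.+1.
Hypothesis eD : aD = aX + n * R.+1.
Hypothesis eC : aC = aD + n * R.+1.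
Hypothesis eO : aO = aC + n.
Hypothesis eT : aT = aO + n.
Hypothesis leW : aT + 8 * d + 4 * R + 100 <= W.

Let Q s := exists nu, is_least_feasible tau mu nu /\ arr s 0 (enc_labeling nu).

Lemma program_runs s : cells s = nth 0 inst -> runs W program s (total_time n m R) Q.
Proof.
move=> cs.
have W_gt0 : 0 < W by move: leW; clear; lia.
have a0 : arr s 0 inst by move=> k _; rewrite cs.
have := a0; rewrite {1}/enc_instance -(maxprioE G).
case/arr_cat=> aH /arr_cat[aown /arr_cat[apr /arr_cat[atau /arr_cat[aarc alab]]]].
rewrite !size_enum_map ?size_arcs_pairs in aown apr atau aarc alab.
(* Memory past the input is 0, so the bounds start as the zero table that [inv_init] expects. *)
have beyond b : aM <= b -> cells s b = 0.
  move=> Mb; rewrite cs nth_default // size_instance enc_labeling_opts.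
  have := size_enc_opts (genc_ok mu); rewrite size_genc; move: Mb; rewrite eM; clear.
  by move: (size _) => x; lia.
rewrite /program; apply: (@runs_seq_k W W_gt0 (R * 30 + 150)); first by rewrite /total_time; lia.
apply: (@setup_runs W n m d R aM aX aD aC aO aT erefl eM eX eD eC eO eT leW) => //.
move=> s1 cs1 rs1.
apply: (@runs_le _ (n * (R.+1 * 160 + 170) + (n + R.+2) * (round_time n m R + 10) + 140)).
  by rewrite /total_time; lia.
apply: (@runs_seq_k W W_gt0 (n * (R.+1 * 80 + 70) + 50)); first by lia.
apply: (@parse_runs W n m d R aM _ _ _ s1 (genc mu)) => //.
- by rewrite eM.
- by move: leW; rewrite eT eO eC eD eX; clear; lia.
- by move: leW; rewrite eT eO; clear; lia.
- by split; rewrite rs1.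
- exact: size_genc.
- exact: genc_ok.
- rewrite -enc_labeling_opts => k kx; rewrite cs1 -alab //; congr (cells s _).
  by rewrite /=; clear; lia.
move=> s2 rs2 ap cs2.
apply: (@runs_le _ (n * (R.+1 * 80 + 100) + (n + R.+2) * (round_time n m R + 10) + 85)).
  by lia.
have below b : b < aM -> cells s2 b = cells s b by move=> bM; rewrite cs2 ?cs1 //; left.
have above b : aX <= b -> cells s2 b = 0.
  move=> Xb; rewrite cs2 ?cs1; last by right; rewrite -eX.
  by apply: beyond; apply: leq_trans Xb; rewrite eX leq_addr.
(* The tables of base and current labels are filled by the first round; until then they are
   described by whatever their cells hold. *)
pose X0 a v := mkseq (fun k => cells s2 (a + v * R.+1 + k)) R.+1.
have aX0 a : arrs n R s2 a (X0 a).
  by move=> v _; split=> [|k]; rewrite size_mkseq // => kR; rewrite nth_mkseq.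
have hp : heap n m d R aM aX aD aC aO aT (gown G) (gtau tau) (nprio G) (garcs arcs)
    (nvec mu) s2 (X0 aX) (X0 aD) (fun=> 0) (fun=> 0).
  split=> //.
  + by move=> x x11; rewrite rs2 ?rs1 //; apply: leq_trans x11 _.
  + move=> v vn; rewrite below; last by rewrite eM; move: vn; clear; lia.
    by rewrite (arr_enum false aown).
  + move=> v vn; rewrite below; last by rewrite eM; move: vn; clear; lia.
    by rewrite (@arr_enum _ _ _ _ id _ 0 apr).
  + move=> v vn; rewrite below; last by rewrite eM; move: vn; clear; lia.
    rewrite /gtau -(@arr_enum _ _ _ _ id _ 0 atau) //; congr (cells s _).
    by rewrite /=; clear; lia.
  + move=> k km; rewrite below; last by rewrite eM; move: km; clear; lia.
    have [<- _] := nth_arcs_pairs km; rewrite -aarc; last by rewrite size_arcs_pairs ltn_mul2l.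
    by congr (cells s _); rewrite /=; clear; lia.
  + move=> k km; rewrite below; last by rewrite eM; move: km; clear; lia.
    have [_ <-] := nth_arcs_pairs km; rewrite -aarc; last first.
      by rewrite size_arcs_pairs; move: km; clear; lia.
    by congr (cells s _); rewrite /=; clear; lia.
  + move=> v vn; have := ap v vn; case/enc_nodeP: vn => u ->.
    by rewrite nth_genc -vec_enc /nvec on_nodeE.
  + by move=> v vn; apply: above; rewrite eC eD; clear; lia.
  + by move=> v vn; apply: above; rewrite eO eC eD; clear; lia.
apply: (@runs_seq_k W W_gt0 ((n + R.+2) * (round_time n m R + 10) + 30)); first by lia.
apply: (@main_loop_runs W n m d R aM aX aD aC aO aT (gown G) (gtau tau) (nprio G) (garcs arcs)
  (nvec mu) _ _ _ _ _ _ leW _ _ _ _ _ _ _ s2 _ _ _ _ _ hp) => //.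
- by rewrite eM leq_addr.
- by rewrite eX.
- by rewrite eD.
- by rewrite eC.
- by rewrite eO.
- by rewrite eT.
- exact: d_gt0.
- by rewrite size_map.
- by move=> _ /mapP[e _ ->] /=; rewrite !enc_node_lt.
- by move=> v /enc_nodeP[u ->]; rewrite /nprio on_nodeE prio_gt0_le.
- exact: nvec_valid.
- by rewrite (active_garcs tau arcs_ok); exact: tau_arcs_succ.
- by rewrite (active_garcs tau arcs_ok); exact: nvec_lift.
move=> s3 X D c ok hp3 vD lf.
apply: (@runs_le _ (n * (R.+1 * 80 + 100) + 50)); first by lia.
have [nu lnu nuE] : exists2 nu, is_least_feasible tau mu nu & forall v, vec (nu v) = D (enc_node v).
  case: (posnP n) => [n0|n0].
    have no v : v < n -> False by rewrite n0.
    by apply: (least_feasible_of tau_ok arcs_ok) => // [v /no|v /no|nu _ _ _ v /no].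
  have [h1 h2 h3] := lf n0; rewrite (active_garcs tau arcs_ok) in h2 h3.
  exact: (least_feasible_of tau_ok arcs_ok).
apply: (@output_runs W n d R aD _ _ _ s3 (genc nu)) => //.
- by rewrite eD eX eM; clear; lia.
- by move: leW; rewrite eT eO eC; clear; lia.
- by move: leW; rewrite eT eO; clear; lia.
- by split; rewrite (heap_glob hp3).
- exact: size_genc.
- exact: genc_ok.
- move=> v vn; have := heap_D hp3 vn; case/enc_nodeP: vn => u ->.
  by rewrite nth_genc -nuE vec_enc.
- by rewrite -enc_labeling_opts => s4 a4; exists nu.
Qed.

End Program.

Theorem theorem4p18 :
  exists (P : cmd) (k C : nat),
  forall (G : parity_game) (tau : G -> G) (mu : labeling G)
         (arcs : seq (G * G)),
    odd_strategy tau ->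
    (forall v w : G, (v, w) \in edges_odd tau -> ~ loose mu v w) ->
    perm_eq arcs (enum (edges G)) ->
    exists (nu : labeling G) (t : nat),
      [/\ is_least_feasible tau mu nu,
          computes_in P ((#|G| + maxprio G + 2) ^ k) t
            (enc_instance arcs tau mu) (enc_labeling nu)
        & t <= C * (#|edges G| * #|G| ^ 2 * trunc_log 2 #|G|
                      * trunc_log 2 (maxprio G) + 1)].
Proof.
exists program, 9, (200 * 100) => G tau mu arcs tau_ok no_loose arcs_ok.
set W := _ ^ 9; have mE := size_arcs arcs_ok; have mn := card_edges_le G.
have nm := card_node_le_edges G.
have Rn : trunc_log 2 #|G| <= #|G|.
  case: (posnP #|G|) => [->|n0]; first by rewrite trunc_log0.
  by apply: leq_trans (trunc_logP _ n0); [exact: ltnW (ltn_expl _ _)|].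
have leW : 3 + 3 * #|G| + 2 * size arcs + 2 * (#|G| * (trunc_log 2 #|G|).+1) +
    #|G| * (trunc_log 2 #|G|).+1 + #|G| * (trunc_log 2 #|G|).+1 +
    #|G| * (trunc_log 2 #|G|).+1 + #|G| + #|G| +
    8 * (maxprio G)./2.*2 + 4 * trunc_log 2 #|G| + 100 <= W.
  rewrite mE maxprioE /W; apply: leq_trans (word_size (maxprio G) mn Rn erefl erefl).
  by clear; lia.
pose s0 := State (fun=> 0) (nth 0 (enc_instance arcs tau mu)).
have cs : cells s0 = nth 0 (enc_instance arcs tau mu) by [].
(* All rules for [runs] presuppose that the memory holds words of size at most [W], so this is
   checked for the input. *)
have b0 : bounded_state W s0.
  split=> // a /=; case: (ltnP a (size (enc_instance arcs tau mu))) => ai.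
    have /allP ib : all (leq^~ W) (enc_instance arcs tau mu).
      by apply: instance_bound; move: leW; clear; lia.
    exact: ib (mem_nth 0 ai).
  by rewrite nth_default.
have [s [t [ex tT [nu [lf an]]]]] :=
  program_runs tau_ok no_loose arcs_ok erefl erefl erefl erefl erefl erefl leW cs b0.
exists nu, t; split=> //; first by exists s; split=> // i /an.
apply: leq_trans tT _; rewrite mE.
(* With at most one node the logarithm of [n] vanishes, only the summand 1 of the bound remains, and
   the constant alone has to cover the time. *)
case: (leqP #|G| 1) => n1.
  have -> : trunc_log 2 #|G| = 0 by apply/eqP; rewrite trunc_log_eq0.
  rewrite muln0 mul0n muln1; apply: total_time1 => //.
  by apply: leq_trans mn _; case: #|G| n1 => [|[]].
have R0 : 0 < trunc_log 2 #|G| by rewrite trunc_log_gt0.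
apply: leq_trans (total_time_le n1 nm R0 Rn) _; rewrite leq_mul2l.
apply/orP; right; apply: leq_trans (leq_addr _ _); apply: leq_pmulr.
(* A node has a positive priority, so the even [maxprio] is at least 2 and its logarithm at least 1;
   multiplying by it does not shrink the bound. *)
have /card_gt0P[v _] : 0 < #|G| by exact: ltnW.
by rewrite trunc_log_gt0 /= -(maxprioE G); have := h_gt0 v; clear; lia.
Qed.
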